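(* Let $\mathcal{F}$ be a codimension one distribution of degree $d$ on $\mathbb{P}^3$ such that its tangent sheaf $T_{\mathcal{F}}$ is nonsplit. Let $\varepsilon\in\{0,1\}$ with $\varepsilon\equiv d \pmod 2$. Then $T_{\mathcal{F}}$ is unstable if and only if $d\geq 3$ and $$1\leq t_{\mathcal{F}}\leq \frac{d-2+\varepsilon}{2}.$$ Moreover, in this case $T_{\mathcal{F}}$ is unstable of order $\frac{d+\varepsilon}{2}-t_{\mathcal{F}}$.
   Context: Work over $\mathbb{C}$. A codimension one distribution $\mathcal{F}$ of degree $d\ge 0$ on $\mathbb{P}^3$ is an exact sequence $0\to T_{\mathcal{F}}\to T\mathbb{P}^3\to \mathcal{I}_Z(d+2)\to 0$, where $T_{\mathcal{F}}$ (the tangent sheaf) is a rank 2 reflexive sheaf and $\mathcal{I}_Z$ is the ideal sheaf of a closed subscheme $Z=\mathrm{Sing}(\mathcal{F})$ of codimension at least 2. Define $t_{\mathcal{F}}:=\min\{k\in\mathbb{Z}: H^0(T_{\mathcal{F}}(k-1))\neq 0\}$. A rank 2 sheaf is split if it is a direct sum of line bundles. For a rank 2 reflexive sheaf $F$ on $\mathbb{P}^3$ the normalization is $F_\eta=F(-c_1(F)/2)$ if $c_1(F)$ is even and $F_\eta=F(-(c_1(F)+1)/2)$ if $c_1(F)$ is odd. $F$ is unstable of order $r$ if $r$ is a positive integer and is maximal with the property $H^0((F_\eta)^\vee(-r))\ne 0$; $F$ is unstable if it is unstable of order $r$ for some $r\ge 1$ (equivalently, $F$ is not $\mu$-semistable).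 *)

(* Defs.v *)
From HB Require Import structures.
From mathcomp Require Import all_boot all_order all_algebra.
From mathcomp Require Export boolp classical_sets reals.
From mathcomp Require Export mpoly complex.

Set Implicit Arguments.
Unset Strict Implicit.
Unset Printing Implicit Defensive.

Import Order.TTheory GRing.Theory Num.Theory.
Local Open Scope classical_set_scope.
Local Open Scope ring_scope.

(* Projective 3-space over an algebraically closed field K is treated as a
   classical variety.  A point is given by homogeneous coordinates, that is, by
   a nonzero vector 'I_4 -> K up to scaling; accordingly a subset of P^3 is
   represented by the set of the nonzero vectors lying over it. *)

Section ProjectiveSpace.
Variable K : closedFieldType.

Definition vec := 'I_4 -> K.
Definition nz (x : vec) : Prop := exists i, x i != 0.

(* Zariski open sets: complements of the common zeros of a set of homogeneous
   polynomials. *)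
Definition is_zopen (U : set vec) : Prop :=
  exists S : set {mpoly K[4]},
    (forall p, S p -> exists m : nat, p \is m.-homog) /\
    U = [set x | nz x /\ exists2 p, S p & p.@[x] != 0].

Record zopen := ZOpen { pts :> set vec; zopenP : is_zopen pts }.
Implicit Types U V W T : zopen.

Fact PP_subproof : is_zopen [set x | nz x].
Proof.
exists [set 1]; split=> [p ->|]; first by exists 0%N; apply: dhomog1.
apply/seteqP; split=> x /=; last by case.
by move=> nzx; split=> //; exists 1 => //; rewrite meval1 oner_neq0.
Qed.
Definition PP := ZOpen PP_subproof.

Lemma subPP (U : zopen) : U `<=` PP.
Proof. by have [S [_ ->]] := zopenP U; move=> x []. Qed.

Definition zclosed (Y : set vec) : Prop :=
  exists U : zopen, Y = [set x | nz x /\ ~ pts U x].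

Definition zirreducible (Y : set vec) : Prop :=
  [/\ zclosed Y, Y !=set0 &
    forall Y1 Y2, zclosed Y1 -> zclosed Y2 -> Y = Y1 `|` Y2 ->
      Y = Y1 \/ Y = Y2].

Definition codim_ge2 (Z : set vec) : Prop :=
  forall Y0, zirreducible Y0 -> Y0 `<=` Z ->
    exists Y1 Y2, [/\ zirreducible Y1, zirreducible Y2, Y0 `<` Y1 & Y1 `<` Y2].

(* Sections of O(k) over U: functions on the cone over U which are locally
   quotients p / q of homogeneous polynomials with deg p - deg q = k.  Such a
   function is extended by 0 outside U, so that equality of sections is
   equality of functions. *)
Definition regular (k : int) (U : zopen) (f : vec -> K) : Prop :=
  (forall x, ~ pts U x -> f x = 0) /\
  forall x, pts U x -> exists (p q : {mpoly K[4]}) (m n : nat),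
    [/\ p \is m.-homog, q \is n.-homog, m%:Z = n%:Z + k, q.@[x] != 0 &
        forall y, pts U y -> q.@[y] != 0 -> f y = p.@[y] / q.@[y]].

Record reg (k : int) (U : zopen) :=
  Reg { rfun :> vec -> K; regP : regular k U rfun }.

Lemma reg_inj k U (f g : reg k U) : (forall x, f x = g x) -> f = g.
Proof.
move=> fg; have {fg} : rfun f = rfun g by apply: functional_extensionality_dep.
case: f g => f fP [g gP] /= e; subst g; congr Reg; exact: Prop_irrelevance.
Qed.

Lemma reg_out k U (f : reg k U) x : ~ pts U x -> f x = 0.
Proof. by have [fP _] := regP f; apply: fP. Qed.

Fact reg0_subproof k U : regular k U (fun=> 0).
Proof.
split=> // x Ux; have [i xi] := subPP Ux.
have hX n : ('X_i ^+ n : {mpoly K[4]}) \is n.-homog.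
  by rewrite -[X in X.-homog]mul1n; apply: dhomogMn; rewrite dhomogX /= mdeg1.
have hE n y : ('X_i ^+ n : {mpoly K[4]}).@[y] = y i ^+ n.
  by rewrite rmorphXn /= mevalXU.
case: k => n.
- exists 0, 1, n, 0%N; split; rewrite ?rpred0 ?dhomog1 ?add0r ?meval1 ?oner_neq0 //.
  by move=> y _ _; rewrite meval0 mul0r.
exists 0, ('X_i ^+ n.+1), 0%N, n.+1; split; rewrite ?rpred0 ?hX //.
- by rewrite NegzE subrr.
- by rewrite hE expf_neq0.
by move=> y _ _; rewrite meval0 mul0r.
Qed.
Definition reg0 k U := Reg (reg0_subproof k U).

Fact regD_subproof k U (f g : reg k U) : regular k U (fun x => f x + g x).
Proof.
split=> [x Ux|x Ux]; first by rewrite !reg_out // addr0.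
have [_ /(_ x Ux)[p [q [a [b [hp hq e qx fE]]]]]] := regP f.
have [_ /(_ x Ux)[p' [q' [a' [b' [hp' hq' e' qx' gE]]]]]] := regP g.
have ab : (a + b' = b + a')%N.
  by apply/eqP; rewrite -eqz_nat !PoszD e e' addrAC addrA.
exists (p * q' + q * p'), (q * q'), (a + b')%N, (b + b')%N; split.
- by apply: rpredD; [apply: dhomogM | rewrite ab; apply: dhomogM].
- exact: dhomogM.
- by rewrite !PoszD e addrAC.
- by rewrite mevalM mulf_neq0.
move=> y Uy; rewrite mevalM mulf_eq0 negb_or => /andP[qy qy'].
by rewrite fE // gE // mevalD !mevalM addf_div // [p'.@[y] * _]mulrC.
Qed.
Definition regD k U (f g : reg k U) := Reg (regD_subproof f g).

Fact regN_subproof k U (f : reg k U) : regular k U (fun x => - f x).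
Proof.
split=> [x Ux|x Ux]; first by rewrite reg_out // oppr0.
have [_ /(_ x Ux)[p [q [a [b [hp hq e qx fE]]]]]] := regP f.
exists (- p), q, a, b; split=> //; first by rewrite rpredN.
by move=> y Uy qy; rewrite fE // mevalN mulNr.
Qed.
Definition regN k U (f : reg k U) := Reg (regN_subproof f).

Fact regM_subproof j k U (f : reg j U) (g : reg k U) :
  regular (j + k) U (fun x => f x * g x).
Proof.
split=> [x Ux|x Ux]; first by rewrite reg_out // mul0r.
have [_ /(_ x Ux)[p [q [a [b [hp hq e qx fE]]]]]] := regP f.
have [_ /(_ x Ux)[p' [q' [a' [b' [hp' hq' e' qx' gE]]]]]] := regP g.
exists (p * p'), (q * q'), (a + a')%N, (b + b')%N; split.
- exact: dhomogM.
- exact: dhomogM.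
- by rewrite !PoszD e e' addrACA.
- by rewrite mevalM mulf_neq0.
move=> y Uy; rewrite mevalM mulf_eq0 negb_or => /andP[qy qy'].
by rewrite fE // gE // !mevalM mulf_div.
Qed.

Definition indic (U : zopen) (x : vec) : K := if `[< pts U x >] then 1 else 0.

Fact regC_subproof U (c : K) : regular 0 U (fun x => c * indic U x).
Proof.
rewrite /indic; split=> x Ux; first by rewrite asboolF // mulr0.
exists c%:MP, 1, 0%N, 0%N; split; rewrite ?dhomog1 ?meval1 ?oner_neq0 //.
  by rewrite -[c%:MP]mulr1 mul_mpolyC; apply: rpredZ; apply: dhomog1.
by move=> y Uy _; rewrite asboolT // mulr1 mevalC meval1 divr1.
Qed.
Definition regC U c : reg 0 U := Reg (regC_subproof U c).

Fact regR_subproof k (U V : zopen) (VU : V `<=` U) (f : reg k U) :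
  regular k V (fun x => f x * indic V x).
Proof.
rewrite /indic; split=> x Vx; first by rewrite asboolF // mulr0.
have [_ /(_ x (VU x Vx))[p [q [a [b [hp hq e qx fE]]]]]] := regP f.
exists p, q, a, b; split=> // y Vy qy.
by rewrite asboolT // mulr1 fE //; apply: VU.
Qed.
Definition regR k (U V : zopen) (VU : V `<=` U) (f : reg k U) : reg k V :=
  Reg (regR_subproof VU f).

Lemma indicE (U : zopen) x : pts U x -> indic U x = 1.
Proof. by move=> Ux; rewrite /indic asboolT. Qed.

Lemma regRE k (U V : zopen) (VU : V `<=` U) (f : reg k U) x :
  pts V x -> regR VU f x = f x.
Proof. by move=> Vx; rewrite /= indicE // mulr1. Qed.

Lemma reg_eqP k U (f g : reg k U) : (forall x, pts U x -> f x = g x) -> f = g.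
Proof.
move=> fg; apply: reg_inj => x; have [/fg//|nUx] := pselect (pts U x).
by rewrite !reg_out.
Qed.

HB.instance Definition _ k U := gen_eqMixin (reg k U).
HB.instance Definition _ k U := gen_choiceMixin (reg k U).

Fact regDA k U : associative (@regD k U).
Proof. by move=> f g h; apply: reg_inj => x /=; rewrite addrA. Qed.
Fact regDC k U : commutative (@regD k U).
Proof. by move=> f g; apply: reg_inj => x /=; rewrite addrC. Qed.
Fact reg0D k U : left_id (reg0 k U) (@regD k U).
Proof. by move=> f; apply: reg_inj => x /=; rewrite add0r. Qed.
Fact regND k U : left_inverse (reg0 k U) (@regN k U) (@regD k U).
Proof. by move=> f; apply: reg_inj => x /=; rewrite addNr. Qed.
HB.instance Definition _ k U := GRing.isZmodule.Build (reg k U)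
  (@regDA k U) (@regDC k U) (@reg0D k U) (@regND k U).

Definition OO (U : zopen) := reg 0 U.
HB.instance Definition _ U := GRing.Zmodule.on (OO U).

Definition OOM U (f g : OO U) : OO U := Reg (regM_subproof f g).
Fact OOMA U : associative (@OOM U).
Proof. by move=> f g h; apply: reg_inj => x /=; rewrite mulrA. Qed.
Fact OOMC U : commutative (@OOM U).
Proof. by move=> f g; apply: reg_inj => x /=; rewrite mulrC. Qed.
Fact OO1M U : left_id (regC U 1 : OO U) (@OOM U).
Proof. by move=> f; apply: reg_eqP => x Ux /=; rewrite indicE // !mul1r. Qed.
Fact OOMD U : left_distributive (@OOM U) +%R.
Proof. by move=> f g h; apply: reg_inj => x /=; rewrite mulrDl. Qed.
HB.instance Definition _ U := GRing.Zmodule_isComPzRing.Build (OO U)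
  (@OOMA U) (@OOMC U) (@OO1M U) (@OOMD U).

Fact regZ_subproof k U (a : OO U) (f : reg k U) :
  regular k U (fun x => a x * f x).
Proof. by have := regM_subproof a f; rewrite add0r. Qed.
Definition regZ k U (a : OO U) (f : reg k U) := Reg (regZ_subproof a f).
Fact regZA k U (a b : OO U) (f : reg k U) : regZ a (regZ b f) = regZ (a * b) f.
Proof. by apply: reg_inj => x /=; rewrite mulrA. Qed.
Fact reg1Z k U : left_id (1 : OO U) (@regZ k U).
Proof. by move=> f; apply: reg_eqP => x Ux /=; rewrite indicE // !mul1r. Qed.
Fact regZDr k U : right_distributive (@regZ k U) +%R.
Proof. by move=> a f g; apply: reg_inj => x /=; rewrite mulrDr. Qed.
Fact regZDl k U (f : reg k U) : {morph (@regZ k U)^~ f : a b / a + b}.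
Proof. by move=> a b; apply: reg_inj => x /=; rewrite mulrDl. Qed.
HB.instance Definition _ k U := GRing.Zmodule_isLmodule.Build (OO U) (reg k U)
  (@regZA k U) (@reg1Z k U) (@regZDr k U) (@regZDl k U).

Definition OOres (U V : zopen) (VU : V `<=` U) (f : OO U) : OO V := regR VU f.

Lemma OOresM U V (VU : V `<=` U) f g :
  OOres VU (f * g) = OOres VU f * OOres VU g.
Proof. by apply: reg_eqP => x Vx /=; rewrite indicE // !mulr1. Qed.
Lemma OOresD U V (VU : V `<=` U) f g :
  OOres VU (f + g) = OOres VU f + OOres VU g.
Proof. by apply: reg_eqP => x Vx /=; rewrite indicE // !mulr1. Qed.
Lemma OOres1 U V (VU : V `<=` U) : OOres VU 1 = 1.
Proof. by apply: reg_eqP => x Vx /=; rewrite !indicE ?mulr1 //; apply: VU. Qed.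
Lemma OOres_comp U V W (VU : V `<=` U) (WV : W `<=` V) (WU : W `<=` U) f :
  OOres WV (OOres VU f) = OOres WU f.
Proof.
by apply: reg_eqP => x Wx /=; rewrite !indicE ?mulr1 //; apply: WV.
Qed.

(* Presheaves of O-modules.  The sheaf condition is the separate predicate
   [is_sheaf]; the constructions below (O(k), Hom, ...) yield sheaves whenever
   their arguments are sheaves. *)
Record omod := OMod {
  sec :> forall U : zopen, lmodType (OO U);
  res : forall U V : zopen, V `<=` U -> sec U -> sec V;
  res_linear : forall U V (VU : V `<=` U) (a : OO U) (s t : sec U),
    res VU (a *: s + t) = OOres VU a *: res VU s + res VU t;
  res_id : forall U (UU : U `<=` U) (s : sec U), res UU s = s;
  res_comp : forall U V W (VU : V `<=` U) (WV : W `<=` V) (WU : W `<=` U)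
    (s : sec U), res WV (res VU s) = res WU s }.
Arguments res {o U V}.

Definition is_sheaf (F : omod) : Prop :=
  forall (U : zopen) (I : Type) (W : I -> zopen) (WU : forall i, W i `<=` U),
    U `<=` \bigcup_i W i ->
  forall s : forall i, F (W i),
    (forall i j (V : zopen) (Vi : V `<=` W i) (Vj : V `<=` W j),
       res Vi (s i) = res Vj (s j)) ->
  exists! t : F U, forall i, res (WU i) t = s i.

Definition locally (U : zopen) (P : forall V : zopen, V `<=` U -> Prop) : Prop :=
  forall x, pts U x -> exists (V : zopen) (VU : V `<=` U), pts V x /\ P V VU.

Fact Osh_linear k (U V : zopen) (VU : V `<=` U) (a : OO U) (s t : reg k U) :
  regR VU (a *: s + t) = OOres VU a *: regR VU s + regR VU t.
Proof. by apply: reg_eqP => x Vx /=; rewrite indicE // !mulr1. Qed.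
Fact Osh_id k (U : zopen) (UU : U `<=` U) (s : reg k U) : regR UU s = s.
Proof. by apply: reg_eqP => x Ux /=; rewrite indicE // mulr1. Qed.
Fact Osh_comp k (U V W : zopen) (VU : V `<=` U) (WV : W `<=` V) (WU : W `<=` U)
  (s : reg k U) : regR WV (regR VU s) = regR WU s.
Proof. by apply: reg_eqP => x Wx /=; rewrite !indicE ?mulr1 //; apply: WV. Qed.
Definition Osh (k : int) : omod := OMod (@Osh_linear k) (@Osh_id k) (@Osh_comp k).

Section DirectSum.
Variables F G : omod.
Definition dsum_res (U V : zopen) (VU : V `<=` U) (s : (F U * G U)%type) :
  (F V * G V)%type := (res VU s.1, res VU s.2).
Fact dsum_linear U V (VU : V `<=` U) (a : OO U) (s t : (F U * G U)%type) :
  dsum_res VU (a *: s + t) = OOres VU a *: dsum_res VU s + dsum_res VU t.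
Proof. by rewrite /dsum_res !res_linear. Qed.
Fact dsum_id (U : zopen) (UU : U `<=` U) s : dsum_res UU s = s.
Proof. by case: s => s t; rewrite /dsum_res !res_id. Qed.
Fact dsum_comp U V W (VU : V `<=` U) (WV : W `<=` V) (WU : W `<=` U) s :
  dsum_res WV (dsum_res VU s) = dsum_res WU s.
Proof. by rewrite /dsum_res !(res_comp _ _ WU). Qed.
Definition dsum : omod := OMod dsum_linear dsum_id dsum_comp.
End DirectSum.

(* Families of maps X V -> G V indexed by the open subsets V of U. Morphism
   sheaves, alternating forms and derivations are cut out inside such
   families. *)
Section Families.
Variables (X : zopen -> Type) (G : omod).

Definition fam (U : zopen) := forall V : zopen, V `<=` U -> X V -> G V.

Lemma famP U (f g : fam U) : (forall V VU x, f V VU x = g V VU x) -> f = g.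
Proof.
move=> fg; apply: functional_extensionality_dep => V.
apply: functional_extensionality_dep => VU.
by apply: functional_extensionality_dep => x.
Qed.

HB.instance Definition _ U := gen_eqMixin (fam U).
HB.instance Definition _ U := gen_choiceMixin (fam U).

Definition fam0 U : fam U := fun V VU x => 0.
Definition famD U (f g : fam U) : fam U := fun V VU x => f V VU x + g V VU x.
Definition famN U (f : fam U) : fam U := fun V VU x => - f V VU x.
Definition famZ U (a : OO U) (f : fam U) : fam U :=
  fun V VU x => OOres VU a *: f V VU x.

Fact famDA U : associative (@famD U).
Proof. by move=> f g h; apply: famP => V VU x; apply: addrA. Qed.
Fact famDC U : commutative (@famD U).
Proof. by move=> f g; apply: famP => V VU x; apply: addrC. Qed.
Fact fam0D U : left_id (@fam0 U) (@famD U).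
Proof. by move=> f; apply: famP => V VU x; apply: add0r. Qed.
Fact famND U : left_inverse (@fam0 U) (@famN U) (@famD U).
Proof. by move=> f; apply: famP => V VU x; apply: addNr. Qed.
HB.instance Definition _ U := GRing.isZmodule.Build (fam U)
  (@famDA U) (@famDC U) (@fam0D U) (@famND U).

Fact famZA U (a b : OO U) (f : fam U) : famZ a (famZ b f) = famZ (a * b) f.
Proof. by apply: famP => V VU x; rewrite /famZ OOresM scalerA. Qed.
Fact fam1Z U : left_id (1 : OO U) (@famZ U).
Proof. by move=> f; apply: famP => V VU x; rewrite /famZ OOres1 scale1r. Qed.
Fact famZDr U : right_distributive (@famZ U) +%R.
Proof. by move=> a f g; apply: famP => V VU x; apply: scalerDr. Qed.
Fact famZDl U (f : fam U) : {morph (@famZ U)^~ f : a b / a + b}.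
Proof.
by move=> a b; apply: famP => V VU x; rewrite /famZ OOresD; apply: scalerDl.
Qed.
HB.instance Definition _ U := GRing.Zmodule_isLmodule.Build (OO U) (fam U)
  (@famZA U) (@fam1Z U) (@famZDr U) (@famZDl U).

Definition famR (U V : zopen) (VU : V `<=` U) (f : fam U) : fam V :=
  fun W WV x => f W (subset_trans WV VU) x.

Fact Fam_linear U V (VU : V `<=` U) (a : OO U) (s t : fam U) :
  famR VU (a *: s + t) = OOres VU a *: famR VU s + famR VU t.
Proof.
apply: famP => W WV x; congr (_ *: _ + _).
by symmetry; apply: OOres_comp.
Qed.
Fact Fam_id (U : zopen) (UU : U `<=` U) (f : fam U) : famR UU f = f.
Proof.
by apply: famP => V VU x; congr (f V _ x); apply: Prop_irrelevance.
Qed.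
Fact Fam_comp U V W (VU : V `<=` U) (WV : W `<=` V) (WU : W `<=` U)
  (f : fam U) : famR WV (famR VU f) = famR WU f.
Proof.
by apply: famP => T TW x; congr (f T _ x); apply: Prop_irrelevance.
Qed.
Definition Fam : omod := OMod Fam_linear Fam_id Fam_comp.
End Families.

Record sub_closed (M : omod) (P : forall U, M U -> Prop) : Prop := SubClosed {
  sub_closed0 : forall U, P U 0;
  sub_closed_linear : forall U (a : OO U) s t, P U s -> P U t -> P U (a *: s + t);
  sub_closed_res : forall U V (VU : V `<=` U) s, P U s -> P V (res VU s) }.

Section SubModule.
Variables (M : omod) (P : forall U, M U -> Prop) (clP : sub_closed P).

Record subsec (clP : sub_closed P) (U : zopen) :=
  SubSec { sval :> M U; subsecP : P sval }.
Local Notation S := (subsec clP).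

Lemma subsec_inj U (s t : S U) : sval s = sval t -> s = t.
Proof.
case: s t => s sP [t tP] /= e; subst t; congr SubSec; exact: Prop_irrelevance.
Qed.

HB.instance Definition _ U := gen_eqMixin (S U).
HB.instance Definition _ U := gen_choiceMixin (S U).

Fact subD_subproof U (s t : S U) : P (sval s + sval t).
Proof.
by rewrite -[sval s]scale1r; apply: (sub_closed_linear clP); apply: subsecP.
Qed.
Fact subZ_subproof U (a : OO U) (s : S U) : P (a *: sval s).
Proof.
rewrite -[_ *: _]addr0; apply: (sub_closed_linear clP); first exact: subsecP.
exact: sub_closed0.
Qed.
Fact subN_subproof U (s : S U) : P (- sval s).
Proof. by rewrite -scaleN1r; apply: subZ_subproof. Qed.

Definition sub0 U : S U := SubSec clP (sub_closed0 clP U).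
Definition subD U (s t : S U) : S U := SubSec clP (subD_subproof s t).
Definition subN U (s : S U) : S U := SubSec clP (subN_subproof s).
Definition subZ U (a : OO U) (s : S U) : S U := SubSec clP (subZ_subproof a s).

Fact subDA U : associative (@subD U).
Proof. by move=> f g h; apply: subsec_inj; apply: addrA. Qed.
Fact subDC U : commutative (@subD U).
Proof. by move=> f g; apply: subsec_inj; apply: addrC. Qed.
Fact sub0D U : left_id (@sub0 U) (@subD U).
Proof. by move=> f; apply: subsec_inj; apply: add0r. Qed.
Fact subND U : left_inverse (@sub0 U) (@subN U) (@subD U).
Proof. by move=> f; apply: subsec_inj; apply: addNr. Qed.
HB.instance Definition _ U := GRing.isZmodule.Build (S U)
  (@subDA U) (@subDC U) (@sub0D U) (@subND U).

Fact subZA U (a b : OO U) (f : S U) : subZ a (subZ b f) = subZ (a * b) f.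
Proof. by apply: subsec_inj; apply: scalerA. Qed.
Fact sub1Z U : left_id (1 : OO U) (@subZ U).
Proof. by move=> f; apply: subsec_inj; apply: scale1r. Qed.
Fact subZDr U : right_distributive (@subZ U) +%R.
Proof. by move=> a f g; apply: subsec_inj; apply: scalerDr. Qed.
Fact subZDl U (f : S U) : {morph (@subZ U)^~ f : a b / a + b}.
Proof. by move=> a b; apply: subsec_inj; apply: scalerDl. Qed.
HB.instance Definition _ U := GRing.Zmodule_isLmodule.Build (OO U) (S U)
  (@subZA U) (@sub1Z U) (@subZDr U) (@subZDl U).

Definition sub_res (U V : zopen) (VU : V `<=` U) (s : S U) : S V :=
  SubSec clP (sub_closed_res clP VU (subsecP s)).

Fact sub_linear U V (VU : V `<=` U) (a : OO U) (s t : S U) :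
  sub_res VU (a *: s + t) = OOres VU a *: sub_res VU s + sub_res VU t.
Proof. by apply: subsec_inj; apply: res_linear. Qed.
Fact sub_id (U : zopen) (UU : U `<=` U) (s : S U) : sub_res UU s = s.
Proof. by apply: subsec_inj; apply: res_id. Qed.
Fact sub_comp U V W (VU : V `<=` U) (WV : W `<=` V) (WU : W `<=` U)
  (s : S U) : sub_res WV (sub_res VU s) = sub_res WU s.
Proof. by apply: subsec_inj; apply: res_comp. Qed.
Definition SubMod : omod := OMod sub_linear sub_id sub_comp.
End SubModule.

Lemma res0 (F : omod) U V (VU : V `<=` U) : res VU (0 : F U) = 0.
Proof.
have := res_linear VU 1 (0 : F U) 0.
rewrite scaler0 addr0 OOres1 scale1r => /(congr1 (fun s => s - res VU 0)).
by rewrite subrr addrK.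
Qed.

(* Hom F G is the sheaf of O-linear maps: its sections over U are the morphisms
   from the restriction of F to U to the restriction of G to U. *)
Definition is_hom (F G : omod) (U : zopen) (f : Fam (fun V => F V) G U) : Prop :=
  (forall V (VU : V `<=` U) (a : OO V) (s t : F V),
     f V VU (a *: s + t) = a *: f V VU s + f V VU t) /\
  (forall V W (VU : V `<=` U) (WU : W `<=` U) (WV : W `<=` V) (s : F V),
     f W WU (res WV s) = res WV (f V VU s)).

Fact is_hom_closed F G : sub_closed (@is_hom F G).
Proof.
split=> [U|U a f g [fL fR] [gL gR]|U V VU f [fL fR]]; split.
- by move=> V VU a s t; rewrite /= scaler0 addr0.
- by move=> V W VU WU WV s; rewrite res0.
- move=> V VU b s t /=.
  have E u : (a *: f + g) V VU u = OOres VU a *: f V VU u + g V VU u by [].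
  by rewrite !E fL gL !scalerDr !scalerA [_ * b]mulrC addrACA.
- move=> V W VU WU WV s.
  have E T TU u : (a *: f + g) T TU u = OOres TU a *: f T TU u + g T TU u by [].
  by rewrite !E (fR _ _ VU) (gR _ _ VU) res_linear (OOres_comp _ _ WU).
- by move=> W WV a s t; apply: fL.
- by move=> W T WV TV TW s; apply: fR.
Qed.
Definition Hom (F G : omod) : omod := SubMod (is_hom_closed F G).

Definition app (F G : omod) (U : zopen) (f : Hom F G U) (V : zopen)
  (VU : V `<=` U) (s : F V) : G V :=
  (sval (f : subsec (is_hom_closed F G) U) : fam (fun V => F V) G U) V VU s.

Definition dual (F : omod) : omod := Hom F (Osh 0).

(* F(k) = F (x) O(k) is written as Hom(O(-k), F), since O(k) is invertible with
   dual O(-k). *)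
Definition twist (F : omod) (k : int) : omod := Hom (Osh (- k)) F.

(* O-bilinear alternating forms F x F -> O, that is, the dual of the second
   exterior power of F. *)
Definition is_alt2 (F : omod) (U : zopen)
    (f : Fam (fun V => (F V * F V)%type) (Osh 0) U) : Prop :=
  [/\ forall V (VU : V `<=` U) (a : OO V) (s t u : F V),
        f V VU (a *: s + t, u) = a *: f V VU (s, u) + f V VU (t, u),
      forall V (VU : V `<=` U) (a : OO V) (s t u : F V),
        f V VU (u, a *: s + t) = a *: f V VU (u, s) + f V VU (u, t),
      forall V (VU : V `<=` U) (s : F V), f V VU (s, s) = 0 &
      forall V W (VU : V `<=` U) (WU : W `<=` U) (WV : W `<=` V) (s t : F V),
        f W WU (res WV s, res WV t) = res WV (f V VU (s, t))].

Fact is_alt2_closed F : sub_closed (@is_alt2 F).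
Proof.
split=> [U|U a f g [fl fr fA fR] [gl gr gA gR]|U V VU f [fl fr fA fR]].
- split=> //; try by move=> V VU a s t u; rewrite /= scaler0 addr0.
  by move=> V W VU WU WV s t; rewrite res0.
- have E T TU u : (a *: f + g) T TU u = OOres TU a *: f T TU u + g T TU u by [].
  split.
  + by move=> V VU b s t u; rewrite !E fl gl !scalerDr !scalerA [_ * b]mulrC addrACA.
  + by move=> V VU b s t u; rewrite !E fr gr !scalerDr !scalerA [_ * b]mulrC addrACA.
  + by move=> V VU s; rewrite E fA gA scaler0 addr0.
  + move=> V W VU WU WV s t.
    by rewrite !E (fR _ _ VU) (gR _ _ VU) res_linear (OOres_comp _ _ WU).
- split.
  + by move=> W WV a s t u; apply: fl.
  + by move=> W WV a s t u; apply: fr.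
  + by move=> W WV s; apply: fA.
  + by move=> W T WV TV TW s t; apply: fR.
Qed.
Definition Alt2 (F : omod) : omod := SubMod (is_alt2_closed F).

(* The tangent sheaf of P^3: K-linear derivations of the structure sheaf. *)
Definition is_der (U : zopen) (f : Fam OO (Osh 0) U) : Prop :=
  [/\ forall V (VU : V `<=` U) (s t : OO V),
        f V VU (s + t) = f V VU s + f V VU t,
      forall V (VU : V `<=` U) (s t : OO V),
        f V VU (s * t) = s *: f V VU t + t *: f V VU s,
      forall V (VU : V `<=` U) (c : K), f V VU (regC V c) = 0 &
      forall V W (VU : V `<=` U) (WU : W `<=` U) (WV : W `<=` V) (s : OO V),
        f W WU (OOres WV s) = OOres WV (f V VU s)].

Fact is_der_closed : sub_closed is_der.
Proof.
split=> [U|U a f g [fD fM fC fR] [gD gM gC gR]|U V VU f [fD fM fC fR]].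
- split=> //.
  + by move=> V VU s t; rewrite /= addr0.
  + by move=> V VU s t; rewrite /= !scaler0 addr0.
  + by move=> V W VU WU WV s; symmetry; apply: (@res0 (Osh 0)).
- have E T TU u : (a *: f + g) T TU u = OOres TU a *: f T TU u + g T TU u by [].
  split.
  + by move=> V VU s t; rewrite !E fD gD scalerDr addrACA.
  + move=> V VU s t; rewrite !E fM gM !scalerDr !scalerA.
    by rewrite [_ * s]mulrC [_ * t]mulrC addrACA.
  + by move=> V VU c; rewrite E fC gC scaler0 addr0.
  + move=> V W VU WU WV s.
    rewrite !E (fR _ _ VU) (gR _ _ VU) -(OOres_comp VU WV WU).
    by symmetry; apply: (@res_linear (Osh 0)).
- split.
  + by move=> W WV s t; apply: fD.
  + by move=> W WV s t; apply: fM.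
  + by move=> W WV c; apply: fC.
  + by move=> W T WV TV TW s; apply: fR.
Qed.
Definition TP3 : omod := SubMod is_der_closed.

Definition mor (F G : omod) := Hom F G PP.
Definition mapp (F G : omod) (f : mor F G) (U : zopen) : F U -> G U :=
  app f (@subPP U).

Definition is_mono (F G : omod) (f : mor F G) : Prop :=
  forall U, injective (mapp f (U := U)).

Definition is_epi (F G : omod) (f : mor F G) : Prop :=
  forall U (s : G U), locally (fun V (VU : V `<=` U) =>
    exists t : F V, mapp f t = res VU s).

Definition exact_at (F G H : omod) (f : mor F G) (g : mor G H) : Prop :=
  (forall U (s : F U), mapp g (mapp f s) = 0) /\
  (forall U (s : G U), mapp g s = 0 -> locally (fun V (VU : V `<=` U) =>
     exists t : F V, mapp f t = res VU s)).

Definition iso_on (U : zopen) (F G : omod) : Prop :=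
  exists f : Hom F G U, forall V (VU : V `<=` U), bijective (app f VU).
Definition omod_iso (F G : omod) : Prop := iso_on PP F G.

(* Locally finitely presented sheaves (the coherent sheaves, P^3 being
   noetherian): near every point, e generates F and r generates the relations
   between the members of e. *)
Definition coherent (F : omod) : Prop :=
  is_sheaf F /\
  forall x, nz x -> exists (U : zopen) (n m : nat) (e : 'I_n -> F U)
      (r : 'I_m -> 'I_n -> OO U),
    [/\ pts U x,
        forall V (VU : V `<=` U) (s : F V), locally (fun W (WV : W `<=` V) =>
          exists a : 'I_n -> OO W,
            res WV s = \sum_i a i *: res (subset_trans WV VU) (e i)),
        forall j, \sum_i r j i *: e i = 0 &
        forall V (VU : V `<=` U) (a : 'I_n -> OO V),
          \sum_i a i *: res VU (e i) = 0 ->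
          locally (fun W (WV : W `<=` V) => exists b : 'I_m -> OO W,
            forall i, OOres WV (a i) =
              \sum_j b j * OOres (subset_trans WV VU) (r j i))].

(* The condition says that the evaluation map from F to its double dual is
   bijective on sections. *)
Definition reflexive (F : omod) : Prop :=
  coherent F /\
  forall U (f : dual (dual F) U), exists! s : F U,
    forall V (VU : V `<=` U) (g : dual F V),
      app f VU g = app g (@subset_refl _ V) (res VU s).

Definition rank2 (F : omod) : Prop :=
  exists U : zopen, U !=set0 /\ iso_on U F (dsum (Osh 0) (Osh 0)).

Definition is_split (F : omod) : Prop :=
  exists a b : int, omod_iso F (dsum (Osh a) (Osh b)).

Definition H0_neq0 (F : omod) : Prop := exists s : F PP, s <> 0.

(* For a sheaf of rank 2, det F is the double dual of the second exterior power
   and c_1(F) is the integer c with det F = O(c) (0 if there is none, which does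
   not happen for reflexive sheaves of rank 2). *)
Definition det_sheaf (F : omod) : omod := dual (Alt2 F).
Definition c1 (F : omod) : int := xget 0 [set c : int | omod_iso (det_sheaf F) (Osh c)].

Definition normalization (F : omod) : omod :=
  twist F (- (if (2 %| c1 F)%Z then c1 F %/ 2 else (c1 F + 1) %/ 2)%Z).

Definition unstable_of_order (F : omod) (r : int) : Prop :=
  [/\ 0 < r, H0_neq0 (twist (dual (normalization F)) (- r)) &
      forall r' : int,
        H0_neq0 (twist (dual (normalization F)) (- r')) -> r' <= r].

Definition unstable (F : omod) : Prop :=
  exists2 r : int, 1 <= r & unstable_of_order F r.

(* min {k | H^0(F(k-1)) <> 0}, with value 0 if there is no minimum. *)
Definition min_twist (F : omod) : int :=
  xget 0 [set k : int | H0_neq0 (twist F (k - 1)) /\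
    forall j : int, H0_neq0 (twist F (j - 1)) -> k <= j].

(* The zero locus of an ideal sheaf, i.e. the support of O / I. *)
Definition zeros (I : omod) (i : mor I (Osh 0)) : set vec :=
  [set x | nz x /\
    forall (U : zopen) (s : I U), pts U x -> (mapp i s : reg 0 U) x = 0].

(* Codimension one distributions of degree d, given by an exact sequence
   0 -> tangent -> TP^3 -> I(d+2) -> 0 where I is a coherent ideal sheaf
   (equivalently, the ideal sheaf of a closed subscheme). *)
Record distribution (d : nat) := Distribution {
  tangent : omod;
  tangent_reflexive : reflexive tangent;
  tangent_rank2 : rank2 tangent;
  sing_ideal : omod;
  sing_incl : mor sing_ideal (Osh 0);
  sing_coherent : coherent sing_ideal;
  sing_incl_mono : is_mono sing_incl;
  sing_codim : codim_ge2 (zeros sing_incl);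
  dist_incl : mor tangent TP3;
  dist_form : mor TP3 (twist sing_ideal (d%:Z + 2));
  dist_incl_mono : is_mono dist_incl;
  dist_exact : exact_at dist_incl dist_form;
  dist_form_epi : is_epi dist_form }.

End ProjectiveSpace.

(* Main.v *)
(** Over an open set U, the sections of the tangent sheaf T are the homogeneous
    fields of bivectors x /\ v with a . v = 0, where a = (a_0, ..., a_3) is the
    defining 1-form: four forms of degree d + 1 with a . x = 0 and without common
    factor, the latter because the singular scheme has codimension at least 2.
    For two such fields the 1-form det(-, x, v, w) is pointwise proportional to
    a, hence it is h(v, w) a with h regular.  This pairing h identifies det T with
    O(2 - d), and the dual of T with T(d - 2).  So T is unstable of order r exactly
    when r > 0 and (d + eps) / 2 - r is the least k with H^0(T(k - 1)) <> 0.

    It remains to see that this least k is positive, i.e. that T splits when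
    H^0(T(-1)) <> 0.  A nonzero section of T(-1) is a constant vector v with
    a . v = 0 identically.  In coordinates where v is a basis vector, a involves
    only three differentials, and a . x = 0 is a Koszul relation in three
    variables; its exactness provides B with a = det(-, x, v, B), that is
    h(v, B) = 1.  Then v and B form a basis of T, and T = O(1) + O(1 - d). *)
From HB Require Import structures.
Require Import Defs.
From mathcomp Require Import all_boot all_order all_algebra.
From mathcomp Require Import ring zify.
Import Order.TTheory GRing.Theory Num.Theory.
Set Implicit Arguments.
Unset Strict Implicit.
Unset Printing Implicit Defensive.
Local Open Scope classical_set_scope.
Local Open Scope ring_scope.
Local Notation sub_trans := classical_sets.subset_trans.

(** * Unique factorization *)

(** A derivation fixes its homogeneous vector field [v] only modulo [x], and the natural
    representatives differ from chart to chart. The matrix [x /\ v] is free of this choice: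
    regularity is a condition on its entries, tangency a condition at each point, and relations
    between sections become polynomial identities.

    The obstacle is the singular scheme, near which the tangent sheaf need not have a local basis.
    Linear and alternating forms are therefore evaluated on the Koszul fields
    [x /\ (a_l e_i - a_i e_l)], which exist everywhere, and the values are divided by the
    coefficients of [a]. The division is possible because these have no common factor, and
    identities need checking only where some [a_l] is nonzero.

    Having no common factor is algebraic, whereas codimension is defined by chains of irreducible
    closed sets. The bridge is that polynomial rings are factorial and that a prime form is
    recovered from its zeros. The same two facts show that global sections of [O(k)] are forms of
    degree [k]. *)

Section Factoriality.
Variable R : idomainType.
Implicit Types a b c p q : R.

Definition divides a b := exists c, b = c * a.

Definition prime_elt p :=
  [/\ p != 0, p \isn't a GRing.unit &
      forall a b, divides p (a * b) -> divides p a \/ divides p b].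

(** Asking for prime factors instead of irreducible ones makes the factorization unique without
    further proof. *)
Definition factorial_ring :=
  forall a, a != 0 -> exists u (s : seq R),
    [/\ u \is a GRing.unit, forall p, p \in s -> prime_elt p &
        a = u * \prod_(p <- s) p].

Lemma divides_mulr a b c : divides a b -> divides a (b * c).
Proof. by case=> e ->; exists (e * c); rewrite mulrAC. Qed.
Lemma divides_mull a b c : divides a b -> divides a (c * b).
Proof. by case=> e ->; exists (c * e); rewrite mulrA. Qed.
Lemma divides0 a : divides a 0.
Proof. by exists 0; rewrite mul0r. Qed.
Lemma divides_refl a : divides a a.
Proof. by exists 1; rewrite mul1r. Qed.
Lemma dividesD a b c : divides a b -> divides a c -> divides a (b + c).
Proof. by case=> e -> [f ->]; exists (e + f); rewrite mulrDl. Qed.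
Lemma dividesN a b : divides a b -> divides a (- b).
Proof. by case=> e ->; exists (- e); rewrite mulNr. Qed.
Lemma prime_elt_divides_unit p u :
  prime_elt p -> u \is a GRing.unit -> ~ divides p u.
Proof.
case=> _ pU _ uU [c e]; move: uU; rewrite e unitrM => /andP[_ h].
by rewrite h in pU.
Qed.

Lemma prime_elt_assoc p q : prime_elt p -> prime_elt q -> divides p q ->
  exists2 u, u \is a GRing.unit & q = u * p.
Proof.
move=> [p0 pU pP] [q0 qU qP] [c e]; exists c => //.
have /qP[] : divides q (c * p) by rewrite -e; apply: divides_refl.
- case=> f ef; case/negP: pU; apply/unitrP; exists f.
  have : q * 1 = q * (f * p) by rewrite mulr1 {1}e ef; ring.
  by move/(mulfI q0) => h; split; [|rewrite mulrC]; rewrite -h.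
- case=> f ef; apply/unitrP; exists f.
  have : p * 1 = p * (f * c) by rewrite mulr1 {1}ef e; ring.
  by move/(mulfI p0) => h; split; [|rewrite mulrC]; rewrite -h.
Qed.

Lemma prime_divides_prod p (s : seq R) : prime_elt p ->
  divides p (\prod_(q <- s) q) -> exists2 q, q \in s & divides p q.
Proof.
move=> pP; elim: s => [|q s IH].
  by rewrite big_nil => /(prime_elt_divides_unit pP (unitr1 _)).
rewrite big_cons; have [_ _ h] := pP.
case/h=> [d|/IH[r rs d]]; first by exists q; rewrite ?mem_head.
by exists r; rewrite // in_cons rs orbT.
Qed.

Lemma prime_factor a : factorial_ring -> a != 0 -> a \isn't a GRing.unit ->
  exists2 p, prime_elt p & divides p a.
Proof.
move=> ufd /ufd[u [[|p s] [uU sP ->]]].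
  by rewrite big_nil mulr1 uU.
move=> _; exists p; first by apply: sP; rewrite mem_head.
by rewrite big_cons; exists (u * \prod_(q <- s) q); ring.
Qed.
End Factoriality.

(** The prime factors of [a] are cancelled one at a time: some [A i] is not divisible by the prime
    in question, so this prime divides [b]. Only the family as a whole is coprime, not its members
    pairwise. *)
Lemma divides_of_all (R : idomainType) (I : Type) (A : I -> R) (a b : R) :
  factorial_ring R -> (forall p, prime_elt p -> exists i, ~ divides p (A i)) ->
  a != 0 -> (forall i, divides a (A i * b)) -> divides a b.
Proof.
move=> ufd coprimeA /ufd[u [s [uU sP ->]]].
elim: s b sP => [|p s IH] b sP h.
  by rewrite big_nil mulr1; exists (b * u^-1); rewrite -mulrA mulVr // mulr1.
have pP : prime_elt p by apply: sP; rewrite mem_head.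
have [p0 _ P] := pP; have [i ni] := coprimeA p pP.
have [b' eb] : divides p b.
  have := h i; rewrite big_cons mulrCA => -[c ec].
  have [|//|//] := P (A i) b.
  by exists (c * (u * \prod_(j <- s) j)); rewrite ec; ring.
have [||c ec] := IH b'.
- by move=> q qs; apply: sP; rewrite in_cons qs orbT.
- move=> j; have := h j; rewrite big_cons mulrCA => -[c ec]; exists c.
  by apply: (mulfI p0); rewrite eb in ec; rewrite mulrCA [p * b']mulrC ec; ring.
by exists c; rewrite big_cons eb ec; ring.
Qed.

(* Peeling off one common prime factor at a time, by induction on a
   factorization of [b]. *)
Lemma reduced_fraction (R : idomainType) (a b : R) : factorial_ring R -> b != 0 ->
  exists c a' b', [/\ a = c * a', b = c * b' &
    forall p, prime_elt p -> divides p a' -> ~ divides p b'].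
Proof.
move=> ufd /ufd[u [s [uU sP ->]]].
elim: s a sP => [|q s IH] a sP.
  rewrite big_nil mulr1; exists 1, a, u; split; rewrite ?mul1r // => p pP _.
  exact: prime_elt_divides_unit.
have qP : prime_elt q by apply: sP; rewrite mem_head.
have sP' p : p \in s -> prime_elt p by move=> ps; apply: sP; rewrite in_cons ps orbT.
have [[e ->]|nqa] := pselect (divides q a).
  have [c [a' [b' [-> eb H]]]] := IH e sP'.
  exists (c * q), a', b'; split=> //; first by ring.
  by rewrite big_cons mulrCA eb; ring.
have [c [a' [b' [ea eb H]]]] := IH a sP'.
exists c, a', (q * b'); split=> //; first by rewrite big_cons mulrCA eb; ring.
move=> p pP pa'; have [_ _ P] := pP; case/P => [pq|]; last exact: H.
have [v vU ev] := prime_elt_assoc pP qP pq.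
apply: nqa; case: pa' => x ex; exists (c * x * v^-1).
by rewrite ea ex ev -!mulrA mulKr.
Qed.

(** * Gauss's lemma and factorial polynomial rings *)

Section GaussLemma.
Variable R : idomainType.
Hypothesis ufdR : factorial_ring R.
Implicit Types p q f g h : {poly R}.

Lemma divides_polyC (c : R) p : divides c%:P p <-> forall i, divides c p`_i.
Proof.
split=> [[q ->] i|h]; first by exists q`_i; rewrite coefMC.
have [f fP] := choice h.
exists (\poly_(i < size p) f i); apply/polyP => i.
rewrite coefMC coef_poly; case: ltnP => // /leq_sizeP-> //.
by rewrite mul0r.
Qed.

(** Gauss's lemma. With [i] and [j] the first indices whose coefficients [c] does not divide, every
    term in the coefficient of index [i + j] of the product, except the one from [i] and [j], is
    divisible by [c]. *)
Lemma prime_polyC (c : R) : prime_elt c -> prime_elt c%:P.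
Proof.
move=> [c0 cU cP]; split; first by rewrite polyC_eq0.
  apply/negP => h; case/negP: cU.
  by move: h; rewrite poly_unitE size_polyC c0 coefC eqxx.
move=> p q /divides_polyC pq; apply: contrapT => /not_orP[np nq].
have min_coef (r : {poly R}) : ~ divides c%:P r ->
    exists i, ~ divides c r`_i /\ forall j, (j < i)%N -> divides c r`_j.
  move=> /divides_polyC/existsNP/cid[i0 hi0].
  have ex : exists i, `[< ~ divides c r`_i >] by exists i0; apply/asboolP.
  case: (ex_minnP ex) => i /asboolP hi him; exists i; split=> // j ji.
  by apply: contrapT => /asboolP/him; rewrite leqNgt ji.
have [i [pi hi]] := min_coef _ np; have [j [qj hj]] := min_coef _ nq.
have := pq (i + j)%N; rewrite coefM.
have lti : (i < (i + j).+1)%N by rewrite ltnS leq_addr.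
rewrite (bigD1 (Ordinal lti)) //= addKn => hd.
have : divides c (p`_i * q`_j).
  rewrite -[_ * _](addrK (\sum_(k < (i + j).+1 | k != Ordinal lti)
     p`_k * q`_(i + j - k))).
  apply: dividesD => //; apply: dividesN.
  elim/big_ind: _ => [|x y|k ki]; [exact: divides0|exact: dividesD|].
  have [lk|lk] := ltnP k i; first exact/divides_mulr/hi.
  apply/divides_mull/hj; have : (k != i :> nat) by exact: ki.
  by have := ltn_ord k; lia.
by case/cP.
Qed.

Definition primitive p := forall c : R, prime_elt c -> ~ divides c%:P p.

(** Polynomial division over [R] works only up to a constant [a]. The primes of [a] divide [p * h]
    but not the primitive [p], so they divide [h] and can be cancelled. *)
Lemma primitive_cancel (a : R) f p h : a != 0 -> primitive p ->
  a%:P * f = p * h -> divides p f.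
Proof.
move=> a0 prp; have [u [s [uU sP e]]] := ufdR a0; rewrite e {e a a0}.
elim: s f h sP => [|c s IH] f h sP.
  rewrite big_nil mulr1 => e; exists (u^-1%:P * h).
  by rewrite -mulrA [h * p]mulrC -e mulrA -polyCM mulVr // mul1r.
rewrite big_cons mulrCA polyCM => e.
have cP : prime_elt c by apply: sP; rewrite mem_head.
have c0 : c%:P != 0 by case: (prime_polyC cP).
have [_ _ /(_ p h)] := prime_polyC cP; case.
- by rewrite -e -mulrA; exists ((u * \prod_(j <- s) j)%:P * f); rewrite mulrC.
- by move/(prp c cP).
case=> h' eh; apply: (IH f h').
  by move=> x xs; apply: sP; rewrite in_cons xs orbT.
by apply: (mulfI c0); rewrite mulrA e eh; ring.
Qed.

(** A prime constant dividing [f] also divides its leading coefficient, so the number of prime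
    factors of that coefficient bounds how often a prime can be taken out. The induction runs on
    this number. *)
Lemma primitive_part f : f != 0 ->
  exists (c : R) p, [/\ c != 0, primitive p & f = c%:P * p].
Proof.
move=> f0; have l0 : lead_coef f != 0 by rewrite lead_coef_eq0.
have [u [s [uU sP e]]] := ufdR l0 => {l0}.
have [n] := ubnP (size s); elim: n f f0 u s uU sP e => // n IH f f0 u s uU sP e.
move=> sn; have [|/existsNP[c /not_implyP[cP /contrapT[f' ef]]]] := pselect (primitive f).
  by exists 1, f; rewrite oner_neq0 mul1r.
have f'0 : f' != 0 by apply: contraNneq f0 => h; rewrite ef h mul0r.
have c0 : c != 0 by case: cP.
have [q qs dq] : exists2 q, q \in s & divides c q.
  have : divides c (u * \prod_(q <- s) q).
    by rewrite -e ef lead_coefM lead_coefC; exists (lead_coef f').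
  have [_ _ h] := cP; case/h => [/(prime_elt_divides_unit cP uU)//|].
  exact: prime_divides_prod.
have [v vU eq] := prime_elt_assoc cP (sP _ qs) dq.
have [] := IH f' f'0 (u * v) (rem q s).
- by rewrite unitrM uU vU.
- by move=> x /mem_rem; apply: sP.
- apply: (mulIf c0).
  have -> : lead_coef f' * c = lead_coef f by rewrite ef lead_coefM lead_coefC.
  by rewrite e (big_rem q) //=; move: (\prod_(y <- rem q s) y) => P; rewrite eq; ring.
- rewrite size_rem //; case: (s) qs sn => //.
- move=> c' [p [c'0 prp ep]]; exists (c * c'), p; split=> //.
    by rewrite mulf_neq0.
  by rewrite ef ep polyCM; ring.
Qed.

(** [irreducible_poly] and [%|] amount to irreducibility and divisibility over the fraction field;
    [primitive_cancel] brings divisibility back to [R]. *)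
Lemma irreducible_primitive_prime p :
  primitive p -> irreducible_poly p -> prime_elt p.
Proof.
move=> prp ip; split.
- exact: irredp_neq0.
- by rewrite poly_unitE negb_and; case: ip => /gtn_eqF ->.
move=> f g [h e].
have div k : p %| k -> divides p k.
  move=> /Pdiv.Idomain.dvdpP[[c r] /= c0]; rewrite -mul_polyC mulrC => ee.
  apply: (@primitive_cancel c _ _ r) => //.
  by rewrite mulrC ee mulrC.
have : p %| f * g by rewrite e dvdp_mull.
have [pf _|npf] := boolP (p %| f); first by left; apply: div.
rewrite Gauss_dvdpr => [/div|]; first by right.
have [_ irr] := ip; rewrite coprimep_def; apply: contraNT npf => /irr.
move=> /(_ (dvdp_gcdl _ _)) /eqp_dvdl <-; exact: dvdp_gcdr.
Qed.

Lemma factorial_poly : factorial_ring {poly R}.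
Proof.
(* Primitive polynomials first, by induction on the size: a reducible one is a product of two
   primitive polynomials of smaller size, and a constant one is a unit. *)
have prim p : p != 0 -> primitive p -> exists u (s : seq {poly R}),
    [/\ u \is a GRing.unit, forall q, q \in s -> prime_elt q &
        p = u * \prod_(q <- s) q].
  have [n] := ubnP (size p); elim: n p => // n IH p pn p0 prp.
  have [s1|s1] := leqP (size p) 1%N.
    have [c e] : exists c, p = c%:P by exists p`_0; apply: size1_polyC.
    exists p, [::]; rewrite big_nil mulr1; split=> //.
    have c0 : c != 0 by move: p0; rewrite e polyC_eq0.
    have cU : c \is a GRing.unit.
      apply: contrapT => /negP cU; have [q qP [d ed]] := prime_factor ufdR c0 cU.
      by case: (prp q qP); exists d%:P; rewrite e ed polyCM.
    by rewrite e poly_unitE size_polyC c0 coefC /= cU.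
  have [ip|nip] := pselect (irreducible_poly p).
    exists 1, [:: p]; rewrite unitr1 big_seq1 mul1r; split=> // q.
    by rewrite inE => /eqP->; apply: irreducible_primitive_prime.
  have [q [q1 qp nqp]] : exists q, [/\ size q != 1%N, q %| p & ~~ (q %= p)].
    apply: contrapT => H; apply: nip; split=> // q q1 qp.
    by apply: contrapT => /negP nqp; apply: H; exists q.
  have q0 : q != 0 by apply: contraNneq p0 => h; rewrite -dvd0p -h.
  have sq : (size q < size p)%N.
    rewrite ltn_neqAle (dvdp_leq p0 qp) andbT.
    by apply: contra nqp => /eqP h; rewrite -dvdp_size_eqp ?h.
  have q1' : (1 < size q)%N.
    by rewrite ltn_neqAle eq_sym q1 size_poly_gt0.
  have [c [qq [c0 prq eq]]] := primitive_part q0.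
  have sqq : size qq = size q by rewrite eq size_Cmul.
  have /Pdiv.Idomain.dvdpP[[a r] /= a0 e] := qp.
  have [h eh] : divides qq p.
    apply: (@primitive_cancel a _ _ (r * c%:P)) => //.
    by rewrite mul_polyC e eq; ring.
  have h0 : h != 0 by apply: contraNneq p0 => hh; rewrite eh hh mul0r.
  have qq0 : qq != 0 by rewrite -size_poly_gt0 sqq size_poly_gt0.
  have sh : (size h < size p)%N.
    by rewrite eh size_mul // sqq; move: q1' (size_poly_gt0 h); rewrite h0; lia.
  have prh : primitive h.
    move=> x xP [y ey]; apply: (prp x xP); exists (y * qq).
    by rewrite eh ey; ring.
  have [] := IH qq _ qq0 prq; first by rewrite sqq; apply: leq_trans sq _.
  move=> u1 [l1 [u1U l1P e1]].
  have [] := IH h _ h0 prh; first by apply: leq_trans sh _.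
  move=> u2 [l2 [u2U l2P e2]].
  exists (u1 * u2), (l1 ++ l2); split; first by rewrite unitrM u1U.
    by move=> x; rewrite mem_cat => /orP[/l1P|/l2P].
  by rewrite big_cat /= eh e1 e2; ring.
move=> f /[dup] f0 /primitive_part[c [p [c0 prp e]]].
have [] := prim p _ prp; first by apply: contraNneq f0 => h; rewrite e h mulr0.
move=> u [s [uU sP ep]].
have [v [t [vU tP ec]]] := ufdR c0.
exists (v%:P * u), (map polyC t ++ s); split.
- have v0 : v != 0 by apply: contraTneq vU => ->; rewrite unitr0.
  by rewrite unitrM uU andbT poly_unitE size_polyC coefC /= vU v0.
- by move=> x; rewrite mem_cat => /orP[/mapP[y /tP yP ->]|/sP//]; apply: prime_polyC.
- rewrite big_cat big_map /= e ec ep polyCM rmorph_prod /=; ring.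
Qed.
End GaussLemma.

Lemma prime_elt_iso (R S : idomainType) (f : {rmorphism R -> S})
    (g : {rmorphism S -> R}) p : cancel f g -> cancel g f ->
  prime_elt p -> prime_elt (f p).
Proof.
move=> fK gK [p0 pU pP]; split.
- by apply: contraNneq p0 => h; rewrite -(fK p) h rmorph0.
- by apply: contraNN pU => h; rewrite -(fK p) rmorph_unit.
move=> b c [d e']; have [] := pP (g b) (g c).
- by exists (g d); rewrite -!rmorphM e' rmorphM fK.
- by case=> x ex; left; exists (f x); rewrite -rmorphM -ex gK.
- by case=> x ex; right; exists (f x); rewrite -rmorphM -ex gK.
Qed.

Lemma factorial_iso (R S : idomainType) (f : {rmorphism R -> S})
    (g : {rmorphism S -> R}) : cancel f g -> cancel g f ->
  factorial_ring R -> factorial_ring S.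
Proof.
move=> fK gK ufd a a0.
have [|u [s [uU sP e]]] := ufd (g a).
  by apply: contraNneq a0 => h; rewrite -(gK a) h rmorph0.
exists (f u), (map f s); split; first exact: rmorph_unit.
  by move=> _ /mapP[p /sP pP ->]; exact: prime_elt_iso fK gK pP.
by rewrite -(gK a) e rmorphM rmorph_prod big_map.
Qed.

(** * Polynomial rings in one more variable *)

Section MultivariateRing.
Variables (K : idomainType).

(** The inverse of [muni], which views a polynomial as one in its last variable; factoriality and
    primality are carried along this isomorphism. *)
Definition mjoin n (p : {poly {mpoly K[n]}}) : {mpoly K[n.+1]} :=
  (map_poly (@mwiden n K) p).['X_ord_max].

HB.instance Definition _ n := GRing.RMorphism.copy (@mjoin n)
  (horner_eval ('X_(@ord_max n) : {mpoly K[n.+1]}) \o map_poly (@mwiden n K)).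

Lemma muniX n (m : 'X_{1..n.+1}) : muni ('X_[m] : {mpoly K[n.+1]}) =
  'X_[[multinom (m (widen_ord (leqnSn n) i)) | i < n]] *: 'X^(m ord_max).
Proof. by rewrite muniE msuppX big_seq1 mcoeffX eqxx scale1r. Qed.

Lemma muni_mwiden n (p : {mpoly K[n]}) : muni (mwiden p) = p%:P.
Proof.
elim/mpolyind: p => [|c m p _ _ IH]; first by rewrite mwiden0 muni0 polyC0.
rewrite mwidenD muniD IH mwidenZ muniZ mwidenX muniX mnmwiden_ordmax expr0.
rewrite alg_polyC -mul_polyC -polyCM mul_mpolyC -polyCD.
have -> : [multinom mnmwiden m (widen_ord (leqnSn n) i) | i < n] = m.
  by apply/mnmP => i; rewrite mnmE mnmwiden_widen.
by [].
Qed.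

Lemma mjoinK n : cancel (@mjoin n) (@muni n K).
Proof.
have muniXmax : muni ('X_ord_max : {mpoly K[n.+1]}) = 'X.
  rewrite muniX mnm1E eqxx expr1 (_ : [multinom _ | _ < _] = 0%MM).
    by rewrite mpolyX0 scale1r.
  apply/mnmP => i; rewrite mnmE mnm1E mnm0E.
  by rewrite (_ : (_ == _) = false) //; apply/negbTE; rewrite -val_eqE /= gtn_eqF.
move=> p; rewrite /mjoin; elim/poly_ind: p => [|p c IH].
  by rewrite rmorph0 horner0 muni0.
rewrite rmorphD rmorphM /= map_polyX map_polyC /= !hornerE muniD muniM IH.
by rewrite muni_mwiden muniXmax.
Qed.

Lemma mjoinC n (c : {mpoly K[n]}) : mjoin c%:P = mwiden c.
Proof. by rewrite /mjoin map_polyC /= hornerC. Qed.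

Lemma mjoinX n : mjoin ('X : {poly {mpoly K[n]}}) = 'X_ord_max.
Proof. by rewrite /mjoin map_polyX hornerX. Qed.

Lemma mjoinD n : {morph @mjoin n : p q / p + q}.
Proof. exact: rmorphD. Qed.

Lemma mjoinM n : {morph @mjoin n : p q / p * q}.
Proof. exact: rmorphM. Qed.

Lemma muniK n : cancel (@muni n K) (@mjoin n).
Proof.
move=> p; elim/mpolyind: p => [|c m p _ _ IH]; first by rewrite muni0 rmorph0.
rewrite muniD mjoinD [X in _ + X]IH.
suff E : mjoin (muni (c *: 'X_[m])) = c *: 'X_[m] by rewrite [X in X + _]E.
rewrite muniZ muniX -!mul_polyC !mjoinM !mjoinC mwidenC mul_mpolyC mwidenX.
rewrite rmorphXn /= mjoinX [in RHS]mpolyXE_id [in RHS]big_ord_recr /=.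
rewrite mpolyXE_id big_ord_recr /= mnmwiden_ordmax expr0 mulr1.
rewrite (eq_bigr (fun i => 'X_(widen_ord (leqnSn n) i) ^+
  m (widen_ord (leqnSn n) i))) // => i _.
by rewrite mnmwiden_widen mnmE.
Qed.

Lemma meval_mjoin n (p : {poly {mpoly K[n]}}) (x : 'I_n.+1 -> K) :
  (mjoin p).@[x] =
  (map_poly (meval (fun i => x (widen_ord (leqnSn n) i))) p).[x ord_max].
Proof.
elim/poly_ind: p => [|p c IH].
  by rewrite (rmorph0 (@mjoin n)) meval0 rmorph0 horner0.
rewrite mjoinD mjoinM mjoinC mjoinX mevalD mevalM {}IH mevalXU.
rewrite rmorphD rmorphM /= map_polyX map_polyC /= !hornerE; congr (_ + _).
elim/mpolyind: c => [|c m q _ _ IH]; first by rewrite mwiden0 !meval0.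
rewrite mwidenD !mevalD IH mwidenZ !mevalZ mwidenX !mevalX.
rewrite big_ord_recr /= mnmwiden_ordmax expr0 mulr1; congr (_ * _ + _).
by apply: eq_bigr => i _; rewrite mnmwiden_widen.
Qed.
End MultivariateRing.

Lemma mpoly0_const (R : nzRingType) (p : {mpoly R[0]}) : p = (p@_0)%:MP.
Proof.
by apply/mpolyP => m; rewrite mcoeffC (_ : m = 0%MM) ?eqxx ?mulr1 //; apply/mnmP => -[].
Qed.

Lemma mpolyC_unit (K : fieldType) n (p : {mpoly K[n]}) :
  p = (p@_0)%:MP -> p != 0 -> p \is a GRing.unit.
Proof.
move=> ep p0; apply/andP; split; first by rewrite {1}ep.
by rewrite unitfE; apply: contraNneq p0 => h; rewrite ep h mpolyC0.
Qed.

Lemma factorial_mpoly (K : fieldType) n : factorial_ring {mpoly K[n]}.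
Proof.
elim: n => [|n IH].
  move=> a a0; exists a, [::]; rewrite big_nil mulr1; split=> //.
  exact: mpolyC_unit (mpoly0_const a) a0.
exact: (factorial_iso (@mjoinK K n) (@muniK K n) (factorial_poly IH)).
Qed.

(** * Nullstellensatz for hypersurfaces *)

Lemma prime_polyC_inv (R : idomainType) (c : R) : prime_elt c%:P -> prime_elt c.
Proof.
move=> [c0 cU cP]; rewrite polyC_eq0 in c0; split=> //.
  by apply: contraNN cU => cU; rewrite poly_unitE size_polyC c0 coefC.
have d a : divides c%:P a%:P -> divides c a.
  by move=> /divides_polyC/(_ 0%N); rewrite coefC.
move=> a b [e ee]; have [] := cP a%:P b%:P; last by move=> /d; right.
  by exists e%:P; rewrite -!polyCM ee.
by move=> /d; left.
Qed.

Lemma size_factor_polyC (R : idomainType) (c : R) (p q : {poly R}) :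
  c != 0 -> c%:P = p * q -> size q = 1%N.
Proof.
move=> c0 e; have : p * q != 0 by rewrite -e polyC_eq0.
rewrite mulf_eq0 negb_or => /andP[p0 q0].
have : size c%:P = size (p * q) by rewrite e.
rewrite size_polyC c0 size_mul //; move: p0 q0; rewrite -!size_poly_gt0.
by case: (size p) (size q) => [|a] [|[|b]] // _ _ /eqP; rewrite !addnS.
Qed.

Section Evaluation.
Variable K : closedFieldType.

Definition xrcons n (y : 'I_n -> K) (t : K) : 'I_n.+1 -> K :=
  fun i => if unlift ord_max i is Some j then y j else t.

Lemma meval_xrcons n (p : {poly {mpoly K[n]}}) y t :
  (mjoin p).@[xrcons y t] = (map_poly (meval y) p).[t].
Proof.
rewrite meval_mjoin /xrcons unlift_none; congr (_.[_]).
have e : (fun i => xrcons y t (widen_ord (leqnSn n) i)) =1 y.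
  move=> i; rewrite /xrcons (_ : widen_ord _ _ = lift ord_max i) ?liftK //.
  by apply/val_inj; rewrite /= /bump leqNgt ltn_ord.
by apply: eq_map_poly => q; apply: meval_eq.
Qed.

Lemma meval_muni n (p : {mpoly K[n.+1]}) y t :
  p.@[xrcons y t] = (map_poly (meval y) (muni p)).[t].
Proof. by have := meval_xrcons (muni p) y t; rewrite (muniK p). Qed.

Lemma mpoly_nonroot n (p : {mpoly K[n]}) : p != 0 -> exists x, p.@[x] != 0.
Proof.
elim: n p => [|n IH] p p0.
  exists (fun=> 0); have ep := mpoly0_const p.
  by rewrite ep mevalC; apply: contraNneq p0 => h; rewrite ep h mpolyC0.
have f0 : muni p != 0.
  by apply: contraNneq p0 => h; rewrite -(muniK p) h rmorph0.
have [|y hy] := IH (lead_coef (muni p)); first by rewrite lead_coef_eq0.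
have : map_poly (meval y) (muni p) != 0.
  by rewrite -size_poly_eq0 (size_map_poly_id0 hy) size_poly_eq0.
move=> /closed_nonrootP[t]; rewrite /root -meval_xrcons muniK => h.
by exists (xrcons y t).
Qed.

Lemma mpoly_eval_inj n (p q : {mpoly K[n]}) : (forall x, p.@[x] = q.@[x]) -> p = q.
Proof.
move=> pq; apply/eqP; rewrite -subr_eq0; apply: contraT => /mpoly_nonroot[x].
by rewrite mevalB pq subrr eqxx.
Qed.

Lemma meval_unit n (u : {mpoly K[n]}) x : u \is a GRing.unit -> u.@[x] != 0.
Proof.
move=> uU; have := congr1 (meval x) (mulrV uU); rewrite mevalM meval1.
by apply: contra_eq_neq => ->; rewrite mul0r eq_sym oner_neq0.
Qed.

Lemma prime_poly_irreducible (R : idomainType) (p : {poly R}) :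
  prime_elt p -> (1 < size p)%N -> irreducible_poly p.
Proof.
move=> [p0 _ pP] sp; split=> // q q1 qp.
have /Pdiv.Idomain.dvdpP[[c r] /= c0 e] := qp.
have q0 : q != 0 by apply: contraNneq p0 => h; rewrite -dvd0p -h.
have [] := pP r q; first by exists c%:P; rewrite mul_polyC.
- case=> s es; exfalso; move: q1.
  have : c%:P * p = s * q * p by rewrite mul_polyC e es; ring.
  by move/(mulIf p0) => h; rewrite (size_factor_polyC c0 h).
- by case=> s es; rewrite /eqp qp es dvdp_mull.
Qed.

(* Nullstellensatz for a principal prime ideal: in the last variable, a Bezout
   relation [u g + v h = c] with [c] free of that variable would be violated at
   a zero of [g] chosen over a point where [c] does not vanish. *)
Lemma prime_nullstellensatz n (g h : {mpoly K[n]}) : prime_elt g ->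
  (forall x, g.@[x] = 0 -> h.@[x] = 0) -> divides g h.
Proof.
elim: n g h => [|n IH] g h gP gh.
  by have [g0 /negP[]] := gP; exact: mpolyC_unit (mpoly0_const g) g0.
have GP : prime_elt (muni g) := prime_elt_iso (@muniK K n) (@mjoinK K n) gP.
have gh' y t : (map_poly (meval y) (muni g)).[t] = 0 ->
    (map_poly (meval y) (muni h)).[t] = 0.
  move=> e; rewrite -[LHS](meval_muni h); apply: gh.
  exact: etrans (meval_muni g y t) e.
suff [e] : divides (muni g) (muni h).
  by move=> /(congr1 (@mjoin K n)); rewrite (muniK h) mjoinM (muniK g); exists (mjoin e).
move: (muni g) (muni h) GP gh' => G H GP gh' {g h gP gh}.
(* If [G] is free of the last variable, then over a zero of [G] the specialized [H] vanishes at
   every [t]. So all its coefficients vanish there, and the induction hypothesis applies to each of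
   them. *)
have [s1|s1] := leqP (size G) 1%N.
  have eG := size1_polyC s1; rewrite eG in GP *; have cP := prime_polyC_inv GP.
  apply/divides_polyC => i; apply: IH => // y cy.
  suff : map_poly (meval y) H = 0.
    by move/(congr1 (coefp i)); rewrite /= coef_map coef0.
  apply/eqP; apply: contraT => /closed_nonrootP[t]; rewrite /root gh' ?eqxx //.
  by rewrite eG map_polyC /= cy hornerC.
have irr := prime_poly_irreducible GP s1.
have [/Pdiv.Idomain.dvdpP[[c r] /= c0 e]|ngh] := boolP (G %| H).
  have [_ _ P] := GP; have [||//] := P c%:P H.
  - by exists r; rewrite mul_polyC.
  - move=> [e' ee']; exfalso.
    by move: s1; rewrite (size_factor_polyC c0 ee').
exfalso; have /Bezout_coprimepP[[u v] /=] : coprimep G H.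
  rewrite coprimep_def; apply: contraNT ngh => /irr.
  by move=> /(_ (dvdp_gcdl _ _)) /eqp_dvdl <-; exact: dvdp_gcdr.
rewrite -size_poly_eq1 => /size_poly1P[b b0 eb].
(* A point where [lead_coef G] is nonzero keeps the degree of [G], so that the specialized
   polynomial has a root. *)
have [|y] := mpoly_nonroot (p := b * lead_coef G).
  by rewrite mulf_neq0 // lead_coef_eq0 irredp_neq0.
rewrite mevalM mulf_eq0 negb_or => /andP[by0 ly].
have /closed_rootP[t /rootP rt] : size (map_poly (meval y) G) != 1%N.
  by rewrite (size_map_poly_id0 ly) gtn_eqF.
have := congr1 (fun f => (map_poly (meval y) f).[t]) eb.
rewrite /= rmorphD !rmorphM /= hornerD !hornerM rt (gh' _ _ rt) map_polyC hornerC.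
by rewrite !mulr0 addr0 => /esym/eqP; rewrite (negbTE by0).
Qed.
End Evaluation.

(** After all powers of [X] are taken out of [p] and [q], the cofactors [f] and [g] do not vanish at
    0. Hence [k <= i + j], and [f] divides the constant [a]. *)
Lemma monomial_factor (R : idomainType) (a : R) (p q : {poly R}) k :
  a != 0 -> p * q = a%:P * 'X^k -> exists c i, p = c%:P * 'X^i.
Proof.
move=> a0 e; have XN m : ('X^m : {poly R}) != 0 by rewrite expf_neq0 ?polyX_eq0.
have : p * q != 0 by rewrite e mulf_neq0 ?polyC_eq0.
rewrite mulf_eq0 negb_or => /andP[p0 q0].
have [i [f]] := multiplicity_XsubC p 0; rewrite p0 /= subr0 => f0 ef.
have [j [g]] := multiplicity_XsubC q 0; rewrite q0 /= subr0 => g0 eg.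
have fg0 : ~~ root (f * g) 0 by rewrite rootM negb_or f0.
have e' : (f * g) * 'X^(i + j) = a%:P * 'X^k by rewrite -e ef eg exprD; ring.
have le : (k <= i + j)%N.
  rewrite leqNgt; apply/negP => lt; case/negP: fg0.
  have : f * g * 'X^(i + j) = a%:P * 'X^(k - (i + j)) * 'X^(i + j).
    by rewrite e' -mulrA -exprD subnK // ltnW.
  move=> /(mulIf (XN _)) ->; rewrite rootM /root hornerXn expr0n.
  have -> : (k - (i + j) == 0)%N = false by apply/negbTE; rewrite subn_eq0 -ltnNge.
  by rewrite eqxx orbT.
have sf : size f = 1%N.
  apply: (@size_factor_polyC R a (g * 'X^(i + j - k))) => //.
  apply: (mulIf (XN k)); rewrite -e' -[in LHS](subnK le) exprD; ring.
exists f`_0, i; rewrite [in LHS]ef; congr (_ * _).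
by apply: size1_polyC; rewrite sf.
Qed.

(** * Factors of homogeneous polynomials *)

Section HomogeneousFactors.
Variables (K : fieldType) (n : nat).
Implicit Types p q : {mpoly K[n]}.

(* The grading of {mpoly K[n]} as a morphism, sending [X_i] to [X_i * T]; its
   value at [p] is a monomial in [T] exactly when [p] is homogeneous. *)
Definition grading p : {poly {mpoly K[n]}} :=
  mmap (polyC \o @mpolyC n K) (fun i => ('X_i)%:P * 'X) p.

HB.instance Definition _ := GRing.RMorphism.copy grading
  (mmap (polyC \o @mpolyC n K) (fun i => ('X_i)%:P * 'X)).

Lemma gradingD : {morph grading : p q / p + q}.
Proof. exact: rmorphD. Qed.

Lemma gradingZ c p : grading (c *: p) = (c%:MP)%:P * grading p.
Proof. exact: mmapZ. Qed.

Lemma gradingX (m : 'X_{1..n}) : grading 'X_[m] = ('X_[m])%:P * 'X^(mdeg m).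
Proof.
rewrite /grading mmapX /mmap1.
rewrite (eq_bigr (fun i => ('X_i)%:P ^+ m i * 'X ^+ m i)); last first.
  by move=> i _; rewrite exprMn.
rewrite big_split /= -expr_sum mdegE; congr (_ * _).
by rewrite mpolyXE_id rmorph_prod /=; apply: eq_bigr => i _; rewrite rmorphXn.
Qed.

Lemma grading_coef p (m : 'X_{1..n}) k :
  (grading p)`_k@_m = if mdeg m == k then p@_m else 0.
Proof.
elim/mpolyind: p => [|c m' p _ _ IH].
  by rewrite rmorph0 coef0 !mcoeff0 if_same.
rewrite gradingD coefD mcoeffD [X in _ + X]IH.
rewrite gradingZ gradingX mulrA -polyCM coefCM coefXn.
rewrite mulr_natr mcoeffMn mul_mpolyC mcoeffZ mcoeffD mcoeffZ mcoeffX.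
have [->|nm] := eqVneq m' m; last by rewrite mulr0 mul0rn; case: ifP; rewrite !add0r.
by rewrite eq_sym; case: ifP => _ /=; rewrite ?mulr1n ?mulr0n ?addr0.
Qed.

Lemma grading_homog p k : p \is k.-homog -> grading p = p%:P * 'X^k.
Proof.
move=> /dhomogP hp; apply/polyP => i; apply/mpolyP => m.
rewrite grading_coef coefCM coefXn mulr_natr mcoeffMn eq_sym.
have [ms|ms] := boolP (m \in msupp p).
  by rewrite (hp _ ms) eq_sym; case: eqP; rewrite ?mulr1n ?mulr0n.
by rewrite (memN_msupp_eq0 ms) mul0rn if_same.
Qed.

(** Read through [grading], this says that a factor of a monomial in [T] is a monomial. *)
Lemma homog_factor p q k : p * q != 0 -> p * q \is k.-homog ->
  exists j, p \is j.-homog.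
Proof.
move=> pq0 /grading_homog; rewrite rmorphM /= => e.
have inj0 r : r != 0 -> grading r != 0.
  apply: contraNneq => h; apply/eqP/mpolyP => m.
  by have := grading_coef r m (mdeg m); rewrite h coef0 eqxx => <-.
have [c [i ec]] := monomial_factor pq0 e; exists i.
apply/dhomogP => m ms; apply/eqP; apply: contraT => /negbTE hm.
have := grading_coef p m (mdeg m); rewrite eqxx ec.
rewrite coefCM coefXn hm mulr0 mcoeff0 => /esym/eqP.
by rewrite mcoeff_eq0 ms.
Qed.
End HomogeneousFactors.

(** * Hypersurfaces and codimension in projective space *)

Section Hypersurfaces.
Variable K : closedFieldType.
Implicit Types (p q g h : {mpoly K[4]}) (x : vec K).

Definition zero_locus p : set (vec K) := [set x | nz x /\ p.@[x] = 0].

Lemma homogXU i : ('X_i : {mpoly K[4]}) \is 1.-homog.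
Proof. by rewrite dhomogX /= mdeg1. Qed.

Lemma X_neq0 i : ('X_i : {mpoly K[4]}) != 0.
Proof.
apply/negP => /eqP/(congr1 (meval (fun=> 1))); rewrite mevalXU meval0.
by apply/eqP; rewrite oner_neq0.
Qed.

Lemma zclosed_locus (S : set {mpoly K[4]}) :
  (forall p, S p -> exists m : nat, p \is m.-homog) ->
  zclosed [set x | nz x /\ forall p, S p -> p.@[x] = 0].
Proof.
move=> hS; have zU : is_zopen [set x | nz x /\ exists2 p, S p & p.@[x] != 0].
  by exists S.
exists (ZOpen zU); apply/seteqP; split=> x /= [nzx h]; split=> //.
  by move=> [_ [p /h -> /eqP]].
move=> p Sp; apply: contrapT => /eqP px; apply: h; split=> //; by exists p.
Qed.

Lemma zclosedP (Y : set (vec K)) : zclosed Y -> exists S : set {mpoly K[4]},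
  (forall p, S p -> exists m : nat, p \is m.-homog) /\
  Y = [set x | nz x /\ forall p, S p -> p.@[x] = 0].
Proof.
move=> [U ->]; have [S [hS e]] := zopenP U; exists S; split=> //.
rewrite e; apply/seteqP; split=> x /= [nzx h]; split=> //.
  by move=> p Sp; apply: contrapT => /eqP px; apply: h; split=> //; exists p.
by move=> [_ [p /h -> /eqP]].
Qed.

Lemma zclosed_zero_locus p k : p \is k.-homog -> zclosed (zero_locus p).
Proof.
move=> hp; have := @zclosed_locus [set p].
have -> : [set x | nz x /\ forall q, [set p] q -> q.@[x] = 0] = zero_locus p.
  by apply/seteqP; split=> x /= [nzx h]; split=> //; [apply: h|move=> q ->].
by apply=> q ->; exists k.
Qed.

Lemma zclosedI Y p k : zclosed Y -> p \is k.-homog -> zclosed (Y `&` zero_locus p).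
Proof.
move=> /zclosedP[S [hS ->]] hp; have := @zclosed_locus (S `|` [set p]).
set A := (X in zclosed X); set B := (X in _ -> zclosed X).
have -> : A = B.
  apply/seteqP; split=> x /= => [[nzx h]|[[nzx h] [_ h']]].
    by split; split=> //; [move=> q Sq; apply: h; left | apply: h; right].
  by split=> // q [/h//|->].
by apply=> q [/hS//|->]; exists k.
Qed.

(** If [g] divides [X_0], comparison of degrees makes it a constant multiple of [X_0], and then it
    cannot divide [X_1]. *)
Lemma prime_not_divides_vars g : prime_elt g -> exists i, ~ divides g 'X_i.
Proof.
move=> gP; apply: contrapT => /forallNP h.
have [[e0 h0] [e1 h1]] := (contrapT (h 0), contrapT (h 1)).
have [g0 gU _] := gP.
have e00 : e0 != 0 by apply: contraNneq (X_neq0 0) => hh; rewrite h0 hh mul0r.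
have s : msize e0 = 1%N.
  have := msizeM e00 g0; rewrite -h0 msizeX mdeg1.
  have : (1 < msize g)%N.
    by rewrite ltnNge; apply: contra gU => /msize1_polyC eg; exact: mpolyC_unit eg g0.
  have : (0 < msize e0)%N by rewrite lt0n msize_poly_eq0.
  by case: (msize e0) (msize g) => [|a] [|[|b]] // _ _; lia.
have ec : e0 = (e0@_0)%:MP by apply: msize1_polyC; rewrite s.
pose x : vec K := fun i => if i == 1 then 1 else 0.
have := congr1 (meval x) h0; rewrite mevalM mevalXU {1}ec mevalC /x /=.
move=> /esym/eqP; rewrite mulf_eq0 => /orP[/eqP hh|/eqP gx].
  by case/negP: e00; rewrite ec hh mpolyC0.
have := congr1 (meval x) h1; rewrite mevalM gx mulr0 mevalXU /x /=.
by move/eqP; rewrite oner_eq0.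
Qed.

Lemma nz_meval_var x i : ~ nz x -> ('X_i : {mpoly K[4]}).@[x] = 0.
Proof.
by move=> h; rewrite mevalXU; apply: contrapT => /eqP xi; apply: h; exists i.
Qed.

(** Vanishing at nonzero vectors says nothing about the origin. Multiplying [h] by a variable not
    divisible by [g] makes the product vanish there as well. *)
Lemma projective_nullstellensatz g h : prime_elt g ->
  (forall x, nz x -> g.@[x] = 0 -> h.@[x] = 0) -> divides g h.
Proof.
move=> gP gh; have [i ni] := prime_not_divides_vars gP.
have [_ _ /(_ 'X_i h)] := gP; case=> //.
apply: prime_nullstellensatz => // x gx; rewrite mevalM.
have [nzx|nzx] := pselect (nz x); first by rewrite gh // mulr0.
by rewrite nz_meval_var // mul0r.
Qed.

Lemma zirreducible_zero_locus g k : prime_elt g -> g \is k.-homog ->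
  zirreducible (zero_locus g).
Proof.
move=> gP gk; split; first exact: zclosed_zero_locus gk.
  (* Without zeros at nonzero vectors, [g] would divide every variable. *)
  apply: contrapT => /set0P/negP; rewrite negbK => /eqP E.
  have [i ni] := prime_not_divides_vars gP; apply: ni.
  apply: projective_nullstellensatz => // x nzx gx.
  have gx' : zero_locus g x by [].
  by rewrite E in gx'.
move=> Y1 Y2 /zclosedP[S1 [hS1 e1]] /zclosedP[S2 [hS2 e2]] e.
have [s1|] := pselect (zero_locus g `<=` Y1).
  by left; apply/seteqP; split=> // x Y1x; rewrite e; left.
move=> /existsNP[x /not_implyP[gx]]; rewrite e1 => nx.
right; apply/seteqP; split; last by move=> y Y2y; rewrite e; right.
have [p Sp px] : exists2 p, S1 p & p.@[x] != 0.
  apply: contrapT => /forall2NP H; apply: nx; split; first by case: gx.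
  by move=> p Sp; have [//|/negP] := H p; rewrite negbK => /eqP.
move=> y gy; rewrite e2; split; first by case: gy.
move=> q Sq; have : divides g (p * q).
  apply: projective_nullstellensatz => // z nzz gz; rewrite mevalM.
  have : zero_locus g z by split.
  rewrite e e1 e2 => -[[_ /(_ _ Sp) ->]|[_ /(_ _ Sq) ->]].
    by rewrite mul0r.
  by rewrite mulr0.
have [_ _ P] := gP; case/P => -[c ec].
  by case/negP: px; rewrite ec mevalM (proj2 gx) mulr0.
by rewrite ec mevalM (proj2 gy) mulr0.
Qed.

(** A case of the principal ideal theorem. In a chain from [zero_locus g] to [Y1] to [Y2] the set
    [Y1] is proper, so a nonzero form vanishes on it, and by irreducibility a prime factor [q] of
    that form already does. Then [q] vanishes on the zeros of [g], so [q] and [g] are associate and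
    [Y1] is no larger than [zero_locus g]. *)
Lemma codim_ge2_zero_locus (Z : set (vec K)) g k : codim_ge2 Z ->
  prime_elt g -> g \is k.-homog -> ~ (zero_locus g `<=` Z).
Proof.
move=> cZ gP gk gZ.
have [Y1 [Y2 [[cY1 Y10 iY1] [cY2 _ _] [gY1 ngY1] [Y12 nY12]]]] :=
  cZ _ (zirreducible_zero_locus gP gk) gZ.
have [S1 [hS1 e1]] := zclosedP cY1.
have [x [Y2x nY1x]] : exists x, Y2 x /\ ~ Y1 x.
  apply: contrapT => /forallNP H; apply: nY12 => x Y2x.
  by apply: contrapT => n1; apply: (H x).
have {nY12}[p Sp p0] : exists2 p, S1 p & p != 0.
  apply: contrapT => /forall2NP H; apply: nY1x; rewrite e1; split.
    by have [S2 [_ e2]] := zclosedP cY2; rewrite e2 in Y2x; case: Y2x.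
  by move=> p Sp; have [//|/negP] := H p; rewrite negbK => /eqP ->; rewrite meval0.
have [m pm] := hS1 _ Sp; have Y1p y : Y1 y -> p.@[y] = 0.
  by rewrite e1 => -[_]; apply.
have [u [s [uU sP ep]]] := factorial_mpoly p0.
have hs q r : p = q * r -> exists j, q \is j.-homog.
  by move=> e; apply: (@homog_factor _ _ q r m); rewrite -e.
have [q qs Y1q] : exists2 q, q \in s & Y1 `<=` zero_locus q.
  have {Y1p}: Y1 `<=` zero_locus (u * \prod_(q <- s) q).
    by move=> y Y1y; split; [rewrite e1 in Y1y; case: Y1y|rewrite -ep Y1p].
  (* Being a factor of the form [p] is carried along the induction: it makes every partial product
     homogeneous, so that its zero locus is closed. *)
  have : exists r, p = (u * \prod_(q <- s) q) * r by exists 1; rewrite mulr1.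
  elim: s {ep} sP => [|q s IH] sP [r er].
    have [y Y1y] := Y10 => /(_ y Y1y)[_].
    by rewrite big_nil mulr1 => /eqP; rewrite (negbTE (meval_unit _ uU)).
  rewrite big_cons mulrCA in er * => Y1q.
  have [j qj] : exists j, q \is j.-homog.
    by apply: (hs q (u * \prod_(k <- s) k * r)); rewrite er; ring.
  have [i si] : exists i, u * \prod_(k <- s) k \is i.-homog.
    by apply: (hs _ (q * r)); rewrite er; ring.
  have := iY1 _ _ (zclosedI cY1 qj) (zclosedI cY1 si); case.
  - apply/seteqP; split=> [y Y1y|y [[]//|[]//]].
    have [nzy] := Y1q y Y1y; rewrite mevalM => /eqP; rewrite mulf_eq0.
    by case/orP=> /eqP h; [left|right].
  - by move=> eY; exists q; [rewrite mem_head|rewrite eY; apply: subIsetr].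
  - move=> eY; have [|||q' qs' h] := IH.
    + by move=> q' qs'; apply: sP; rewrite in_cons qs' orbT.
    + by exists (r * q); rewrite er; ring.
    + by rewrite eY; apply: subIsetr.
    by exists q'; rewrite // in_cons qs' orbT.
have [v vU eq] : exists2 v, v \is a GRing.unit & q = v * g.
  apply: prime_elt_assoc => //; first exact: sP.
  apply: projective_nullstellensatz => // y nzy gy.
  by have /Y1q[] : Y1 y by apply: gY1.
apply: ngY1 => y /Y1q[nzy]; rewrite eq mevalM => /eqP.
by rewrite mulf_eq0 (negbTE (meval_unit _ vU)) /= => /eqP.
Qed.

Section CommonFactors.
Variables (Z : set (vec K)) (d : nat) (A : 'I_4 -> {mpoly K[4]}).
Hypotheses (codimZ : codim_ge2 Z) (homA : forall i, A i \is d.-homog)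
  (VA : forall x, nz x -> (forall i, (A i).@[x] = 0) -> Z x).

Lemma no_common_prime g : prime_elt g -> exists i, ~ divides g (A i).
Proof.
move=> gP; apply: contrapT => /forallNP h.
have gA i : divides g (A i) by apply: contrapT.
have gh p : prime_elt p -> (exists k, p \is k.-homog) ->
    (forall i, divides p (A i)) -> False.
  move=> pP [k pk] pA; apply: (codim_ge2_zero_locus codimZ pP pk).
  move=> x [nzx px]; apply: VA => // i; have [c ->] := pA i.
  by rewrite mevalM px mulr0.
(* [g] is homogeneous as a factor of a nonzero [A i]. If all [A i] vanish, any homogeneous prime
   leads to the contradiction, for instance a prime factor of [X_0]. *)
have [[i Ai]|A0] := pselect (exists i, A i != 0).
  apply: (gh g) => //; have [c ec] := gA i.
  by apply: (@homog_factor _ _ g c d); rewrite mulrC -ec.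
have XU : ('X_0 : {mpoly K[4]}) \isn't a GRing.unit.
  by apply/negP => /(meval_unit (fun=> 0)); rewrite mevalXU eqxx.
have [p pP [c ec]] := prime_factor (@factorial_mpoly K 4) (X_neq0 _) XU.
apply: (gh p pP).
  by apply: (@homog_factor _ _ p c 1); rewrite mulrC -ec ?X_neq0 ?homogXU.
move=> i; have [->|Ai] := eqVneq (A i) 0; first exact: divides0.
by case: A0; exists i.
Qed.

(** For a nonzero [A m], proportionality makes [A m] divide every product [A i * p m]. As the [A i]
    have no common prime, [A m] divides [p m]. *)
Lemma proportional_multiple (p : 'I_4 -> {mpoly K[4]}) :
  (forall i j, p i * A j = p j * A i) -> exists e, forall i, p i = A i * e.
Proof.
move=> h; have [m Am] : exists m, A m != 0.
  apply: contrapT => /forallNP A0.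
  have : divides ('X_0 : {mpoly K[4]}) 1.
    apply: (divides_of_all _ no_common_prime (X_neq0 _)) => [|i]; first exact: factorial_mpoly.
    have := A0 i => /negP; rewrite negbK => /eqP->.
    by rewrite mul0r; apply: divides0.
  move=> [c /(congr1 (meval (fun=> 0)))]; rewrite meval1 mevalM mevalXU mulr0.
  by move/eqP; rewrite oner_eq0.
have [e ee] : divides (A m) (p m).
  apply: (divides_of_all _ no_common_prime) => // [|i]; first exact: factorial_mpoly.
  by exists (p i); rewrite mulrC h.
exists e => i; apply: (mulIf Am); rewrite h ee; ring.
Qed.
End CommonFactors.
End Hypersurfaces.

(** * Regular functions *)

Section RegularFunctions.
Variable K : closedFieldType.
Implicit Types (U V W : zopen K) (x y : vec K) (f g : vec K -> K).
Implicit Types (p q : {mpoly K[4]}) (k l e : int).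

Lemma zopen_nz U x : pts U x -> nz x.
Proof. exact: subPP. Qed.

Fact zD_subproof p (hp : exists m : nat, p \is m.-homog) :
  is_zopen [set x | nz x /\ p.@[x] != 0].
Proof.
exists [set p]; split=> [q ->//|]; apply/seteqP; split=> x /= [nzx h]; split=> //.
  by exists p.
by case: h => q ->.
Qed.
Definition zD p hp := ZOpen (@zD_subproof p hp).

Fact zcap_subproof U V : is_zopen (pts U `&` pts V).
Proof.
have [S [hS eU]] := zopenP U; have [T [hT eV]] := zopenP V.
exists [set pq | exists p q, [/\ S p, T q & pq = p * q]]; split.
  move=> _ [p [q [/hS[m hp] /hT[n hq] ->]]]; exists (m + n)%N; exact: dhomogM.
rewrite eU eV; apply/seteqP; split=> x /=.
  move=> [[nzx [p Sp px]] [_ [q Tq qx]]]; split=> //; exists (p * q).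
    by exists p, q.
  by rewrite mevalM mulf_neq0.
move=> [nzx [_ [p [q [Sp Tq ->]]]]]; rewrite mevalM mulf_eq0 negb_or.
by move=> /andP[px qx]; split; split=> //; [exists p|exists q].
Qed.
Definition zcap U V := ZOpen (@zcap_subproof U V).

Lemma zcapl U V : zcap U V `<=` U. Proof. by move=> x []. Qed.
Lemma zcapr U V : zcap U V `<=` V. Proof. by move=> x []. Qed.

Definition chart (i : 'I_4) : zopen K := zD (ex_intro _ 1%N (homogXU K i)).

Lemma chartE i x : pts (chart i) x <-> x i != 0.
Proof.
by rewrite /= mevalXU; split=> [[]//|h]; split=> //; exists i.
Qed.

Lemma in_some_chart U x : pts U x -> exists i, pts (chart i) x.
Proof. by move=> /zopen_nz[i xi]; exists i; apply/chartE. Qed.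

Lemma chart_cover U x : pts U x ->
  exists V (VU : V `<=` U) (k : 'I_4), pts V x /\ V `<=` chart k.
Proof.
move=> Ux; have [k kx] := in_some_chart Ux.
by exists (zcap U (chart k)), (@zcapl U (chart k)), k; split=> //; exact: zcapr.
Qed.

(* [regular] without the normalisation outside [U]. *)
Variant rg k U f : Prop := Rg of
  forall x, pts U x -> exists (p q : {mpoly K[4]}) (m n : nat),
    [/\ p \is m.-homog, q \is n.-homog, m%:Z = n%:Z + k, q.@[x] != 0 &
        forall y, pts U y -> q.@[y] != 0 -> f y = p.@[y] / q.@[y]].

Lemma rgP k U f : rg k U f -> forall x, pts U x ->
  exists (p q : {mpoly K[4]}) (m n : nat),
    [/\ p \is m.-homog, q \is n.-homog, m%:Z = n%:Z + k, q.@[x] != 0 &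
        forall y, pts U y -> q.@[y] != 0 -> f y = p.@[y] / q.@[y]].
Proof. by case. Qed.

Lemma rg_reg k U (f : reg k U) : rg k U f.
Proof. by case: f => f []; split. Qed.

Lemma rg_eq k U f g : (forall x, pts U x -> f x = g x) -> rg k U f -> rg k U g.
Proof.
move=> fg /rgP hf; split=> x Ux; have [p [q [m [n [hp hq e qx h]]]]] := hf x Ux.
by exists p, q, m, n; split=> // y Uy qy; rewrite -fg // h.
Qed.

Lemma rg_sub k U V f : V `<=` U -> rg k U f -> rg k V f.
Proof.
move=> VU /rgP hf; split=> x /VU Ux; have [p [q [m [n [hp hq e qx h]]]]] := hf x Ux.
by exists p, q, m, n; split=> // y /VU; apply: h.
Qed.

Fact mkreg_subproof k U f : rg k U f -> regular k U (fun x => f x * indic U x).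
Proof.
move=> hf; split=> [x nUx|]; first by rewrite /indic asboolF // mulr0.
by apply: rgP; apply: (rg_eq _ hf) => x Ux; rewrite indicE // mulr1.
Qed.
Definition mkreg k U f (hf : rg k U f) : reg k U := Reg (mkreg_subproof hf).

Lemma mkregE k U f (hf : rg k U f) x : pts U x -> mkreg hf x = f x.
Proof. by move=> Ux; rewrite /= indicE // mulr1. Qed.

Lemma rg0 k U : rg k U (fun=> 0).
Proof. exact: rg_reg (reg0 k U). Qed.

Lemma rgD k U f g : rg k U f -> rg k U g -> rg k U (fun x => f x + g x).
Proof.
move=> hf hg; apply: (rg_eq _ (rg_reg (regD (mkreg hf) (mkreg hg)))) => x Ux.
by rewrite /= indicE // !mulr1.
Qed.

Lemma rgN k U f : rg k U f -> rg k U (fun x => - f x).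
Proof.
move=> hf; apply: (rg_eq _ (rg_reg (regN (mkreg hf)))) => x Ux.
by rewrite /= indicE // !mulr1.
Qed.

Lemma rgB k U f g : rg k U f -> rg k U g -> rg k U (fun x => f x - g x).
Proof. by move=> hf hg; apply: rgD => //; apply: rgN. Qed.

Lemma rgM j k l U f g : l = j + k -> rg j U f -> rg k U g ->
  rg l U (fun x => f x * g x).
Proof.
move=> -> hf hg; have h := Reg (regM_subproof (mkreg hf) (mkreg hg)).
apply: (rg_eq _ (rg_reg (Reg (regM_subproof (mkreg hf) (mkreg hg))))) => x Ux.
by rewrite /= indicE // !mulr1.
Qed.

Lemma rg_const U c : rg 0 U (fun=> c).
Proof.
apply: (rg_eq _ (rg_reg (regC U c))) => x Ux; by rewrite /= indicE // mulr1.
Qed.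

Lemma rg_sum k U (I : Type) (r : seq I) (P : pred I) (F : I -> vec K -> K) :
  (forall i, P i -> rg k U (F i)) -> rg k U (fun x => \sum_(i <- r | P i) F i x).
Proof.
move=> h; elim: r => [|i r IH].
  by apply: (rg_eq _ (rg0 k U)) => x _; rewrite big_nil.
have [Pi|nPi] := boolP (P i).
  by apply: (rg_eq _ (rgD (h i Pi) IH)) => x _; rewrite big_cons Pi.
by apply: (rg_eq _ IH) => x _; rewrite big_cons (negbTE nPi).
Qed.

Lemma rg_poly U p (m : nat) : p \is m.-homog -> rg m U (fun x => p.@[x]).
Proof.
move=> hp; split=> x Ux; exists p, 1, m, 0%N; split=> //.
- exact: dhomog1.
- by rewrite meval1 oner_neq0.
- by move=> y _ _; rewrite meval1 divr1.
Qed.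

Lemma rg_coord U i : rg 1 U (fun x => x i).
Proof.
have h : rg 1%N U _ := rg_poly U (homogXU K i).
by apply: (rg_eq _ h) => x _; rewrite mevalXU.
Qed.

Lemma rgV k U f : rg k U f -> (forall x, pts U x -> f x != 0) ->
  rg (- k) U (fun x => (f x)^-1).
Proof.
move=> /rgP hf f0; split=> x Ux; have [p [q [m [n [hp hq e qx h]]]]] := hf x Ux.
have p0 y : pts U y -> q.@[y] != 0 -> p.@[y] != 0.
  by move=> Uy qy; have := f0 y Uy; rewrite h //; apply: contraNneq => ->; rewrite mul0r.
exists (q * q), (p * q), (n + n)%N, (m + n)%N; split.
- exact: dhomogM.
- exact: dhomogM.
- by rewrite !PoszD e; ring.
- by rewrite mevalM mulf_neq0 // p0.
move=> y Uy; rewrite !mevalM mulf_eq0 negb_or => /andP[py qy].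
by rewrite h //; field; rewrite qy py.
Qed.

Lemma rg_exp k (n : nat) U f : rg k U f -> rg (k *+ n) U (fun x => f x ^+ n).
Proof.
move=> hf; elim: n => [|n IH]; first exact: rg_const.
by apply: (rg_eq _ (rgM (mulrS _ _) hf IH)) => x _; rewrite exprS.
Qed.

Lemma rg_chart_pow e U i : U `<=` chart i -> rg e U (fun x => x i ^ e).
Proof.
move=> Ui; case: e => n.
  by have := rg_exp n (rg_coord U i); rewrite -[1 *+ n]/(n%:R) natz.
have h x : pts U x -> x i ^+ n.+1 != 0.
  by move=> /Ui/chartE xi; rewrite expf_neq0.
have := rgV (rg_exp n.+1 (rg_coord U i)) h.
by rewrite -[1 *+ n.+1]/(n.+1%:R) natz.
Qed.

Lemma rg_local k U f : (forall x, pts U x ->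
    exists V : zopen K, [/\ pts V x, V `<=` U & rg k V f]) -> rg k U f.
Proof.
move=> H; split=> x Ux; have [V [Vx VU /rgP hf]] := H x Ux.
have [p [q [m [n [hp hq e qx h]]]]] := hf x Vx.
(* Regularity on [U] asks the fraction to be valid wherever its denominator is nonzero on [U]. Both
   terms are therefore multiplied by a form [s] whose nonvanishing implies membership in [V]. *)
have [S [hS eV]] := zopenP V; have : pts V x by [].
rewrite {1}eV => -[nzx [s Ss sx]]; have [a ha] := hS _ Ss.
exists (p * s), (q * s), (m + a)%N, (n + a)%N; split; try exact: dhomogM.
- by rewrite !PoszD e; ring.
- by rewrite mevalM mulf_neq0.
move=> y Uy; rewrite !mevalM mulf_eq0 negb_or => /andP[qy sy].
rewrite h //; first by field; rewrite qy sy.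
by rewrite eV; split; [exact: zopen_nz Uy|exists s].
Qed.

(** [P] describes a local problem whose solutions have determined values, so that solutions agree on
    overlaps. The glued function takes at each point the value of the solution chosen around it. *)
Lemma rg_glue k U (P : zopen K -> (vec K -> K) -> Prop) :
  (forall x, pts U x -> exists V f, [/\ pts V x, V `<=` U, rg k V f & P V f]) ->
  (forall V W f g x, P V f -> P W g -> pts V x -> pts W x -> f x = g x) ->
  exists f, rg k U f /\ forall x, pts U x ->
    exists V g, [/\ pts V x, V `<=` U, P V g & forall y, pts V y -> f y = g y].
Proof.
move=> ex un.
have /choice[F hF] : forall x, exists Vf : zopen K * (vec K -> K), pts U x ->
    [/\ pts Vf.1 x, Vf.1 `<=` U, rg k Vf.1 Vf.2 & P Vf.1 Vf.2].
  move=> x; have [Ux|nUx] := pselect (pts U x); last by exists (U, fun=> 0).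
  by have [V [f h]] := ex x Ux; exists (V, f).
pose f x := (F x).2 x.
have fE x y : pts U x -> pts (F x).1 y -> f y = (F x).2 y.
  move=> Ux xy; have [xx xU _ Px] := hF x Ux; have [yy _ _ Py] := hF y (xU y xy).
  exact: un Py Px yy xy.
exists f; split.
  apply: rg_local => x Ux; have [xx xU hx _] := hF x Ux.
  exists (F x).1; split=> //; apply: (rg_eq _ hx) => y xy.
  by rewrite (fE x).
move=> x Ux; have [xx xU hx Px] := hF x Ux.
by exists (F x).1, (F x).2; split=> // y xy; rewrite (fE x).
Qed.

Lemma zopen_dense U x p q : pts U x -> q != 0 ->
  (forall y, pts U y -> q.@[y] != 0 -> p.@[y] = 0) -> p = 0.
Proof.
move=> Ux q0 h; have [S [hS eU]] := zopenP U; move: Ux; rewrite eU.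
move=> [_ [s Ss sx]]; have s0 : s != 0.
  by apply: contraNneq sx => ->; rewrite meval0.
(* The factor [X_0] takes care of the origin, which lies in no open set. *)
have : p * (q * s * 'X_0) = 0.
  apply: mpoly_eval_inj => y; rewrite !mevalM mevalXU meval0.
  have [nzy|nzy] := pselect (nz y); last first.
    suff -> : y 0 = 0 by rewrite !mulr0.
    by apply: contrapT => /eqP y0; apply: nzy; exists 0.
  have [->|qy] := eqVneq q.@[y] 0; first by rewrite !mul0r mulr0.
  have [->|sy] := eqVneq s.@[y] 0; first by rewrite mulr0 mul0r mulr0.
  by rewrite h ?mul0r // eU; split=> //; exists s.
move/eqP; rewrite mulf_eq0 => /orP[/eqP//|].
by rewrite !mulf_eq0 (negbTE q0) (negbTE s0) (negbTE (X_neq0 K 0)).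
Qed.

Lemma rg_dense k U f q : q != 0 -> rg k U f ->
  (forall x, pts U x -> q.@[x] != 0 -> f x = 0) -> forall x, pts U x -> f x = 0.
Proof.
move=> q0 hf h x Ux; have [p [r [m [n [hp hr e rx hE]]]]] := rgP hf Ux.
suff p0 : p = 0 by rewrite hE // p0 meval0 mul0r.
have r0 : r != 0 by apply: contraNneq rx => ->; rewrite meval0.
apply: (zopen_dense Ux (mulf_neq0 q0 r0)) => y Uy.
rewrite mevalM mulf_eq0 negb_or => /andP[qy ry].
have := h y Uy qy; rewrite hE // => /eqP.
by rewrite mulf_eq0 invr_eq0 (negbTE ry) orbF => /eqP.
Qed.

Lemma rg_dense_eq k U f g q : q != 0 -> rg k U f -> rg k U g ->
  (forall x, pts U x -> q.@[x] != 0 -> f x = g x) -> forall x, pts U x -> f x = g x.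
Proof.
move=> q0 hf hg h x Ux; apply/eqP; rewrite -subr_eq0; apply/eqP.
by apply: (rg_dense q0 (rgB hf hg)) Ux => y Uy qy; rewrite h // subrr.
Qed.

Lemma rg_common_denom (I : finType) e U (f : I -> vec K -> K) x :
  (forall i, rg e U (f i)) -> pts U x -> exists (p : I -> {mpoly K[4]}) q (m : I -> nat) n,
    [/\ forall i, p i \is (m i).-homog, q \is n.-homog,
        forall i, (m i)%:Z = n%:Z + e, q.@[x] != 0 &
        forall i y, pts U y -> q.@[y] != 0 -> f i y = (p i).@[y] / q.@[y]].
Proof.
move=> hf Ux.
have /choice[F hF] : forall i, exists F : {mpoly K[4]} * {mpoly K[4]} * nat * nat,
    let: (p, q, m, n) := F in [/\ p \is m.-homog, q \is n.-homog,
        m%:Z = n%:Z + e, q.@[x] != 0 &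
        forall y, pts U y -> q.@[y] != 0 -> f i y = p.@[y] / q.@[y]].
  move=> i; have [p [q [m [n h]]]] := rgP (hf i) Ux; by exists (p, q, m, n).
pose p i := (F i).1.1.1; pose q i := (F i).1.1.2.
pose m i := (F i).1.2; pose n i := (F i).2.
have H i : [/\ p i \is (m i).-homog, q i \is (n i).-homog,
        (m i)%:Z = (n i)%:Z + e, (q i).@[x] != 0 &
        forall y, pts U y -> (q i).@[y] != 0 -> f i y = (p i).@[y] / (q i).@[y]].
  by have := hF i; rewrite /p /q /m /n; case: (F i) => [[[]]].
have hprod (P : pred I) : \prod_(i | P i) q i \is (\sum_(i | P i) n i)%N.-homog.
  elim/big_rec2: _ => [|i a b _ hb]; first exact: dhomog1.
  by apply: dhomogM => //; case: (H i).
exists (fun i => p i * \prod_(j | j != i) q j), (\prod_i q i),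
  (fun i => m i + \sum_(j | j != i) n j)%N, (\sum_i n i)%N; split.
- by move=> i; apply: dhomogM => //; case: (H i).
- exact: hprod.
- move=> i; rewrite [in RHS](bigD1 i) //=; have [_ _ e' _ _] := H i.
  by rewrite !PoszD e'; ring.
- by rewrite rmorph_prod; apply/prodf_neq0 => i _; case: (H i).
move=> i y Uy; rewrite (bigD1 i) //= !mevalM mulf_eq0 negb_or => /andP[qy ry].
by have [_ _ _ _ h] := H i; rewrite h //; field; rewrite qy ry.
Qed.

(* Over projective space, the reduced denominator of a section of O(k) has no
   zero, hence is constant. *)
Lemma global_section k f : rg k (PP K) f -> exists p,
  (forall x, nz x -> f x = p.@[x]) /\ (p = 0 \/ exists2 m : nat, k = m%:Z & p \is m.-homog).
Proof.
move=> hf; pose x0 : vec K := fun=> 1.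
have nz0 : nz x0 by exists 0; rewrite oner_neq0.
have [p [q [m [n [hp hq e qx h]]]]] := rgP hf (nz0 : pts (PP K) x0).
have q0 : q != 0 by apply: contraNneq qx => ->; rewrite meval0.
have [p0|p0] := eqVneq p 0.
  exists 0; split; last by left.
  move=> x nzx; rewrite meval0; apply: (rg_dense q0 hf) nzx => y nzy qy.
  by rewrite h // p0 meval0 mul0r.
have ufd := @factorial_mpoly K 4.
have [c [p' [q' [ep eq H]]]] := reduced_fraction p ufd q0.
have c0 : c != 0 by apply: contraNneq q0 => hh; rewrite eq hh mul0r.
have q'0 : q' != 0 by apply: contraNneq q0 => hh; rewrite eq hh mulr0.
have q'nz x : nz x -> q'.@[x] != 0.
  move=> nzx; have [p1 [q1 [m1 [n1 [_ _ _ q1x h1]]]]] := rgP hf (nzx : pts (PP K) x).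
  have q10 : q1 != 0 by apply: contraNneq q1x => ->; rewrite meval0.
  have E : p1 * q' = p' * q1.
    apply/eqP; rewrite -subr_eq0; apply/eqP.
    apply: (@zopen_dense (PP K) x _ (q1 * q)) => //; first exact: mulf_neq0.
    move=> y nzy; rewrite mevalM mulf_eq0 negb_or => /andP[q1y qy].
    have := h1 y nzy q1y; rewrite h // ep eq !mevalM.
    move: qy; rewrite eq mevalM mulf_eq0 negb_or => /andP[cy q'y].
    rewrite mevalB !mevalM => E; have -> : p1.@[y] = p1.@[y] / q1.@[y] * q1.@[y].
      by rewrite divfK.
    by rewrite -E; field; rewrite cy q'y.
  (* [p'] and [q'] have no common prime, and [q'] divides both [p' * q1] and [q' * q1]. *)
  have [e' ee'] : divides q' q1.
    apply: (@divides_of_all _ bool (fun b => if b then p' else q')) => //.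
      move=> g gP; have [d|d] := pselect (divides g p'); last by exists true.
      by exists false; apply: H.
    by move=> [|]; [exists p1; rewrite E | exists q1; rewrite mulrC].
  by move: q1x; rewrite ee' mevalM mulf_eq0 negb_or => /andP[].
have [n' hq'] : exists n', q' \is n'.-homog.
  by apply: (@homog_factor _ _ q' c n); rewrite mulrC -eq.
have q'U : q' \is a GRing.unit.
  apply: contrapT => /negP nU; have [g gP [b eb]] := prime_factor ufd q'0 nU.
  have [j gj] : exists j, g \is j.-homog.
    by apply: (@homog_factor _ _ g b n'); rewrite mulrC -eb.
  have [_ [x [nzx gx]] _] := zirreducible_zero_locus gP gj.
  by have := q'nz x nzx; rewrite eb mevalM gx mulr0 eqxx.
have ec : q' = (q'@_0)%:MP by case/andP: q'U => /eqP.
have p'0 : p' != 0 by apply: contraNneq p0 => hh; rewrite ep hh mulr0.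
have [j hp'] : exists j, p' \is j.-homog.
  by apply: (@homog_factor _ _ p' c m); rewrite mulrC -ep.
have [i hc] : exists i, c \is i.-homog.
  by apply: (@homog_factor _ _ c p' m); rewrite -ep.
have n'0 : n' = 0%N.
  apply: (dhomog_uniq q'0 hq'); rewrite ec -[_%:MP]mulr1 mul_mpolyC.
  by apply: rpredZ; apply: dhomog1.
have ei : i = n.
  apply: dhomog_uniq q0 _ hq; move: (dhomogM hc hq'); by rewrite n'0 addn0 -eq.
have em : m = (i + j)%N.
  by apply: dhomog_uniq p0 hp _; rewrite ep; exact: dhomogM.
have ek : k = j%:Z.
  by move: e; rewrite em ei PoszD; move/addrI.
have u0 : q'@_0 != 0 by have := q'nz x0 nz0; rewrite {1}ec mevalC.
exists ((q'@_0)^-1 *: p'); split; last by right; exists j => //; apply: rpredZ.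
have hr : rg k (PP K) (fun x => ((q'@_0)^-1 *: p').@[x]).
  by rewrite ek; apply: rg_poly; apply: rpredZ.
apply: (rg_dense_eq q0 hf hr) => x nzx qx'; rewrite h // ep eq !mevalM mevalZ.
move: qx'; rewrite eq mevalM mulf_eq0 negb_or => /andP[cx _].
by rewrite {1}ec mevalC; field; rewrite cx u0.
Qed.

End RegularFunctions.

(** * Bivectors in dimension four *)

Notation o0 := (@Ordinal 4 0 isT).
Notation o1 := (@Ordinal 4 1 isT).
Notation o2 := (@Ordinal 4 2 isT).
Notation o3 := (@Ordinal 4 3 isT).

Lemma ord4_ind (P : 'I_4 -> Prop) : P o0 -> P o1 -> P o2 -> P o3 -> forall i, P i.
Proof.
move=> h0 h1 h2 h3 [[|[|[|[|n]]]] hi] //.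
- by rewrite (_ : Ordinal hi = o0) //; apply/val_inj.
- by rewrite (_ : Ordinal hi = o1) //; apply/val_inj.
- by rewrite (_ : Ordinal hi = o2) //; apply/val_inj.
- by rewrite (_ : Ordinal hi = o3) //; apply/val_inj.
Qed.

Section PointwiseAlgebra.
Variable K : fieldType.
Implicit Types (x v w a : 'I_4 -> K) (m : 'I_4 -> 'I_4 -> K).

Lemma sum4 (F : 'I_4 -> K) : \sum_i F i = F o0 + F o1 + F o2 + F o3.
Proof.
rewrite !big_ord_recl big_ord0 addr0 !addrA.
by congr (F _ + F _ + F _ + F _); apply/val_inj.
Qed.

Lemma sum_delta v (s : 'I_4) : \sum_i v i * (s == i)%:R = v s.
Proof. by rewrite sum4; move: s; apply: ord4_ind => /=; ring. Qed.

Definition dot a v := \sum_i a i * v i.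
Definition wedge x v : 'I_4 -> 'I_4 -> K := fun i j => x i * v j - x j * v i.

(** The Hodge dual. Complementary indices are ordered so that no sign occurs; thus every
    off-diagonal entry of [star m] is an entry of [m], even when [m] is not alternating. *)
Definition star m (i j : 'I_4) : K :=
  match nat_of_ord i, nat_of_ord j with
  | 0, 1 => m o2 o3 | 0, 2 => m o3 o1 | 0, 3 => m o1 o2
  | 1, 2 => m o0 o3 | 1, 3 => m o2 o0 | 2, 3 => m o0 o1
  | 1, 0 => m o3 o2 | 2, 0 => m o1 o3 | 3, 0 => m o2 o1
  | 2, 1 => m o3 o0 | 3, 1 => m o0 o2 | 3, 2 => m o1 o0
  | _, _ => 0%R
  end%N.

Lemma sum_wedge_delta x v i j :
  \sum_r v r * wedge x (fun s => (s == r)%:R) i j = wedge x v i j.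
Proof.
rewrite /wedge -(sum_delta v i) -(sum_delta v j) !mulr_sumr -sumrB.
by apply: eq_bigr => r _; ring.
Qed.

(* The determinant of [e_l, x, v, w], up to sign. *)
Definition eta x v w (l : 'I_4) : K := \sum_i w i * star (wedge x v) i l.

(** For [s = x /\ v] and [t = x /\ w] this is the rank one matrix with entries [x k * eta x v w l].
    Being written in [s] and [t] alone, it involves no choice of [v] and [w]. *)
Definition pair_mx (s t : 'I_4 -> 'I_4 -> K) k l : K := \sum_i t k i * star s i l.

Lemma eq_star m m' i j : (forall i j, m i j = m' i j) -> star m i j = star m' i j.
Proof. by move=> h; move: i j; do 2!apply: ord4_ind; rewrite /star /= ?h. Qed.

Lemma pair_mxE x v w (s t : 'I_4 -> 'I_4 -> K) k l :
  (forall i j, s i j = wedge x v i j) -> (forall i j, t i j = wedge x w i j) ->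
  pair_mx s t k l = x k * eta x v w l.
Proof.
move=> hs ht; rewrite /pair_mx (eq_bigr (fun i => wedge x w k i * star (wedge x v) i l)).
  rewrite /eta !sum4 /wedge; move: l; apply: ord4_ind; rewrite /star /=; ring.
by move=> i _; rewrite ht (eq_star _ _ hs).
Qed.

(** Contraction of the trivector [x /\ v /\ w] with [a]. If [a] kills the three vectors, all 2 by 2
    minors of [a] and [eta x v w] vanish. *)
Lemma eta_cramer a x v w (l r : 'I_4) :
  a r * eta x v w l - a l * eta x v w r =
  dot a w * star (wedge x v) r l + dot a x * star (wedge v w) r l
  + dot a v * star (wedge w x) r l.
Proof.
rewrite /eta /dot !sum4 /wedge; move: l r; apply: ord4_ind; apply: ord4_ind;
  rewrite /star /=; ring.
Qed.

Lemma eta_proportional a x v w (l r : 'I_4) : dot a x = 0 -> dot a v = 0 -> dot a w = 0 ->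
  eta x v w l * a r = eta x v w r * a l.
Proof.
move=> ax av aw; apply/eqP; rewrite -subr_eq0 ![_ * a _]mulrC eta_cramer.
by rewrite ax av aw !mul0r !addr0.
Qed.

(** Cramer's rule for [x], [s], [t], [w] and a basis vector, taken modulo [x]; the factor on the
    right is the determinant of the four vectors, up to sign. *)
Lemma eta_relation x s t w i j l :
  eta x s t l * wedge x w i j + eta x t w l * wedge x s i j
  + eta x w s l * wedge x t i j =
  dot w (eta x s t) * (x i * (j == l)%:R - x j * (i == l)%:R).
Proof.
rewrite /eta /dot !sum4 /wedge; move: i j l; do 3!apply: ord4_ind;
  rewrite /star /=; ring.
Qed.

Lemma dot_eta a x v w l : dot a x = 0 -> dot a v = 0 -> dot a w = 0 ->
  a l != 0 -> forall u, dot a u = 0 -> dot u (eta x v w) = 0.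
Proof.
move=> ax av aw al u au; apply: (mulIf al); rewrite mul0r /dot mulr_suml.
rewrite (eq_bigr (fun i => a i * u i * eta x v w l)).
  by rewrite -mulr_suml -/(dot a u) au mul0r.
move=> i _; rewrite -[LHS]mulrA (eta_proportional i l ax av aw); ring.
Qed.

Lemma wedge_cyclic x v i j k :
  x k * wedge x v i j = x i * wedge x v k j - x j * wedge x v k i.
Proof. by rewrite /wedge; ring. Qed.

Definition alternating m := (forall i, m i i = 0) /\ forall i j, m i j = - m j i.

(** Duality turns contraction with [x] into exterior product, so [x /\ star m = 0]; this is its
    coordinate form. Division by [x k] then exhibits [star m] as some [x /\ v]. *)
Lemma star_cyclic x m i j k : alternating m -> (forall l, \sum_i x i * m i l = 0) ->
  x k * star m i j = x i * star m k j - x j * star m k i.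
Proof.
move=> [m0 mN] h; have := h o0; have := h o1; have := h o2; have := h o3.
rewrite !sum4 !m0 (mN o1 o0) (mN o2 o0) (mN o3 o0) (mN o2 o1) (mN o3 o1) (mN o3 o2).
move=> h3 h2 h1 h0; apply/eqP; rewrite -subr_eq0; apply/eqP; move: i j k.
have n (a b : K) : a = 0 -> b = a \/ b = - a -> b = 0.
  by move=> -> [->//|->]; rewrite oppr0.
do 3!apply: ord4_ind; rewrite /star /= ?(mN o1 o0) ?(mN o2 o0) ?(mN o3 o0)
  ?(mN o2 o1) ?(mN o3 o1) ?(mN o3 o2); first
  [ by ring | by apply: n h0 _; first [left; ring | right; ring]
  | by apply: n h1 _; first [left; ring | right; ring]
  | by apply: n h2 _; first [left; ring | right; ring]
  | by apply: n h3 _; first [left; ring | right; ring]].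
Qed.

(** Duality exchanges exterior product with [a] and contraction with [a]. *)
Lemma star_annihilated a m k : alternating m ->
  (forall i j r, a r * m i j + a i * m j r + a j * m r i = 0) ->
  \sum_j a j * star m k j = 0.
Proof.
move=> [m0 mN] h; rewrite sum4; move: k; apply: ord4_ind; rewrite /star /=.
- by rewrite -[RHS](h o2 o3 o1); ring.
- by rewrite -[RHS](h o3 o2 o0); ring.
- by rewrite -[RHS](h o3 o0 o1) [m o1 o3]mN; ring.
- by rewrite -[RHS](h o1 o0 o2); ring.
Qed.

Lemma star_star m i j : alternating m -> star (star m) i j = m i j.
Proof.
move=> [m0 mN]; move: i j; apply: ord4_ind; apply: ord4_ind;
  by rewrite /star /= ?m0.
Qed.

(** The Koszul relations of [a]: polynomial in [a], and spanning the vectors killed by [a] wherever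
    [a l] is nonzero, by [sum_koszul]. *)
Definition koszul a i l : 'I_4 -> K :=
  fun j => a l * (j == i)%:R - a i * (j == l)%:R.

Lemma dot_koszul a i l : dot a (koszul a i l) = 0.
Proof.
rewrite /dot /koszul sum4; move: i l; apply: ord4_ind; apply: ord4_ind => /=; ring.
Qed.

Lemma sum_koszul a u l j :
  \sum_i u i * koszul a i l j = a l * u j - dot a u * (j == l)%:R.
Proof.
rewrite /dot /koszul !sum4; move: l j; apply: ord4_ind; apply: ord4_ind => /=; ring.
Qed.

Lemma koszul_cyclic a i l r j :
  a r * koszul a i l j + a i * koszul a l r j + a l * koszul a r i j = 0.
Proof. by rewrite /koszul; ring. Qed.

(** The reason why a linear form on tangent fields is determined by its values on Koszul fields: up
    to the factor [x k * a l], any field is a combination of these with its own entries as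
    coefficients. *)
Lemma koszul_combination a x w l k i j : dot a x = 0 -> dot a w = 0 ->
  \sum_r wedge x w k r * wedge x (koszul a r l) i j =
  x k * a l * wedge x w i j.
Proof.
move=> ax aw; have am : dot a (wedge x w k) = 0.
  have -> : dot a (wedge x w k) = x k * dot a w - w k * dot a x.
    by rewrite /dot /wedge !sum4; ring.
  by rewrite ax aw !mulr0 subrr.
transitivity (x i * (\sum_r wedge x w k r * koszul a r l j)
            - x j * (\sum_r wedge x w k r * koszul a r l i)).
  by rewrite !sum4 /wedge; ring.
by rewrite !sum_koszul am !mul0r !subr0 /wedge; ring.
Qed.

(** [star] at [k], [l] selects the two complementary indices. The Koszul bivectors belonging to them
    have pairing [a l * x k], so they form a basis where this is nonzero. *)
Lemma eta_koszul a x k l p : k != l -> dot a x = 0 ->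
  star (fun i r => eta x (koszul a i l) (koszul a r l) p) k l = a l * a p * x k.
Proof.
move=> kl ax; transitivity (a l * a p * x k - dot a x * (a l * (p == k)%:R)).
  move: kl; rewrite {ax}; move: k l p; do 3!apply: ord4_ind; rewrite //= => _;
    rewrite /star /= /eta /dot /koszul !sum4 /wedge /star /=; ring.
by rewrite ax mul0r subr0.
Qed.
End PointwiseAlgebra.

(** * Maps between line bundles *)

Section BilinearSections.
Variable K : closedFieldType.
Implicit Types (U V W : zopen K) (x y : vec K) (f g : vec K -> K).

Definition chart_gen (k : int) U i (Ui : U `<=` chart K i) : reg k U :=
  mkreg (rg_chart_pow k Ui).

Lemma chart_genE k U i (Ui : U `<=` chart K i) x : pts U x ->
  chart_gen k Ui x = x i ^ k.
Proof. exact: mkregE. Qed.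

Lemma chart_gen_neq0 k U i (Ui : U `<=` chart K i) x : pts U x ->
  chart_gen k Ui x != 0.
Proof. by move=> Ux; rewrite chart_genE // expfz_neq0 //; apply/chartE/Ui. Qed.

Lemma chart_decomposition k U i (Ui : U `<=` chart K i) (a : reg k U) :
  exists c : OO U, a = c *: chart_gen k Ui.
Proof.
exists (mkreg (rgM (esym (subrr k)) (rg_reg a) (rg_chart_pow (- k) Ui))).
apply: reg_eqP => x Ux.
have -> (c : OO U) : (c *: chart_gen k Ui : reg k U) x = c x * chart_gen k Ui x by [].
rewrite chart_genE // mkregE // -mulrA -expfzDr ?addNr ?expr0z ?mulr1 //.
exact/chartE/Ui.
Qed.

Lemma scale_regE k U (c : OO U) (a : reg k U) x : (c *: a) x = c x * a x.
Proof. by []. Qed.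

(** On a chart, powers of the coordinate generate [O(j)] and [O(k)], so [B] is multiplication by its
    value on the two generators, corrected to degree [l - j - k]. These multipliers glue. *)
Lemma bilinear_section (j k l : int) U
    (B : forall V : zopen K, V `<=` U -> reg j V -> reg k V -> reg l V) :
  (forall V VU (c : OO V) a b, B V VU (c *: a) b = c *: B V VU a b) ->
  (forall V VU (c : OO V) a b, B V VU a (c *: b) = c *: B V VU a b) ->
  (forall V W VU WU (WV : W `<=` V) a b,
     B W WU (regR WV a) (regR WV b) = regR WV (B V VU a b)) ->
  exists f, rg (l - j - k) U f /\
    forall V VU a b x, pts V x -> B V VU a b x = f x * a x * b x.
Proof.
move=> Bl Br Bres.
pose P V f := V `<=` U /\ forall W (WV : W `<=` V) (WU : W `<=` U) a b x, pts W x ->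
  B W WU a b x = f x * a x * b x.
have [||f [hf fP]] := @rg_glue K (l - j - k) U P.
- move=> x Ux; have [i ix] := in_some_chart Ux.
  pose V := zcap U (chart K i); have Vi : V `<=` chart K i := @zcapr K _ _.
  pose b0 := B V (@zcapl K _ _) (chart_gen j Vi) (chart_gen k Vi).
  exists V, (fun x => b0 x * x i ^ (- j) * x i ^ (- k)); split=> //.
    exact: zcapl.
    apply: (rgM (j := l - j) (k := - k) erefl); last exact: rg_chart_pow.
    by apply: (rgM (j := l) (k := - j) erefl); [exact: rg_reg|exact: rg_chart_pow].
  split=> [|W WV WU a b y Wy]; first exact: zcapl.
  have Wi := classical_sets.subset_trans WV Vi.
  have [c ->] := chart_decomposition Wi a; have [e ->] := chart_decomposition Wi b.
  have yi : y i != 0 by apply/chartE/Wi.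
  rewrite Bl Br !scale_regE !chart_genE //.
  have -> : B W WU (chart_gen j Wi) (chart_gen k Wi) y = b0 y.
    have r m : chart_gen m Wi = regR WV (chart_gen m Vi).
      by apply: reg_eqP => z Wz; rewrite regRE // !chart_genE //; apply: WV.
    by rewrite !r (Bres _ _ (@zcapl K _ _)) regRE.
  rewrite [RHS](_ : _ = c y * (e y * b0 y) * (y i ^ (- j) * y i ^ j) *
    (y i ^ (- k) * y i ^ k)); last by ring.
  by rewrite -!expfzDr // !addNr !expr0z !mulr1.
- move=> V W f g x [VU hf] [WU hg] Vx Wx; have [i ix] := in_some_chart Vx.
  pose T := zcap (zcap V W) (chart K i).
  have Ti : T `<=` chart K i := @zcapr K _ _.
  have TV : T `<=` V by move=> y [[]].
  have TW : T `<=` W by move=> y [[]].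
  have Tx : pts T x by [].
  have e1 := hf T TV (classical_sets.subset_trans TV VU) (chart_gen j Ti) (chart_gen k Ti) x Tx.
  have := hg T TW (classical_sets.subset_trans TV VU) (chart_gen j Ti) (chart_gen k Ti) x Tx.
  rewrite e1 => /(mulIf (chart_gen_neq0 k Ti Tx)).
  by move/(mulIf (chart_gen_neq0 j Ti Tx)).
exists f; split=> // V VU a b x Vx; have [W [g [Wx WU [_ hg] fg]]] := fP x (VU x Vx).
pose T := zcap V W; have TV : T `<=` V := @zcapl K _ _.
have TW : T `<=` W := @zcapr K _ _; have Tx : pts T x by [].
have TU := classical_sets.subset_trans TV VU.
rewrite fg // -(regRE TV _ Tx) -(Bres _ _ VU TU TV) (hg _ TW TU) //.
by rewrite !regRE.
Qed.

(** The bilinear case with [O(0)] as second factor. *)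
Lemma linear_section (j l : int) U
    (B : forall V : zopen K, V `<=` U -> reg j V -> reg l V) :
  (forall V VU (c : OO V) a, B V VU (c *: a) = c *: B V VU a) ->
  (forall V W VU WU (WV : W `<=` V) a,
     B W WU (regR WV a) = regR WV (B V VU a)) ->
  exists f, rg (l - j) U f /\
    forall V VU a x, pts V x -> B V VU a x = f x * a x.
Proof.
move=> Bl Bres.
have [|||f [hf fB]] := @bilinear_section j 0 l U
  (fun V VU a b => (b : OO V) *: B V VU a).
- by move=> V VU c a b; rewrite Bl !scalerA mulrC.
- by move=> V VU c a b; apply: reg_eqP => x Vx; rewrite /= mulrA.
- move=> V W VU WU WV a b; rewrite (Bres _ _ VU); apply: reg_eqP => x Wx.
  by rewrite scale_regE !regRE // scale_regE.
exists f; split=> [|V VU a x Vx]; first by rewrite subr0 in hf.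
have := fB V VU a (1 : OO V) x Vx; rewrite scale1r => ->.
by rewrite /= indicE // !mulr1.
Qed.
End BilinearSections.

(** * Division by coefficients without common factor *)

Section Divisibility.
Variables (K : closedFieldType) (d : nat) (A : 'I_4 -> {mpoly K[4]}).
Hypothesis homA : forall i, A i \is d.-homog.
Hypothesis coprimeA : forall p : 'I_4 -> {mpoly K[4]},
  (forall i j, p i * A j = p j * A i) -> exists e, forall i, p i = A i * e.
Implicit Types (U V W : zopen K) (x y : vec K) (f g : vec K -> K).

Lemma some_coef_neq0 : exists i, A i != 0.
Proof.
apply: contrapT => /forallNP A0.
have Ai i : A i = 0 by have /negP := A0 i; rewrite negbK => /eqP.
have [|e h] := coprimeA (p := fun=> 1); first by move=> i j; rewrite !Ai.
by have /eqP := h 0; rewrite Ai mul0r oner_eq0.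
Qed.

(** Near each point the [M l] have a common denominator, and the numerators, being proportional to
    [A], are a polynomial multiple of [A]. The quotient thus extends over the common zeros of
    [A]. *)
Lemma rg_divide (e : int) U (M : 'I_4 -> vec K -> K) :
  (forall l, rg e U (M l)) ->
  (forall x l m, pts U x -> M l x * (A m).@[x] = M m x * (A l).@[x]) ->
  exists h, rg (e - d%:Z) U h /\ forall x l, pts U x -> M l x = (A l).@[x] * h x.
Proof.
move=> hM prop; have [m Am] := some_coef_neq0.
pose P V h := [/\ V `<=` U, rg (e - d%:Z) V h &
  forall x l, pts V x -> M l x = (A l).@[x] * h x].
have [||h [hh hP]] := @rg_glue K (e - d%:Z) U P; last first.
- exists h; split=> // x l Ux; have [V [g [Vx VU [_ _ hg] fg]]] := hP x Ux.
  by rewrite fg // hg.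
- move=> V W f g x [VU hf fE] [WU hg gE] Vx Wx.
  have hf' : rg (e - d%:Z) (zcap V W) f := rg_sub (@zcapl K _ _) hf.
  have hg' : rg (e - d%:Z) (zcap V W) g := rg_sub (@zcapr K _ _) hg.
  apply: (rg_dense_eq Am hf' hg') => // y [Vy Wy] Amy.
  by apply: (mulfI Amy); rewrite -fE // -gE.
move=> x Ux; have [p [q [a [n [hp hq ea qx pE]]]]] := rg_common_denom hM Ux.
have q0 : q != 0 by apply: contraNneq qx => ->; rewrite meval0.
have [c pA] : exists c, forall i, p i = A i * c.
  apply: coprimeA => i j; apply/eqP; rewrite -subr_eq0; apply/eqP.
  apply: (zopen_dense Ux q0) => y Uy qy; rewrite mevalB !mevalM.
  have := prop y i j Uy; rewrite !pE // => E.
  have -> : (p i).@[y] * (A j).@[y] - (p j).@[y] * (A i).@[y] =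
    q.@[y] * ((p i).@[y] / q.@[y] * (A j).@[y] - (p j).@[y] / q.@[y] * (A i).@[y]).
    by field.
  by rewrite E subrr mulr0.
pose V := zcap U (zD (ex_intro _ n hq)).
have VU : V `<=` U := @zcapl K _ _.
have hc : rg (e - d%:Z) V (fun y => c.@[y] / q.@[y]).
  have [c0|c0] := eqVneq c 0.
    by apply: (rg_eq _ (rg0 _ _)) => y _; rewrite c0 meval0 mul0r.
  have pm0 : c * A m != 0 by rewrite mulf_neq0.
  have [j cj] : exists j, c \is j.-homog.
    by apply: (@homog_factor _ _ c (A m) (a m)); rewrite // mulrC -pA.
  have aj : a m = (j + d)%N.
    by apply: dhomog_uniq pm0 _ (dhomogM cj (homA m)); rewrite mulrC -pA.
  have hqV : rg (- n%:Z) V (fun y => q.@[y]^-1).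
    by apply: rgV; [exact: rg_poly | move=> y [_ []]].
  apply: rgM (rg_poly V cj) hqV.
  by have := ea m; rewrite aj PoszD => /eqP; rewrite -subr_eq => /eqP <-; ring.
exists V, (fun y => c.@[y] / q.@[y]); split=> //.
  by split=> //; split=> //; apply: zopen_nz Ux.
split=> // y l [Uy [_ qy]]; rewrite pE // pA mevalM mulrA //.
Qed.

(** On the chart of [x i], row [i] divided by [x i] is proportional to [A], so [rg_divide] applies;
    the other rows follow from proportionality to [x]. *)
Lemma rg_divide2 (e : int) U (M : 'I_4 -> 'I_4 -> vec K -> K) :
  (forall k l, rg e U (M k l)) ->
  (forall x k l m, pts U x -> M k l x * x m = M m l x * x k) ->
  (forall x k l m, pts U x -> M k l x * (A m).@[x] = M k m x * (A l).@[x]) ->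
  exists h, rg (e - 1 - d%:Z) U h /\
    forall x k l, pts U x -> M k l x = x k * (A l).@[x] * h x.
Proof.
move=> hM propx propA; have [m Am] := some_coef_neq0.
pose P V h := [/\ V `<=` U, rg (e - 1 - d%:Z) V h &
  forall x k l, pts V x -> M k l x = x k * (A l).@[x] * h x].
have [||h [hh hP]] := @rg_glue K (e - 1 - d%:Z) U P; last first.
- exists h; split=> // x k l Ux; have [V [g [Vx VU [_ _ hg] fg]]] := hP x Ux.
  by rewrite fg // hg.
- move=> V W f g x [VU hf fE] [WU hg gE] Vx Wx.
  have hf' := rg_sub (@zcapl K V W) hf; have hg' := rg_sub (@zcapr K V W) hg.
  apply: (rg_dense_eq (mulf_neq0 (X_neq0 K 0) Am) hf' hg') => // y [Vy Wy].
  by rewrite mevalM mevalXU => y0; apply: (mulfI y0); rewrite -fE // -gE.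
move=> x Ux; have [i ix] := in_some_chart Ux; pose V := zcap U (chart K i).
have VU : V `<=` U := @zcapl K _ _; have Vi : V `<=` chart K i := @zcapr K _ _.
have i0 y : pts V y -> y i != 0 by move=> /Vi/chartE.
have [||h [hh hE]] := @rg_divide (e - 1) V (fun l y => M i l y / y i).
- move=> l; apply: rgM (rg_sub VU (hM i l)) (rg_chart_pow (- 1) Vi) => //.
- by move=> y l r Vy; rewrite mulrAC (propA y i l r (VU y Vy)) mulrAC.
exists V, h; split=> //; split=> // y k l Vy; apply: (mulIf (i0 y Vy)).
rewrite propx //; last exact: VU.
have := hE y l Vy => /(canRL (divfK (i0 y Vy))) ->; ring.
Qed.
End Divisibility.

(** * Derivations as bivector fields *)

Lemma mderiv_homog (K : nzRingType) n (p : {mpoly K[n]}) k i :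
  p \is k.+1.-homog -> p^`M(i) \is k.-homog.
Proof.
move=> /dhomogP h; apply/dhomogP => m; rewrite mcoeff_msupp mcoeff_mderiv => hm.
have : (m + U_(i))%MM \in msupp p.
  by rewrite mcoeff_msupp; apply: contraNneq hm => ->; rewrite mul0rn.
by move/h; rewrite /= mdegD mdeg1 addn1 => -[].
Qed.

Lemma euler_homog (K : comNzRingType) n (p : {mpoly K[n]}) k :
  p \is k.-homog -> \sum_i 'X_i * p^`M(i) = k%:R *: p.
Proof.
move=> /dhomogP h; rewrite [in RHS](mpolyE p) scaler_sumr.
transitivity (\sum_(m <- msupp p) \sum_i p@_m *: ('X_i * ('X_[m])^`M(i))).
  rewrite exchange_big /=; apply: eq_bigr => i _.
  rewrite {1}(mpolyE p) raddf_sum mulr_sumr /=; apply: eq_bigr => m _.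
  by rewrite mderivZ scalerAr.
apply: eq_big_seq => m /h dm; rewrite -scaler_sumr scalerA [k%:R * _]mulrC -scalerA.
have -> : k = (\sum_i m i)%N by rewrite -dm /= mdegE.
congr (_ *: _); rewrite natr_sum scaler_suml; apply: eq_bigr => i _.
rewrite mderivX -scalerAr -mpolyXD; have [->|mi] := eqVneq (m i) 0%N.
  by rewrite !scale0r.
by rewrite addmC submK // lep1mP.
Qed.

Section VectorFields.
Variable K : closedFieldType.
Implicit Types (U V W : zopen K) (x y : vec K) (f g : vec K -> K).

Definition dapp U (D : TP3 K U) V (VU : V `<=` U) (s : OO V) : OO V :=
  (Defs.sval (D : subsec (@is_der_closed K) U) : fam (@OO K) (Osh K 0) U) V VU s.

Lemma dapp_inj U (D E : TP3 K U) :
  (forall V (VU : V `<=` U) s, dapp D VU s = dapp E VU s) -> D = E.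
Proof. by move=> h; apply: subsec_inj; apply: famP. Qed.

Lemma dapp_lin U (a : OO U) (D E : TP3 K U) V (VU : V `<=` U) (s : OO V) :
  dapp (a *: D + E) VU s = OOres VU a *: dapp D VU s + dapp E VU s.
Proof. by []. Qed.

Lemma dapp_sub U W (WU : W `<=` U) (D : TP3 K U) V (VW : V `<=` W) VU (s : OO V) :
  dapp (res WU D) VW s = dapp D VU s.
Proof. by rewrite (Prop_irrelevance VU (sub_trans VW WU)). Qed.

Section Der.
Variables (U : zopen K) (D : TP3 K U).
Lemma dappD V (VU : V `<=` U) (s t : OO V) :
  dapp D VU (s + t) = dapp D VU s + dapp D VU t.
Proof. by have [h _ _ _] := subsecP (D : subsec (is_der_closed K) U); apply: h. Qed.
Lemma dappM V (VU : V `<=` U) (s t : OO V) :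
  dapp D VU (s * t) = s *: dapp D VU t + t *: dapp D VU s.
Proof. by have [_ h _ _] := subsecP (D : subsec (is_der_closed K) U); apply: h. Qed.
Lemma dappC V (VU : V `<=` U) c : dapp D VU (regC V c) = 0.
Proof. by have [_ _ h _] := subsecP (D : subsec (is_der_closed K) U); apply: h. Qed.
Lemma dapp_res V W (VU : V `<=` U) (WU : W `<=` U) (WV : W `<=` V) (s : OO V) :
  dapp D WU (OOres WV s) = OOres WV (dapp D VU s).
Proof. by have [_ _ _ h] := subsecP (D : subsec (is_der_closed K) U); apply: h. Qed.
Lemma dapp1 V (VU : V `<=` U) : dapp D VU 1 = 0.
Proof. exact: dappC. Qed.
End Der.

Fact ratio_subproof U i k (Uk : U `<=` chart K k) : rg 0 U (fun x => x i / x k).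
Proof. by apply: rgM (rg_coord U i) (rg_chart_pow (- 1) Uk). Qed.
Definition ratio U i k (Uk : U `<=` chart K k) : OO U := mkreg (ratio_subproof i Uk).

Lemma ratioE U i k (Uk : U `<=` chart K k) x : pts U x -> ratio i Uk x = x i / x k.
Proof. exact: mkregE. Qed.

Lemma ratio_res U V i k (Uk : U `<=` chart K k) (Vk : V `<=` chart K k) (VU : V `<=` U) :
  OOres VU (ratio i Uk) = ratio i Vk.
Proof. by apply: reg_eqP => x Vx; rewrite regRE // !ratioE //; apply: VU. Qed.

Definition some_chart x : 'I_4 := xget o0 [set k | x k != 0].

Lemma some_chart_neq0 x : nz x -> x (some_chart x) != 0.
Proof. by move=> [i xi]; apply: (@xgetPex _ o0 [set k | x k != 0]); exists i. Qed.

(* A derivation D is encoded by the matrix of the [x_i^2 D(x_j / x_i)]; if D is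
   the class of the homogeneous vector field v, this is x /\ v. *)
Definition vloc U (D : TP3 K U) k x i : K :=
  x k * dapp D (@zcapl K U (chart K k)) (ratio i (@zcapr K U (chart K k))) x.

Definition vmat U (D : TP3 K U) x : 'I_4 -> 'I_4 -> K :=
  wedge x (vloc D (some_chart x) x).

Lemma vlocE U (D : TP3 K U) V k (VU : V `<=` U) (Vk : V `<=` chart K k) x i :
  pts V x -> vloc D k x i = x k * dapp D VU (ratio i Vk) x.
Proof.
move=> Vx; have VW : V `<=` zcap U (chart K k).
  by move=> y Vy; split; [exact: VU|exact: Vk].
rewrite /vloc -(ratio_res i (@zcapr K U (chart K k)) Vk VW).
by rewrite (dapp_res D (@zcapl K U (chart K k)) VU) regRE.
Qed.

(** Changing the chart adds a multiple of [x] to the local representative, which the wedge does not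
    see. *)
Lemma wedge_vloc U (D : TP3 K U) k l x i j : pts U x -> x k != 0 -> x l != 0 ->
  wedge x (vloc D k x) i j = wedge x (vloc D l x) i j.
Proof.
move=> Ux xk xl; pose V := zcap U (zcap (chart K k) (chart K l)).
have VU : V `<=` U by move=> y [].
have Vk : V `<=` chart K k by move=> y [_ []].
have Vl : V `<=` chart K l by move=> y [_ []].
have Vx : pts V x by split=> //; split; apply/chartE.
have E r : vloc D k x r = vloc D l x r + x r * dapp D VU (ratio l Vk) x * (x k / x l).
  rewrite (vlocE D VU Vk) // (vlocE D VU Vl) //.
  have -> : ratio r Vk = ratio r Vl * ratio l Vk.
    apply: reg_eqP => y Vy; rewrite /= -!/(ratio _ _ y) !indicE // !mulr1.
    by field; move: (Vk y Vy) (Vl y Vy) => /chartE -> /chartE ->.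
  rewrite dappM; set a := dapp _ _ _; set b := dapp _ _ _.
  have -> : (ratio r Vl *: a + ratio l Vk *: b : OO V) x =
    ratio r Vl x * a x + ratio l Vk x * b x by [].
  by rewrite !ratioE //; field; rewrite xk xl.
by rewrite /wedge !E; ring.
Qed.

Lemma vmatE U (D : TP3 K U) k x i j : pts U x -> x k != 0 ->
  vmat D x i j = wedge x (vloc D k x) i j.
Proof.
move=> Ux xk; apply: wedge_vloc => //; apply: some_chart_neq0; exact: zopen_nz Ux.
Qed.

Lemma vloc_self U (D : TP3 K U) k x : pts U x -> x k != 0 -> vloc D k x k = 0.
Proof.
move=> Ux xk; have Vx : pts (zcap U (chart K k)) x by split=> //; apply/chartE.
rewrite /vloc (_ : ratio _ _ = 1) ?dapp1 ?mulr0 //.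
apply: reg_eqP => y Vy; rewrite ratioE // /= indicE // mul1r divff //.
by case: Vy => _ /chartE.
Qed.

Lemma vloc_mat U (D : TP3 K U) k x i : pts U x -> x k != 0 ->
  vloc D k x i = vmat D x k i / x k.
Proof.
by move=> Ux xk; rewrite (vmatE D _ _ Ux xk) /wedge vloc_self // mulr0 subr0; field.
Qed.

(** The vector [v] is asked for at single points only; all regularity is put on the matrix, which is
    independent of the choice of [v]. Derivations have [v] of degree 1, hence [e = 2]. *)
Definition is_vfield e U (m : vec K -> 'I_4 -> 'I_4 -> K) : Prop :=
  (forall i j, rg e U (fun x => m x i j)) /\
  forall x, pts U x -> exists v, forall i j, m x i j = wedge x v i j.

Lemma vmat_vfield U (D : TP3 K U) : is_vfield 2 U (vmat D).
Proof.
split=> [i j|x _]; last by exists (vloc D (some_chart x) x).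
apply: rg_local => x Ux; have [V [VU [k [Vx Vk]]]] := chart_cover Ux.
exists V; split=> //.
have hv r : rg 1 V (fun y => vloc D k y r).
  apply: (rg_eq (f := fun y => y k * dapp D VU (ratio r Vk) y)).
    by move=> y Vy; rewrite (vlocE D VU Vk).
  by apply: rgM (rg_coord V k) (rg_reg _).
apply: (rg_eq (f := fun y => wedge y (vloc D k y) i j)).
  by move=> y Vy; rewrite (vmatE (k := k) D i j (VU y Vy)) //; apply/chartE/Vk.
by apply: rgB; apply: rgM (rg_coord V _) (hv _).
Qed.

Lemma vmat_lin U (a : OO U) (D E : TP3 K U) x i j : pts U x ->
  vmat (a *: D + E) x i j = a x * vmat D x i j + vmat E x i j.
Proof.
move=> Ux; have [k /chartE xk] := in_some_chart Ux.
have Vx : pts (zcap U (chart K k)) x by split=> //; apply/chartE.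
rewrite !(vmatE _ i j Ux xk) /wedge /vloc !dapp_lin.
set b := dapp D _ _; set c := dapp D _ _; set b' := dapp E _ _; set c' := dapp E _ _.
have L (s t : OO (zcap U (chart K k))) :
  (OOres (@zcapl K U (chart K k)) a *: s + t : OO _) x = a x * s x + t x.
  by rewrite -[LHS]/((OOres (@zcapl K U (chart K k)) a) x * s x + t x) regRE.
by rewrite !L; ring.
Qed.

Lemma vmat_res U V (VU : V `<=` U) (D : TP3 K U) x i j : pts V x ->
  vmat (res VU D) x i j = vmat D x i j.
Proof.
move=> Vx; have [k /chartE xk] := in_some_chart Vx; have Ux := VU x Vx.
have Wx : pts (zcap V (chart K k)) x by split=> //; apply/chartE.
have WU : zcap V (chart K k) `<=` U := sub_trans (@zcapl K _ _) VU.
rewrite (vmatE _ i j Vx xk) (vmatE _ i j Ux xk) /wedge.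
by rewrite !(vlocE D WU (@zcapr K _ _) _ Wx) /vloc !(dapp_sub VU D _ WU).
Qed.

Lemma vmat0 U x i j : pts U x -> vmat (0 : TP3 K U) x i j = 0.
Proof.
move=> Ux; have := vmat_lin 1 (0 : TP3 K U) 0 i j Ux; rewrite scale1r addr0.
rewrite /= indicE // !mul1r => /(congr1 (fun z => z - vmat (0 : TP3 K U) x i j)).
by rewrite subrr addrK.
Qed.

(* A derivation killing the coordinate ratios kills the dehomogenisations of
   all polynomials, hence their quotients. *)
Lemma vmat_eq0 U (D : TP3 K U) :
  (forall x i j, pts U x -> vmat D x i j = 0) -> D = 0.
Proof.
move=> D0; apply: dapp_inj => V VU s; apply: reg_eqP => x Vx; rewrite [RHS]/=.
have [k /chartE xk] := in_some_chart Vx.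
have [p [q [m [n [hp hq e qx h]]]]] := rgP (rg_reg s) Vx.
pose W := zcap V (zcap (chart K k) (zD (ex_intro _ n hq))).
have WV : W `<=` V by move=> y [].
have WU := sub_trans WV VU.
have Wk : W `<=` chart K k by move=> y [_ []].
have Wq y : pts W y -> q.@[y] != 0 by move=> [_ [_ []]].
have Wx : pts W x by split=> //; split; [apply/chartE|split=> //; exact: zopen_nz Vx].
have dehom (r : {mpoly K[4]}) : exists t : OO W,
    (forall y, pts W y -> t y = r.@[fun i => y i / y k]) /\ dapp D WU t = 0.
  have dX i : exists t : OO W,
      (forall y, pts W y -> t y = y i / y k) /\ dapp D WU t = 0.
    exists (ratio i Wk); split; first by move=> y Wy; rewrite ratioE.
    apply: reg_eqP => y Wy; have yk : y k != 0 by apply/chartE/Wk.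
    apply: (mulfI yk); rewrite -(vlocE D WU Wk) // vloc_mat //; last exact: WU.
    by rewrite D0 ?mul0r ?mulr0 //; apply: WU.
  have dM (a b : vec K -> K) :
      (exists t : OO W, (forall y, pts W y -> t y = a y) /\ dapp D WU t = 0) ->
      (exists t : OO W, (forall y, pts W y -> t y = b y) /\ dapp D WU t = 0) ->
      (exists t : OO W, (forall y, pts W y -> t y = a y * b y) /\ dapp D WU t = 0).
    move=> [t [ht t0]] [u [hu u0]]; exists (t * u); split.
      by move=> y Wy; rewrite /= ht // hu.
    by rewrite dappM t0 u0 !scaler0 addr0.
  have dC c : exists t : OO W, (forall y, pts W y -> t y = c) /\ dapp D WU t = 0.
    exists (regC W c); split; last exact: dappC.
    by move=> y Wy; rewrite /= indicE // mulr1.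
  elim/mpolyind: r => [|c mm r _ _ [t [ht t0]]].
    by have [t [ht t0]] := dC 0; exists t; split=> // y /ht ->; rewrite meval0.
  suff [u [hu u0]] : exists u : OO W, (forall y, pts W y ->
      u y = c * ('X_[mm] : {mpoly K[4]}).@[fun i => y i / y k]) /\ dapp D WU u = 0.
    exists (u + t); split; last by rewrite dappD u0 t0 addr0.
    by move=> y Wy; rewrite /= hu // ht // mevalD mevalZ.
  apply: (dM) => //; suff [u [hu u0]] : exists u : OO W, (forall y, pts W y ->
      u y = \prod_(i < 4) (y i / y k) ^+ mm i) /\ dapp D WU u = 0.
    by exists u; split=> // y Wy; rewrite hu // mevalX.
  elim: (index_enum _) => [|i r' IH].
    by have [u [hu u0]] := dC 1; exists u; split=> // y Wy; rewrite big_nil hu.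
  have dXn n' : exists u : OO W, (forall y, pts W y ->
      u y = (y i / y k) ^+ n') /\ dapp D WU u = 0.
    elim: n' => [|n' IH']; first exact: (dC).
    have [u [hu u0]] := dM _ _ (dX i) IH'; exists u; split=> // y Wy.
    by rewrite hu // exprS.
  have [u [hu u0]] := dM _ _ (dXn (mm i)) IH; exists u; split=> // y Wy.
  by rewrite big_cons hu.
have [P [hP P0]] := dehom p; have [Q [hQ Q0]] := dehom q.
have scale r j y : r \is j.-homog -> y k != 0 ->
    r.@[fun i => y i / y k] = r.@[y] / y k ^+ j.
  move=> /dhomogP hr yk; rewrite !mevalE mulr_suml; apply: eq_big_seq => mm /hr <-.
  rewrite -mulrA; congr (_ * _); rewrite /= mdegE expr_sum -prodf_div.
  by apply: eq_bigr => i _; rewrite expr_div_n.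
have mn : m = n by move: e; rewrite addr0 => -[].
have PQ : P = Q * OOres WV s.
  apply: reg_eqP => y Wy; have yk : y k != 0 by apply/chartE/Wk.
  rewrite [RHS]/= indicE // mulr1 hP // hQ // (scale p m) // (scale q n) //.
  rewrite h //; [|exact: WV|exact: Wq].
  by rewrite mn; field; rewrite Wq // expf_neq0.
have := dappM D WU Q (OOres WV s); rewrite -PQ P0 Q0 scaler0 addr0.
rewrite (dapp_res D VU) => /(congr1 (fun t : OO W => t x)).
rewrite [X in X = _]/= => E; apply/eqP.
have : Q x * (OOres WV (dapp D VU s)) x = 0 by rewrite [RHS]E.
rewrite regRE // => /eqP; rewrite mulf_eq0 => /orP[|//].
rewrite hQ // (scale q n) // => /eqP/(congr1 ( *%R^~ (x k ^+ n))).
by rewrite divfK ?mul0r ?expf_neq0 // => /eqP; rewrite (negbTE qx).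
Qed.

Lemma vmat_inj U (D E : TP3 K U) :
  (forall x i j, pts U x -> vmat D x i j = vmat E x i j) -> D = E.
Proof.
move=> h; apply/eqP; rewrite -subr_eq0; apply/eqP; apply: vmat_eq0 => x i j Ux.
rewrite addrC -scaleN1r vmat_lin // h // /= indicE // mulr1; ring.
Qed.
End VectorFields.

(** * Derivations from bivector fields *)

Section Gradient.
Variable K : closedFieldType.
Implicit Types (U V W : zopen K) (x y : vec K) (f g : vec K -> K).
Implicit Types (p q : {mpoly K[4]}).

Definition represents U f p q (n : nat) : Prop :=
  [/\ p \is n.+1.-homog, q \is n.+1.-homog &
      forall y, pts U y -> q.@[y] != 0 -> f y = p.@[y] / q.@[y]].

Lemma represented U f x : rg 0 U f -> pts U x ->
  exists p q n, represents U f p q n /\ q.@[x] != 0.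
Proof.
move=> hf Ux; have [p [q [m [n [hp hq e qx h]]]]] := rgP hf Ux.
have [k xk] := zopen_nz Ux; have mn : m = n by move: e; rewrite addr0 => -[].
exists (p * 'X_k), (q * 'X_k), n; split.
  split=> [||y Uy].
  - by have := dhomogM hp (homogXU K k); rewrite mn addn1.
  - by have := dhomogM hq (homogXU K k); rewrite addn1.
  rewrite !mevalM mulf_eq0 negb_or => /andP[qy yk]; rewrite h //; field.
  by rewrite qy yk.
by rewrite mevalM mevalXU mulf_neq0.
Qed.

Definition quot_grad p q x (i : 'I_4) : K :=
  ((p^`M(i)).@[x] * q.@[x] - p.@[x] * (q^`M(i)).@[x]) / q.@[x] ^+ 2.

Definition grad U f x : 'I_4 -> K :=
  xget (fun=> 0) [set g | exists p q n,
    [/\ represents U f p q n, q.@[x] != 0 & g = quot_grad p q x]].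

(** Two fractions for the same function satisfy [p' * q = p * q'] as polynomials, by density.
    Differentiating this identity shows that the gradients agree. *)
Lemma gradE U f x p q n : rg 0 U f -> pts U x -> represents U f p q n ->
  q.@[x] != 0 -> grad U f x = quot_grad p q x.
Proof.
move=> hf Ux hr qx; apply: xget_unique; first by exists p, q, n.
move=> _ [p' [q' [n' [hr' q'x ->]]]]; apply: functional_extensionality_dep => i.
have [[_ _ h] [_ _ h']] := (hr, hr').
have qq0 : q * q' != 0.
  by rewrite mulf_neq0 //; [apply: contraNneq qx | apply: contraNneq q'x] => ->; rewrite meval0.
have E : p' * q = p * q'.
  apply/eqP; rewrite -subr_eq0; apply/eqP; apply: (zopen_dense Ux qq0) => y Uy.
  rewrite mevalM mulf_eq0 negb_or => /andP[qy q'y]; rewrite mevalB !mevalM.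
  have := h y Uy qy; rewrite h' // => E.
  have -> : p'.@[y] = p'.@[y] / q'.@[y] * q'.@[y] by rewrite divfK.
  by rewrite E; field.
have := congr1 (fun r => (r^`M(i)).@[x]) E; rewrite /= !mderivM !mevalD !mevalM.
have := congr1 (meval x) E; rewrite !mevalM.
rewrite /quot_grad; move: (p.@[x]) (p'.@[x]) (p^`M(i)).@[x] (p'^`M(i)).@[x]
  q.@[x] (q^`M(i)).@[x] q'.@[x] (q'^`M(i)).@[x] qx q'x => a a' da da' b db b' db' b0 b0'.
move=> e de; have ea : a' = a * b' / b by rewrite -e mulfK.
have eda : da' = (da * b' + a * db' - a' * db) / b.
  by apply: (canRL (mulfK b0)); rewrite -de; ring.
by rewrite eda ea; field; rewrite b0 b0'.
Qed.

(** Numerator and denominator have equal degrees, so Euler's formula cancels. It follows that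
    [\sum_i v i * grad U f x i] depends on [x /\ v] only. *)
Lemma grad_euler U f x : rg 0 U f -> pts U x -> \sum_i x i * grad U f x i = 0.
Proof.
move=> hf Ux; have [p [q [n [hr qx]]]] := represented hf Ux.
rewrite (gradE hf Ux hr qx); have [hp hq _] := hr.
have := congr1 (meval x) (euler_homog hp); have := congr1 (meval x) (euler_homog hq).
rewrite !raddf_sum /= !mevalZ => eq ep.
have s (r : {mpoly K[4]}) : \sum_i ('X_i * r^`M(i)).@[x] = \sum_i x i * (r^`M(i)).@[x].
  by apply: eq_bigr => i _; rewrite mevalM mevalXU.
rewrite !s in eq ep.
transitivity (((\sum_i x i * (p^`M(i)).@[x]) * q.@[x] -
  p.@[x] * (\sum_i x i * (q^`M(i)).@[x])) / q.@[x] ^+ 2).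
  by rewrite /quot_grad !sum4; field.
by rewrite eq ep; field.
Qed.

Lemma grad_sub U V f g x : rg 0 U f -> V `<=` U -> pts V x ->
  (forall y, pts V y -> g y = f y) -> grad V g x = grad U f x.
Proof.
move=> hf VU Vx fg; have [p [q [n [hr qx]]]] := represented hf (VU x Vx).
rewrite (gradE hf (VU x Vx) hr qx).
have hg : rg 0 V g by apply: (rg_eq _ (rg_sub VU hf)) => y Vy; rewrite fg.
apply: (gradE hg Vx _ qx (n := n)); have [hp hq h] := hr; split=> // y Vy qy.
by rewrite fg // h //; apply: VU.
Qed.

Lemma gradD U f g x i : rg 0 U f -> rg 0 U g -> pts U x ->
  grad U (fun y => f y + g y) x i = grad U f x i + grad U g x i.
Proof.
move=> hf hg Ux; have [p [q [n [hr qx]]]] := represented hf Ux.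
have [p' [q' [n' [hr' q'x]]]] := represented hg Ux.
have [[hp hq h] [hp' hq' h']] := (hr, hr').
rewrite (gradE hf Ux hr qx) (gradE hg Ux hr' q'x).
rewrite (gradE (p := p * q' + p' * q) (q := q * q') (n := n + n'.+1) (rgD hf hg) Ux).
- rewrite /quot_grad !(mderivM, mderivD, mevalD, mevalM); field.
  by rewrite qx q'x.
- split; rewrite -?addSn.
  + by apply: rpredD; [|rewrite addnC]; apply: dhomogM.
  + exact: dhomogM.
  move=> y Uy; rewrite mevalM mulf_eq0 negb_or => /andP[qy q'y].
  by rewrite h // h' // mevalD !mevalM; field; rewrite qy q'y.
by rewrite mevalM mulf_neq0.
Qed.

Lemma gradM U f g x i : rg 0 U f -> rg 0 U g -> pts U x ->
  grad U (fun y => f y * g y) x i = f x * grad U g x i + g x * grad U f x i.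
Proof.
move=> hf hg Ux; have [p [q [n [hr qx]]]] := represented hf Ux.
have [p' [q' [n' [hr' q'x]]]] := represented hg Ux.
have [[hp hq h] [hp' hq' h']] := (hr, hr').
rewrite (gradE hf Ux hr qx) (gradE hg Ux hr' q'x).
rewrite (gradE (p := p * p') (q := q * q') (n := n + n'.+1) (rgM erefl hf hg) Ux).
- rewrite h // h' // /quot_grad !(mderivM, mevalD, mevalM); field.
  by rewrite qx q'x.
- split; rewrite -?addSn; try exact: dhomogM.
  move=> y Uy; rewrite mevalM mulf_eq0 negb_or => /andP[qy q'y].
  by rewrite h // h' // !mevalM; field; rewrite qy q'y.
by rewrite mevalM mulf_neq0.
Qed.

Lemma grad_const U c x i : pts U x -> grad U (fun=> c) x i = 0.
Proof.
move=> Ux; have [k xk] := zopen_nz Ux.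
rewrite (gradE (p := c *: 'X_k) (q := 'X_k) (n := 0) (rg_const U c) Ux).
- by rewrite /quot_grad mderivZ !mevalZ !mevalXU; field.
- split; [by apply: rpredZ; apply: homogXU|exact: homogXU|].
  by move=> y Uy; rewrite mevalXU mevalZ mevalXU => yk; rewrite mulfK.
by rewrite mevalXU.
Qed.

Lemma grad_ratio U (f : vec K -> K) j k x i : rg 0 U f -> U `<=` chart K k -> pts U x ->
  (forall y, pts U y -> f y = y j / y k) ->
  grad U f x i = ((j == i)%:R * x k - x j * (k == i)%:R) / x k ^+ 2.
Proof.
move=> hf Uk Ux fE; have xk : x k != 0 by apply/chartE/Uk.
rewrite (gradE (p := 'X_j) (q := 'X_k) (n := 0) hf Ux).
- have dX r : (('X_r : {mpoly K[4]})^`M(i)).@[x] = (r == i)%:R.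
    rewrite mderivX mevalZ mnm1E; case: eqP => [->|_]; last by rewrite mul0r.
    by rewrite (_ : (U_(i) - U_(i))%MM = 0%MM) ?mpolyX0 ?meval1 ?mulr1 //; apply/mnmP => l; rewrite mnmBE mnm0E subnn.
  by rewrite /quot_grad !dX !mevalXU.
- split; try exact: homogXU.
  by move=> y Uy; rewrite !mevalXU fE.
by rewrite mevalXU.
Qed.

Lemma rg_grad U f i : rg 0 U f -> rg (- 1) U (fun x => grad U f x i).
Proof.
move=> hf; apply: rg_local => x Ux; have [p [q [n [hr qx]]]] := represented hf Ux.
have [hp hq h] := hr; pose V := zcap U (zD (ex_intro _ n.+1 hq)).
have VU : V `<=` U := @zcapl K _ _.
have q0 y : pts V y -> q.@[y] != 0 by move=> [_ []].
exists V; split=> //; first by split=> //; split=> //; apply: zopen_nz Ux.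
apply: (rg_eq (f := fun y => quot_grad p q y i)).
  by move=> y Vy; rewrite (gradE hf _ hr) //; [apply: VU | apply: q0].
have hn : rg (n + n.+1)%N V (fun y => (p^`M(i) * q - p * q^`M(i)).@[y]).
  apply: rg_poly; apply: rpredB; first by apply: dhomogM => //; apply: mderiv_homog.
  by rewrite addnC; apply: dhomogM => //; apply: mderiv_homog.
have hqV : rg (- (n.+1 + n.+1)%N%:Z) V (fun y => ((q * q).@[y])^-1).
  apply: rgV; first by apply: rg_poly; apply: dhomogM.
  by move=> y Vy; rewrite mevalM mulf_neq0 // q0.
have hm := rgM (l := - 1) _ hn hqV.
apply: (rg_eq _ (hm _)); last by rewrite !PoszD; ring.
by move=> y Vy; rewrite /quot_grad mevalB !mevalM expr2.
Qed.

Section VectorFieldDerivation.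
Variables (U : zopen K) (m : vec K -> 'I_4 -> 'I_4 -> K).
Hypothesis hm : is_vfield 2 U m.

(** The representative of [m x] used here is row [k] divided by [x k], for the chart [k] picked at
    [x]. *)
Definition vder V f x : K :=
  \sum_i m x (some_chart x) i / x (some_chart x) * grad V f x i.

Lemma vderE V f x v : rg 0 V f -> pts V x ->
  (forall i j, m x i j = wedge x v i j) -> vder V f x = \sum_i v i * grad V f x i.
Proof.
move=> hf Vx mv; have xk := some_chart_neq0 (zopen_nz Vx); rewrite /vder.
set k := some_chart x in xk *.
transitivity (\sum_i v i * grad V f x i -
   v k / x k * (\sum_i x i * grad V f x i)).
  by rewrite !sum4 !mv /wedge; field.
by rewrite grad_euler // mulr0 subr0.
Qed.

Lemma vder_chart V k f x : rg 0 V f -> pts V x -> V `<=` U -> x k != 0 ->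
  vder V f x = \sum_i m x k i / x k * grad V f x i.
Proof.
move=> hf Vx VU xk; have [v mv] := proj2 hm x (VU x Vx).
apply: vderE => // i j; have := wedge_cyclic x v i j k; rewrite -!mv /wedge => e.
by apply: (mulfI xk); rewrite e; field.
Qed.

Lemma rg_vder V f : V `<=` U -> rg 0 V f -> rg 0 V (vder V f).
Proof.
move=> VU hf; apply: rg_local => x Vx; have [W [WV [k [Wx Wk]]]] := chart_cover Vx.
exists W; split=> //.
apply: (rg_eq (f := fun y => \sum_i m y k i / y k * grad V f y i)).
  by move=> y Wy; rewrite (vder_chart (k := k) hf (WV y Wy) VU) //; apply/chartE/Wk.
apply: rg_sum => i _; apply: (rgM (j := 1) (k := - 1)) => //.
  apply: rgM (rg_sub (sub_trans WV VU) (proj1 hm k i)) (rg_chart_pow (- 1) Wk) => //.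
exact: rg_sub WV (rg_grad i hf).
Qed.

Definition vfam : fam (@OO K) (Osh K 0) U :=
  fun V VU s => mkreg (rg_vder VU (rg_reg s)).

Fact vfam_der : is_der (vfam : Fam (@OO K) (Osh K 0) U).
Proof.
have rgS V (s : OO V) := rg_reg s.
have fE V (VU : V `<=` U) s x : pts V x -> vfam VU s x = vder V s x.
  by move=> Vx; rewrite /vfam mkregE.
have [hrg hw] := hm; split.
- move=> V VU s t; apply: reg_eqP => x Vx.
  have -> : (vfam VU s + vfam VU t : OO V) x = vfam VU s x + vfam VU t x by [].
  have [v mv] := hw x (VU x Vx).
  rewrite !fE // !(vderE _ Vx mv) //; try exact: rg_reg.
  rewrite -big_split /=; apply: eq_bigr => i _; rewrite -mulrDr; congr (_ * _).
  exact: (gradD i (rgS V s) (rgS V t) Vx).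
- move=> V VU s t; apply: reg_eqP => x Vx.
  have -> : (s *: (vfam VU t : OO V) + t *: (vfam VU s : OO V) : OO V) x =
    s x * vfam VU t x + t x * vfam VU s x by [].
  have [v mv] := hw x (VU x Vx).
  rewrite !fE // !(vderE _ Vx mv) //; try exact: rg_reg.
  rewrite !mulr_sumr -big_split /=; apply: eq_bigr => i _.
  transitivity (v i * (s x * grad V t x i + t x * grad V s x i)); last by rewrite /=; ring.
  by congr (_ * _); exact: (gradM i (rgS V s) (rgS V t) Vx).
- move=> V VU c; apply: reg_eqP => x Vx; have [v mv] := hw x (VU x Vx).
  rewrite fE // (vderE (rg_reg _) Vx mv) big1 // => i _.
  rewrite (grad_sub (U := V) (f := fun=> c) (rg_const V c) _ Vx) //.
    by rewrite grad_const // mulr0.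
  by move=> y Vy; rewrite /= indicE // mulr1.
- move=> V W VU WU WV s; apply: reg_eqP => x Wx; have [v mv] := hw x (WU x Wx).
  rewrite [RHS]regRE // !fE //; last exact: WV.
  rewrite (vderE (rg_reg _) Wx mv) (vderE (rgS V s) (WV x Wx) mv).
  apply: eq_bigr => i _; congr (_ * _).
  rewrite (grad_sub (rgS V s) WV Wx) // => y Wy; exact: regRE.
Qed.

Definition der_of : TP3 K U := SubSec (is_der_closed K) vfam_der.

Lemma vmat_der_of x i j : pts U x -> vmat der_of x i j = m x i j.
Proof.
move=> Ux; have [k /chartE xk] := in_some_chart Ux.
have [v mv] := proj2 hm x Ux; rewrite (vmatE _ i j Ux xk) mv.
have Vx : pts (zcap U (chart K k)) x by split=> //; apply/chartE.
have E r : vloc der_of k x r = v r - x r * v k / x k.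
  rewrite /vloc.
  have -> : dapp der_of (@zcapl K U (chart K k)) (ratio r (@zcapr K U (chart K k))) x =
    vder (zcap U (chart K k)) (ratio r (@zcapr K U (chart K k))) x.
    exact: (mkregE (rg_vder (@zcapl K U (chart K k)) (rg_reg _)) Vx).
  rewrite (vderE (rg_reg _) Vx mv).
  transitivity (x k * \sum_i v i * (((r == i)%:R * x k - x r * (k == i)%:R) / x k ^+ 2)).
    congr (_ * _); apply: eq_bigr => l _; congr (_ * _).
    apply: (@grad_ratio _ _ r k x l (rg_reg _) (@zcapr K _ _) Vx).
    by move=> y Wy; rewrite ratioE.
  transitivity ((x k * (\sum_i v i * (r == i)%:R) - x r * (\sum_i v i * (k == i)%:R)) / x k).
    by rewrite !sum4; field.
  by rewrite !sum_delta; field.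
by rewrite /wedge !E; field.
Qed.
End VectorFieldDerivation.
End Gradient.

(** * The 1-form of a distribution *)

Section Homomorphisms.
Variable K : closedFieldType.
Implicit Types (U V W : zopen K) (F G : omod K).

Section App.
Variables (F G : omod K) (U : zopen K) (f : Defs.Hom F G U).

Lemma app_lin V (VU : V `<=` U) (a : OO V) (s t : F V) :
  app f VU (a *: s + t) = a *: app f VU s + app f VU t.
Proof. by have [h _] := subsecP (f : subsec (is_hom_closed F G) U); apply: h. Qed.

Lemma app_res V W (VU : V `<=` U) (WU : W `<=` U) (WV : W `<=` V) (s : F V) :
  app f WU (res WV s) = res WV (app f VU s).
Proof. by have [_ h] := subsecP (f : subsec (is_hom_closed F G) U); apply: h. Qed.

Lemma appD V (VU : V `<=` U) (s t : F V) : app f VU (s + t) = app f VU s + app f VU t.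
Proof. by have := app_lin VU 1 s t; rewrite !scale1r. Qed.

Lemma app0 V (VU : V `<=` U) : app f VU 0 = 0.
Proof. by apply: (addrI (app f VU 0)); rewrite -appD !addr0. Qed.

Lemma appZ V (VU : V `<=` U) (a : OO V) (s : F V) : app f VU (a *: s) = a *: app f VU s.
Proof. by have := app_lin VU a s 0; rewrite app0 !addr0. Qed.

End App.

Lemma hom_ext F G U (f g : Defs.Hom F G U) :
  (forall V (VU : V `<=` U) s, app f VU s = app g VU s) -> f = g.
Proof. by move=> h; apply: subsec_inj; apply: famP. Qed.

Lemma app_sub F G U V (VU : V `<=` U) (f : Defs.Hom F G U) W (WV : W `<=` V) WU s :
  app (res VU f) WV s = app f WU s.
Proof. by rewrite (Prop_irrelevance WU (sub_trans WV VU)). Qed.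

Lemma app_linl F G U (a : OO U) (f g : Defs.Hom F G U) V (VU : V `<=` U) s :
  app (a *: f + g) VU s = OOres VU a *: app f VU s + app g VU s.
Proof. by []. Qed.

Lemma app_0l F G U V (VU : V `<=` U) s : app (0 : Defs.Hom F G U) VU s = 0.
Proof. by []. Qed.

Definition mkhom F G U (f : forall V : zopen K, V `<=` U -> F V -> G V)
  (hf : @is_hom K F G U f) : Defs.Hom F G U := SubSec (is_hom_closed F G) hf.

Lemma app_mkhom F G U (f : forall V : zopen K, V `<=` U -> F V -> G V) hf V (VU : V `<=` U) s :
  app (@mkhom F G U f hf) VU s = f V VU s.
Proof. by []. Qed.

Lemma mapp_lin F G (f : mor F G) U (a : OO U) (s t : F U) :
  mapp f (a *: s + t) = a *: mapp f s + mapp f t.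
Proof. exact: app_lin. Qed.

Lemma mapp_res F G (f : mor F G) U V (VU : V `<=` U) (s : F U) :
  mapp f (res VU s) = res VU (mapp f s).
Proof. exact: app_res. Qed.

Lemma mapp0 F G (f : mor F G) U : mapp f (0 : F U) = 0.
Proof. exact: app0. Qed.

Lemma mappZ F G (f : mor F G) U a (s : F U) : mapp f (a *: s) = a *: mapp f s.
Proof. exact: appZ. Qed.

Lemma res_scale F U V (VU : V `<=` U) (a : OO U) (s : F U) :
  res VU (a *: s) = OOres VU a *: res VU s.
Proof. by have := res_linear VU a s 0; rewrite res0 !addr0. Qed.

End Homomorphisms.

Section DistributionForm.
Variables (K : closedFieldType) (d : nat) (F : distribution K d).
Implicit Types (U V W : zopen K).
Local Notation N := (d%:Z + 2).

(** A section of [I(d+2)] is by definition a homomorphism from [O(-d-2)] to [I]. Followed by the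
    inclusion of [I] in [O] it is multiplication by a function of degree [d + 2], the value of the
    1-form on [D]. *)
Lemma form_exists U (D : TP3 K U) : exists f : vec K -> K, rg N U f /\
  forall V (VU : V `<=` U) (c : Osh K (- N) V) x, pts V x ->
    (mapp (sing_incl F) (app (mapp (dist_form F) D) VU c) : OO V) x = f x * (c : reg _ V) x.
Proof.
have [||f [hf fE]] := @linear_section K (- N) 0 U
  (fun V VU c => mapp (sing_incl F) (app (mapp (dist_form F) D) VU (c : Osh K (- N) V))).
- move=> V VU c a.
  exact: etrans (congr1 (@mapp K _ _ (sing_incl F) V)
    (appZ (mapp (dist_form F) D) VU c (a : Osh K (- N) V))) (mappZ _ _ _).
- move=> V W VU WU WV a.
  exact: etrans (congr1 (@mapp K _ _ (sing_incl F) W)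
    (app_res (mapp (dist_form F) D) VU WU WV (a : Osh K (- N) V))) (mapp_res _ _ _).
by exists f; split; [rewrite sub0r opprK in hf|].
Qed.

Definition form U (D : TP3 K U) : vec K -> K := projT1 (cid (form_exists D)).

Lemma form_rg U (D : TP3 K U) : rg N U (form D).
Proof. by rewrite /form; case: cid => f []. Qed.

Lemma formE U (D : TP3 K U) V (VU : V `<=` U) (c : Osh K (- N) V) x : pts V x ->
  (mapp (sing_incl F) (app (mapp (dist_form F) D) VU c) : OO V) x =
  form D x * (c : reg _ V) x.
Proof. by have [_ h] := projT2 (cid (form_exists D)); exact: h. Qed.

Lemma form_lin U (a : OO U) (D E : TP3 K U) x : pts U x ->
  form (a *: D + E) x = a x * form D x + form E x.
Proof.
move=> Ux; have [V [VU [k [Vx Vk]]]] := chart_cover Ux.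
pose c : Osh K (- N) V := chart_gen (- N) Vk.
apply: (mulIf (chart_gen_neq0 (- N) Vk Vx)).
rewrite -(formE _ VU c Vx) mapp_lin app_linl mapp_lin.
rewrite mulrDl -mulrA -!(formE _ VU c Vx).
set s := mapp _ _; set t := mapp _ _.
by rewrite -[LHS]/((OOres VU a) x * (s : OO V) x + (t : OO V) x) regRE.
Qed.

Lemma form_res U V (VU : V `<=` U) (D : TP3 K U) x : pts V x ->
  form (res VU D) x = form D x.
Proof.
move=> Vx; have [W [WV [k [Wx Wk]]]] := chart_cover Vx.
pose c : Osh K (- N) W := chart_gen (- N) Wk.
apply: (mulIf (chart_gen_neq0 (- N) Wk Wx)).
rewrite -(formE _ WV c Wx) -(formE _ (sub_trans WV VU) c Wx).
by rewrite mapp_res (app_sub VU _ WV (sub_trans WV VU)).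
Qed.

Lemma form0 U x : pts U x -> form (0 : TP3 K U) x = 0.
Proof.
move=> Ux; have := form_lin 1 (0 : TP3 K U) 0 Ux; rewrite scale1r addr0.
rewrite /= indicE // !mul1r => /(congr1 (fun z => z - form (0 : TP3 K U) x)).
by rewrite subrr addrK.
Qed.

Lemma form_sum U (c : 'I_4 -> OO U) (D : 'I_4 -> TP3 K U) x : pts U x ->
  form (\sum_i c i *: D i) x = \sum_i c i x * form (D i) x.
Proof.
move=> Ux; elim: (index_enum _) => [|i r IH]; first by rewrite !big_nil form0.
by rewrite !big_cons form_lin // IH.
Qed.

Lemma vmat_sum U (c : 'I_4 -> OO U) (D : 'I_4 -> TP3 K U) x i j : pts U x ->
  vmat (\sum_r c r *: D r) x i j = \sum_r c r x * vmat (D r) x i j.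
Proof.
move=> Ux; elim: (index_enum _) => [|r s IH]; first by rewrite !big_nil vmat0.
by rewrite !big_cons vmat_lin // IH.
Qed.

Lemma form_eq0 U (D : TP3 K U) : (forall x, pts U x -> form D x = 0) ->
  mapp (dist_form F) D = 0.
Proof.
move=> h; apply: hom_ext => V VU c.
have hE := formE D VU c.
apply: (@sing_incl_mono K d F V); rewrite app_0l mapp0.
by apply: reg_eqP => x Vx; rewrite hE // h ?mul0r //; exact: (VU x Vx).
Qed.

(* The vector field x_k d/dx_i. *)
Fact coord_vfield i k :
  is_vfield 2 (PP K) (fun x => wedge x (fun r => x k * (r == i)%:R)).
Proof.
split=> [r s|x _]; last by exists (fun r => x k * (r == i)%:R).
have h t : rg 1 (PP K) (fun x => x k * (t == i)%:R).
  apply: rgM (rg_coord _ k) (rg_const _ _) => //.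
by apply: rgB; apply: rgM (rg_coord _ _) (h _).
Qed.
Definition coord_field i k : TP3 K (PP K) := der_of (coord_vfield i k).

Lemma form_coord W k (c : 'I_4 -> OO W) (D : TP3 K W) x :
  (forall y i j, pts W y -> vmat D y i j =
     \sum_r c r y * wedge y (fun s => y k * (s == r)%:R) i j) -> pts W x ->
  form D x = \sum_r c r x * form (coord_field r k) x.
Proof.
move=> h Wx; have -> : D = \sum_r c r *: res (subPP (U := W)) (coord_field r k).
  apply: vmat_inj => y i j Wy; rewrite vmat_sum // h //; apply: eq_bigr => r _.
  by rewrite vmat_res // vmat_der_of //; exact: zopen_nz Wy.
by rewrite form_sum //; apply: eq_bigr => r _; rewrite form_res.
Qed.

(** The Euler field is zero as a derivation of functions of degree 0. *)
Lemma form_coord_euler k x : x k != 0 -> \sum_r x r * form (coord_field r k) x = 0.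
Proof.
move=> /[dup] xk /chartE kx.
have Ck : chart K k `<=` chart K k by [].
have := @form_coord (chart K k) k (fun r => ratio r Ck) 0 x _ kx.
rewrite form0 // => h; transitivity (x k * \sum_r ratio r Ck x * form (coord_field r k) x).
  by rewrite mulr_sumr; apply: eq_bigr => r _; rewrite ratioE //; field.
rewrite -h ?mulr0 // => y i j ky; rewrite vmat0 //; have yk : y k != 0 by apply/chartE.
transitivity (\sum_r y r * wedge y (fun s => (s == r)%:R) i j); last first.
  by apply: eq_bigr => r _; rewrite ratioE // /wedge; field.
by rewrite sum_wedge_delta /wedge; ring.
Qed.

Lemma form_coordC i j k x : x k != 0 ->
  form (coord_field i j) x = x j / x k * form (coord_field i k) x.
Proof.
move=> /[dup] xk /chartE kx; have Ck : chart K k `<=` chart K k by [].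
have kP : chart K k `<=` PP K := @subPP K _.
rewrite -(form_res kP) // (@form_coord _ k
  (fun r => if r == i then ratio j Ck else 0)) //.
  rewrite (bigD1 i) //= eqxx ratioE // big1 ?addr0 // => r ri.
  by rewrite (negbTE ri) mul0r.
move=> y r s ky; have yk : y k != 0 by apply/chartE.
rewrite vmat_res // vmat_der_of //; last exact: zopen_nz ky.
rewrite (bigD1 i) //= eqxx ratioE // big1 ?addr0 => [|t ti].
  by rewrite /wedge; field.
by rewrite (negbTE ti) mul0r.
Qed.

(** The coefficient [a_i] should be the form applied to [d/dx_i], but this lowers degrees by one.
    The field [x_k d/dx_i] preserves them, and its value is divided by [x_k]. *)
Definition coef_fun i x : K := form (coord_field i (some_chart x)) x / x (some_chart x).

Lemma coef_funE i k x : x k != 0 -> coef_fun i x = form (coord_field i k) x / x k.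
Proof.
move=> xk; have nzx : nz x by exists k.
have xs := some_chart_neq0 nzx; rewrite /coef_fun (form_coordC i _ xk).
by field; rewrite xs xk.
Qed.

Lemma coef_fun_rg i : rg d.+1 (PP K) (coef_fun i).
Proof.
apply: rg_local => x nzx; have [k kx] := in_some_chart (nzx : pts (PP K) x).
exists (chart K k); split=> //; first exact: subPP.
apply: (rg_eq (f := fun y => form (coord_field i k) y / y k)).
  by move=> y /chartE yk; rewrite (coef_funE i yk).
have Ck : chart K k `<=` chart K k by [].
apply: (rgM (j := N) (k := - 1)); last exact: (rg_chart_pow (- 1) Ck).
  by rewrite -addn1 PoszD; ring.
exact: rg_sub (@subPP K _) (form_rg _).
Qed.

Lemma coef_exists : exists A : 'I_4 -> {mpoly K[4]},
  (forall i, A i \is d.+1.-homog) /\ forall i x, nz x -> coef_fun i x = (A i).@[x].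
Proof.
have /choice[A hA] : forall i, exists p : {mpoly K[4]}, p \is d.+1.-homog /\
    forall x, nz x -> coef_fun i x = p.@[x].
  move=> i; have [p [h hp]] := global_section (coef_fun_rg i); exists p; split=> //.
  by case: hp => [->|[m [<-]]]; rewrite ?rpred0.
by exists A; split=> i; have [] := hA i.
Qed.

Definition coef : 'I_4 -> {mpoly K[4]} := projT1 (cid coef_exists).
Lemma coef_homog i : coef i \is d.+1.-homog.
Proof. by rewrite /coef; case: cid => A []. Qed.
Lemma coefE i x : nz x -> coef_fun i x = (coef i).@[x].
Proof. by have [_ h] := projT2 (cid coef_exists); exact: h. Qed.

Definition coefv x : 'I_4 -> K := fun i => (coef i).@[x].

Lemma dot_coef x : nz x -> dot (coefv x) x = 0.
Proof.
move=> /[dup] nzx [k xk]; rewrite /dot /coefv.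
transitivity ((\sum_r x r * form (coord_field r k) x) / x k); last first.
  by rewrite form_coord_euler // mul0r.
rewrite mulr_suml; apply: eq_bigr => i _; rewrite -coefE // (coef_funE i xk); ring.
Qed.

Lemma form_dot U (D : TP3 K U) x v : pts U x ->
  (forall i j, vmat D x i j = wedge x v i j) -> form D x = dot (coefv x) v.
Proof.
move=> Ux Dv; have nzx := zopen_nz Ux; have [k kx] := in_some_chart Ux.
have xk : x k != 0 by apply/chartE.
pose V := zcap U (chart K k); have VU : V `<=` U := @zcapl K _ _.
have Vk : V `<=` chart K k := @zcapr K _ _; have Vx : pts V x by [].
have hc r : rg 0 V (fun y => vmat D y k r * y k ^ (- 2)).
  have [h _] := vmat_vfield D.
  by apply: (rgM (j := 2) (k := - 2)) => //; [exact: rg_sub VU (h k r)|exact: rg_chart_pow].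
rewrite -(form_res VU) // (@form_coord _ k (fun r => mkreg (hc r))) //; last first.
  move=> y i j Vy; have yk : y k != 0 by apply/chartE/Vk.
  rewrite vmat_res //; have [_ /(_ y (VU y Vy))[w Dw]] := vmat_vfield D.
  transitivity (\sum_r (wedge y w k r / y k) * wedge y (fun s => (s == r)%:R) i j); last first.
    by apply: eq_bigr => r _; rewrite mkregE // !Dw /wedge -exprnN; field.
  by rewrite (sum_wedge_delta y (fun r => wedge y w k r / y k)) Dw /wedge; field.
transitivity (\sum_r (wedge x v k r / x k) * coefv x r).
  apply: eq_bigr => r _; rewrite mkregE // Dv /coefv -coefE // (coef_funE r xk) -exprnN.
  by field.
transitivity (dot (coefv x) v - v k / x k * dot (coefv x) x).
  by rewrite /dot !sum4 /wedge; field.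
by rewrite dot_coef // mulr0 subr0.
Qed.

(** At a common zero of the coefficients the form vanishes on all derivations. Their images locally
    exhaust [I(d+2)], so every local section of [I] vanishes at the point. *)
Lemma zeros_coef x : nz x -> (forall i, (coef i).@[x] = 0) -> zeros (sing_incl F) x.
Proof.
move=> nzx Ax; split=> // U s Ux; have [V [VU [k [Vx Vk]]]] := chart_cover Ux.
have hc W (WV : W `<=` V) (c : reg (- N) W) : rg 0 W (fun y => c y * y k ^ N).
  apply: (rgM (j := - N) (k := N)); [by rewrite addNr|exact: rg_reg|].
  exact: rg_chart_pow (sub_trans WV Vk).
(* The section [s], made into a section of [I(d+2)] by a power of the chart coordinate. *)
pose t W (WV : W `<=` V) (c : Osh K (- N) W) : sing_ideal F W :=
  (mkreg (hc W WV c) : OO W) *: res (sub_trans WV VU) s.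
have ht : is_hom (t : Fam (fun W => Osh K (- N) W) (sing_ideal F) V).
  split.
    move=> W WV a c e; rewrite /t scalerA -scalerDl; congr (_ *: _).
    apply: reg_eqP => y Wy.
    rewrite mkregE // -[RHS]/(a y * mkreg (hc W WV c) y + mkreg (hc W WV e) y).
    by rewrite !mkregE // -[(a *: c + e : reg _ _) y]/(a y * c y + e y); ring.
  move=> W W' WV W'V W'W c; rewrite /t res_scale.
    rewrite (res_comp (sub_trans WV VU) W'W (sub_trans W'V VU)); congr (_ *: _).
  by apply: reg_eqP => y Wy; rewrite regRE // !mkregE // ?regRE //; apply: W'W.
have [W [WV [Wx [D eD]]]] := @dist_form_epi K d F V (mkhom ht) x Vx.
have Wk := sub_trans WV Vk; pose c : Osh K (- N) W := chart_gen (- N) Wk.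
have E := formE D (@subset_refl _ _) c Wx.
have [v Dv] := proj2 (vmat_vfield D) x Wx.
have f0 : form D x = 0.
  by rewrite (form_dot Wx Dv) /dot big1 // => i _; rewrite /coefv Ax mul0r.
rewrite f0 mul0r eD (app_sub WV (mkhom ht) _ WV) app_mkhom /t mappZ mapp_res in E.
have xk : x k != 0 by apply/chartE/Vk.
have {E} : mkreg (hc W WV c) x * (regR (sub_trans WV VU) (mapp (sing_incl F) s : reg 0 U)) x = 0.
  exact: E.
rewrite regRE // mkregE // chart_genE // -expfzDr // addNr expr0z mul1r.
by [].
Qed.

Lemma coef_coprime (p : 'I_4 -> {mpoly K[4]}) :
  (forall i j, p i * coef j = p j * coef i) -> exists e, forall i, p i = coef i * e.
Proof. exact: (proportional_multiple (@sing_codim K d F) coef_homog zeros_coef). Qed.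

Definition is_tfield e U (m : vec K -> 'I_4 -> 'I_4 -> K) : Prop :=
  (forall i j, rg e U (fun x => m x i j)) /\
  forall x, pts U x -> exists2 v, dot (coefv x) v = 0 &
    forall i j, m x i j = wedge x v i j.

Definition tmat U (s : tangent F U) := vmat (mapp (dist_incl F) s).

Lemma tmat_lin U (a : OO U) (s t : tangent F U) x i j : pts U x ->
  tmat (a *: s + t) x i j = a x * tmat s x i j + tmat t x i j.
Proof. by move=> Ux; rewrite /tmat mapp_lin vmat_lin. Qed.

Lemma tmat_res U V (VU : V `<=` U) (s : tangent F U) x i j : pts V x ->
  tmat (res VU s) x i j = tmat s x i j.
Proof. by move=> Vx; rewrite /tmat mapp_res vmat_res. Qed.

Lemma tmat_inj U (s t : tangent F U) :
  (forall x i j, pts U x -> tmat s x i j = tmat t x i j) -> s = t.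
Proof. by move=> h; apply: (@dist_incl_mono K d F); apply: vmat_inj. Qed.

Lemma tmat_tfield U (s : tangent F U) : is_tfield 2 U (tmat s).
Proof.
have [h1 h2] := vmat_vfield (mapp (dist_incl F) s); split=> // x Ux.
have [v sv] := h2 x Ux; exists v => //; rewrite -(form_dot Ux sv).
have [h _] := dist_exact F; have [V [VU [k [Vx Vk]]]] := chart_cover Ux.
pose c : Osh K (- N) V := chart_gen (- N) Vk.
have := formE (mapp (dist_incl F) s) VU c Vx; rewrite h app_0l mapp0 => /esym/eqP.
by rewrite mulf_eq0 (negbTE (chart_gen_neq0 (- N) Vk Vx)) orbF => /eqP.
Qed.

(** Exactness provides preimages only locally. The inclusion of the tangent sheaf is injective, so
    they agree on overlaps and glue. *)
Lemma tmat_surj U m : is_tfield 2 U m ->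
  exists s : tangent F U, forall x i j, pts U x -> tmat s x i j = m x i j.
Proof.
move=> [h1 h2]; have hm : is_vfield 2 U m.
  by split=> // x /h2[v _ mv]; exists v.
pose D := der_of hm; have DE x i j (Ux : pts U x) : vmat D x i j = m x i j := vmat_der_of hm i j Ux.
have /form_eq0 D0 : forall x, pts U x -> form D x = 0.
  move=> x Ux; have [v av mv] := h2 x Ux; rewrite -av; apply: form_dot => // i j.
  by rewrite DE.
have [_ /(_ U D D0) loc] := dist_exact F.
have /choice[L hL] : forall x : {x | pts U x}, exists V : zopen K,
    exists VU : V `<=` U, pts V (projT1 x) /\ exists t : tangent F V, mapp (dist_incl F) t = res VU D.
  by move=> [x Ux] /=; exact: loc.
pose VU x : L x `<=` U := projT1 (cid (hL x)).
have hVU x : pts (L x) (projT1 x) /\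
    exists t : tangent F (L x), mapp (dist_incl F) t = res (VU x) D := projT2 (cid (hL x)).
have ht x : exists t : tangent F (L x), mapp (dist_incl F) t = res (VU x) D by case: (hVU x).
pose t x := projT1 (cid (ht x)); have tE x : mapp (dist_incl F) (t x) = res (VU x) D.
  by rewrite /t; case: cid.
have [[sheafT _] _] := tangent_reflexive F.
have [||s [sE _]] := @sheafT U _ L VU _ t.
- by move=> x Ux; exists (exist _ x Ux) => //; case: (hVU (exist _ x Ux)).
- move=> x y V Vx Vy; apply: tmat_inj => z i j Vz.
  rewrite !tmat_res // /tmat !tE !vmat_res //; [exact: Vy|exact: Vx].
exists s => x i j Ux; have [Lx _] := hVU (exist _ x Ux).
rewrite -DE // -(tmat_res (VU (exist _ x Ux)) s) // sE /tmat tE vmat_res //.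
Qed.
End DistributionForm.

(** * The determinant pairing *)

Section PointwiseExtra.
Variable K : fieldType.
Implicit Types (x v w : 'I_4 -> K) (m : 'I_4 -> 'I_4 -> K).

Lemma eta_diag x v l : eta x v v l = 0.
Proof. rewrite /eta sum4 /wedge; move: l; apply: ord4_ind; rewrite /star /=; ring. Qed.

Lemma eta_sym x v w l : eta x w v l = - eta x v w l.
Proof. rewrite /eta !sum4 /wedge; move: l; apply: ord4_ind; rewrite /star /=; ring. Qed.

Lemma star_entry (k l : 'I_4) : k != l ->
  exists p q, forall m, star m k l = m p q.
Proof.
move: k l; do 2!apply: ord4_ind; rewrite //= => _; rewrite /star /=;
  first [by exists o2, o3 | by exists o3, o1 | by exists o1, o2 | by exists o0, o3
  | by exists o2, o0 | by exists o0, o1 | by exists o3, o2 | by exists o1, o3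
  | by exists o2, o1 | by exists o3, o0 | by exists o0, o2 | by exists o1, o0].
Qed.

Lemma star_lin (a : K) m m' i j :
  star (fun r s => a * m r s + m' r s) i j = a * star m i j + star m' i j.
Proof.
by move: i j; do 2!apply: ord4_ind; rewrite /star /= ?mulr0 ?addr0.
Qed.

Lemma pair_mx_linl (a : K) m m' t k l :
  pair_mx (fun r s => a * m r s + m' r s) t k l = a * pair_mx m t k l + pair_mx m' t k l.
Proof.
rewrite /pair_mx mulr_sumr -big_split /=; apply: eq_bigr => i _.
by rewrite star_lin; ring.
Qed.

Lemma eq_pair_mx s s' t t' k l : (forall i j, s i j = s' i j) ->
  (forall i j, t i j = t' i j) -> @pair_mx K s t k l = pair_mx s' t' k l.
Proof.
move=> hs ht; apply: eq_bigr => i _; by rewrite ht (eq_star _ _ hs).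
Qed.
End PointwiseExtra.

Section TangentFields.
Variables (K : closedFieldType) (d : nat) (F : distribution K d).
Implicit Types (U V W : zopen K) (x y : vec K).
Implicit Types (m s t u w : vec K -> 'I_4 -> 'I_4 -> K) (e : int).
Local Notation a := (coefv F).

Lemma tfield_sub e U V m : V `<=` U -> is_tfield F e U m -> is_tfield F e V m.
Proof.
by move=> VU [h1 h2]; split=> [i j|x /VU]; [exact: rg_sub VU (h1 i j)|exact: h2].
Qed.

Lemma tfield_eq e U m m' : (forall x i j, pts U x -> m x i j = m' x i j) ->
  is_tfield F e U m -> is_tfield F e U m'.
Proof.
move=> E [h1 h2]; split=> [i j|x Ux].
  by apply: (rg_eq _ (h1 i j)) => x Ux; rewrite E.
by have [v av mv] := h2 x Ux; exists v => // i j; rewrite -E.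
Qed.

Lemma tfield_scale k e U (f : vec K -> K) m : rg k U f -> is_tfield F e U m ->
  is_tfield F (k + e) U (fun x i j => f x * m x i j).
Proof.
move=> hf [h1 h2]; split=> [i j|x Ux]; first exact: rgM (hf) (h1 i j).
have [v av mv] := h2 x Ux; exists (fun i => f x * v i).
  transitivity (f x * dot (a x) v); last by rewrite av mulr0.
  by rewrite /dot mulr_sumr; apply: eq_bigr => i _; ring.
by move=> i j; rewrite mv /wedge; ring.
Qed.

Lemma tfield_add e U m m' : is_tfield F e U m -> is_tfield F e U m' ->
  is_tfield F e U (fun x i j => m x i j + m' x i j).
Proof.
move=> [h1 h2] [h1' h2']; split=> [i j|x Ux]; first exact: rgD.
have [v av mv] := h2 x Ux; have [v' av' mv'] := h2' x Ux.
exists (fun i => v i + v' i).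
  transitivity (dot (a x) v + dot (a x) v'); last by rewrite av av' addr0.
  by rewrite /dot -big_split /=; apply: eq_bigr => i _; ring.
by move=> i j; rewrite mv mv' /wedge; ring.
Qed.

Lemma some_coef : exists l, coef F l != 0.
Proof. exact: some_coef_neq0 (@coef_coprime K d F). Qed.

(** One coefficient of [a] is a nonzero polynomial, so points where it does not vanish are enough;
    some coordinate is nonzero at every point. *)
Lemma tfield_dense k U (f : vec K -> K) : rg k U f ->
  (forall x i l, pts U x -> x i != 0 -> a x l != 0 -> f x = 0) ->
  forall x, pts U x -> f x = 0.
Proof.
move=> hf h; have [l Al] := some_coef.
apply: (rg_dense Al hf) => x Ux al; have [i xi] := zopen_nz Ux.
exact: h Ux xi al.
Qed.

Lemma tfield_dense_eq k U (f g : vec K -> K) : rg k U f -> rg k U g ->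
  (forall x i l, pts U x -> x i * a x l * f x = x i * a x l * g x) ->
  forall x, pts U x -> f x = g x.
Proof.
move=> hf hg h x Ux; apply/eqP; rewrite -subr_eq0; apply/eqP.
apply: (tfield_dense (rgB hf hg)) Ux => {}x i l Ux xi al.
have xa : x i * a x l != 0 by rewrite mulf_neq0.
by apply: (mulfI xa); rewrite mulr0 mulrBr h // subrr.
Qed.

Definition tsec U m (hm : is_tfield F 2 U m) : tangent F U :=
  projT1 (cid (tmat_surj hm)).

Lemma tmat_tsec U m (hm : is_tfield F 2 U m) x i j : pts U x ->
  tmat (tsec hm) x i j = m x i j.
Proof. by have := projT2 (cid (tmat_surj hm)); apply. Qed.

Lemma koszul_tfield U i l :
  is_tfield F d.+2 U (fun x => wedge x (koszul (a x) i l)).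
Proof.
have h r : rg d.+1 U (fun x => koszul (a x) i l r).
  have ha (r' : 'I_4) (b : bool) : rg d.+1 U (fun x => a x r' * b%:R).
    by apply: (rgM (j := d.+1) (k := 0)); [rewrite addr0|exact/rg_poly/coef_homog|exact: rg_const].
  exact: rgB (ha _ _) (ha _ _).
split=> [r r'|x Ux]; last by exists (koszul (a x) i l) => //; exact: dot_koszul.
have e : d.+2%:Z = 1 + d.+1%:Z by rewrite -[in LHS]addn1 PoszD addrC.
by apply: rgB; apply: rgM e (rg_coord _ _) (h _).
Qed.

(* For tangent fields s = x /\ v, t = x /\ w the 1-form [eta x v w] is a multiple
   of the defining form; the factor is the value of the determinant pairing. *)
Definition is_pairing U s t (h : vec K -> K) : Prop :=
  forall x (r l : 'I_4), pts U x -> pair_mx (s x) (t x) r l = x r * a x l * h x.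

(** The entries of [pair_mx] have degree [e + e']; the degrees 1 and [d.+1] of the factors [x r] and
    [a x l] are subtracted. *)
Definition pdeg e e' : int := e' + e - 1 - d.+1%:Z.

Lemma rg_star e U s i j : (forall i j, rg e U (fun x => s x i j)) ->
  rg e U (fun x => star (s x) i j).
Proof.
move=> h; move: i j; do 2!apply: ord4_ind; rewrite /star /=; first [exact: h|exact: rg0].
Qed.

Lemma pairing_exists e e' U s t : is_tfield F e U s -> is_tfield F e' U t ->
  exists h, rg (pdeg e e') U h /\ is_pairing U s t h.
Proof.
move=> [hs1 hs2] [ht1 ht2].
have [|||h [hh hE]] := @rg_divide2 K d.+1 (coef F) (@coef_homog K d F)
    (@coef_coprime K d F) (e' + e) U (fun k l x => pair_mx (s x) (t x) k l).
- by move=> k l; apply: rg_sum => i _; apply: rgM erefl (ht1 k i) (rg_star i l hs1).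
- move=> x k l r Ux; have [v av sv] := hs2 x Ux; have [w aw tw] := ht2 x Ux.
  by rewrite !(pair_mxE _ _ sv tw); ring.
- move=> x k l r Ux; have [v av sv] := hs2 x Ux; have [w aw tw] := ht2 x Ux.
  have := eta_proportional l r (dot_coef F (zopen_nz Ux)) av aw.
  rewrite !(pair_mxE _ _ sv tw) -!mulrA => E; congr (_ * _); exact: E.
by exists h.
Qed.

Definition pairing e e' U s t : vec K -> K :=
  xget (fun=> 0) [set h | rg (pdeg e e') U h /\ is_pairing U s t h].

Section Pairing.
Variables (e e' : int) (U : zopen K) (s t : vec K -> 'I_4 -> 'I_4 -> K).
Hypotheses (hs : is_tfield F e U s) (ht : is_tfield F e' U t).

Lemma pairing_rg : rg (pdeg e e') U (pairing e e' U s t).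
Proof. by have [] := xgetPex (fun=> 0) (pairing_exists hs ht). Qed.

Lemma pairingP : is_pairing U s t (pairing e e' U s t).
Proof. by have [] := xgetPex (fun=> 0) (pairing_exists hs ht). Qed.

Lemma pairing_unique h : rg (pdeg e e') U h -> is_pairing U s t h ->
  forall x, pts U x -> pairing e e' U s t x = h x.
Proof.
move=> hh hP; apply: (tfield_dense_eq pairing_rg hh) => x i l Ux.
by rewrite -hP // -pairingP.
Qed.

Lemma pairing_eta x (v w : 'I_4 -> K) l : pts U x -> (forall i j, s x i j = wedge x v i j) ->
  (forall i j, t x i j = wedge x w i j) -> eta x v w l = a x l * pairing e e' U s t x.
Proof.
move=> Ux sv tw; have [k xk] := zopen_nz Ux; apply: (mulfI xk).
by rewrite -(pair_mxE _ _ sv tw) pairingP // mulrA.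
Qed.
End Pairing.

Lemma pairing_sub e e' U V s t x : is_tfield F e U s -> is_tfield F e' U t ->
  V `<=` U -> pts V x -> pairing e e' V s t x = pairing e e' U s t x.
Proof.
move=> hs ht VU; apply: pairing_unique.
- exact: tfield_sub VU hs.
- exact: tfield_sub VU ht.
- exact: rg_sub VU (pairing_rg hs ht).
- by move=> y k l /VU Uy; apply: pairingP.
Qed.

Lemma pairing_eq e e' U s s' t t' x : is_tfield F e U s -> is_tfield F e' U t ->
  (forall x i j, pts U x -> s' x i j = s x i j) ->
  (forall x i j, pts U x -> t' x i j = t x i j) -> pts U x ->
  pairing e e' U s' t' x = pairing e e' U s t x.
Proof.
move=> hs ht es et; apply: pairing_unique.
- by apply: tfield_eq hs => y i j Uy; rewrite es.
- by apply: tfield_eq ht => y i j Uy; rewrite et.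
- exact: pairing_rg.
- by move=> y k l Uy; rewrite -(pairingP hs ht) //; apply: eq_pair_mx => i j; [exact: es|exact: et].
Qed.

Lemma pairing_diag e U s x : is_tfield F e U s -> pts U x -> pairing e e U s s x = 0.
Proof.
move=> hs; apply: (pairing_unique hs hs (rg0 _ _)) => y k l Uy.
by have [v _ sv] := proj2 hs y Uy; rewrite (pair_mxE _ _ sv sv) eta_diag !mulr0.
Qed.

Lemma pairing_sym e e' U s t x : is_tfield F e U s -> is_tfield F e' U t ->
  pts U x -> pairing e' e U t s x = - pairing e e' U s t x.
Proof.
move=> hs ht; apply: (pairing_unique (h := fun x => - pairing e e' U s t x) ht hs).
  have -> : pdeg e' e = pdeg e e' by rewrite /pdeg [e + _]addrC.
  exact: rgN (pairing_rg hs ht).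
move=> y k l Uy; have [v _ sv] := proj2 hs y Uy; have [w _ tw] := proj2 ht y Uy.
by rewrite (pair_mxE _ _ tw sv) eta_sym (pairing_eta hs ht l Uy sv tw); ring.
Qed.

Lemma pairing_linl e e' U (f : vec K -> K) s s' t x : rg 0 U f ->
  is_tfield F e U s -> is_tfield F e U s' -> is_tfield F e' U t -> pts U x ->
  pairing e e' U (fun x i j => f x * s x i j + s' x i j) t x =
  f x * pairing e e' U s t x + pairing e e' U s' t x.
Proof.
move=> hf hs hs' ht; have hfs := tfield_scale hf hs; rewrite add0r in hfs.
apply: (pairing_unique (h := fun x => f x * pairing e e' U s t x + pairing e e' U s' t x)
  (tfield_add hfs hs') ht).
  by apply: rgD (pairing_rg hs' ht); apply: rgM (esym (add0r _)) hf (pairing_rg hs ht).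
move=> y k l Uy; rewrite pair_mx_linl (pairingP hs ht) // (pairingP hs' ht) //; ring.
Qed.

Lemma pairing_scale k e e' U (f : vec K -> K) s t x : rg k U f ->
  is_tfield F e U s -> is_tfield F e' U t -> pts U x ->
  pairing (k + e) e' U (fun x i j => f x * s x i j) t x = f x * pairing e e' U s t x.
Proof.
move=> hf hs ht.
apply: (pairing_unique (h := fun x => f x * pairing e e' U s t x) (tfield_scale hf hs) ht).
  by apply: rgM hf (pairing_rg hs ht); rewrite /pdeg; ring.
move=> y r l Uy; transitivity (f y * pair_mx (s y) (t y) r l).
  rewrite -[RHS]addr0 -[X in _ + X](_ : pair_mx (fun _ _ => 0) (t y) r l = 0).
    by rewrite -pair_mx_linl; apply: eq_pair_mx => // i j; rewrite addr0.
  rewrite /pair_mx big1 // => i _.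
  by rewrite (_ : star _ _ _ = 0) ?mulr0 //; move: i l; do 2!apply: ord4_ind.
by rewrite (pairingP hs ht) //; ring.
Qed.

(* Three sections of a sheaf of rank 2 are linearly dependent. *)
Lemma pairing_relation e1 e2 e3 U s t w x i j :
  is_tfield F e1 U s -> is_tfield F e2 U t -> is_tfield F e3 U w -> pts U x ->
  pairing e1 e2 U s t x * w x i j + pairing e2 e3 U t w x * s x i j
  + pairing e3 e1 U w s x * t x i j = 0.
Proof.
move=> hs ht hw; pose E := pdeg e1 e2 + e3.
have h1 : rg E U (fun x => pairing e1 e2 U s t x * w x i j).
  exact: rgM erefl (pairing_rg hs ht) (proj1 hw i j).
have h2 : rg E U (fun x => pairing e2 e3 U t w x * s x i j).
  by apply: rgM (pairing_rg ht hw) (proj1 hs i j); rewrite /E /pdeg; ring.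
have h3 : rg E U (fun x => pairing e3 e1 U w s x * t x i j).
  by apply: rgM (pairing_rg hw hs) (proj1 ht i j); rewrite /E /pdeg; ring.
apply: (tfield_dense_eq (rgD (rgD h1 h2) h3) (rg0 _ _)) => {}x k l Ux.
have [vs as_ sv] := proj2 hs x Ux; have [vt at_ tv] := proj2 ht x Ux.
have [vw aw wv] := proj2 hw x Ux; rewrite mulr0.
have ax := dot_coef F (zopen_nz Ux).
have [al|al] := eqVneq (a x l) 0; first by rewrite al mulr0 mul0r.
have := eta_relation x vs vt vw i j l.
rewrite (dot_eta ax as_ at_ al aw) mul0r.
rewrite (pairing_eta hs ht l Ux sv tv) (pairing_eta ht hw l Ux tv wv).
rewrite (pairing_eta hw hs l Ux wv sv) -sv -tv -wv => E0.
by rewrite -[RHS](mulr0 (x k)) -E0; ring.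
Qed.

(** The linear relation of [pairing_relation], paired with a fourth field [u]. *)
Lemma pairing_plucker e1 e2 e3 e4 U s t w u x :
  is_tfield F e1 U s -> is_tfield F e2 U t -> is_tfield F e3 U w ->
  is_tfield F e4 U u -> pts U x ->
  pairing e1 e2 U s t x * pairing e3 e4 U w u x
  + pairing e2 e3 U t w x * pairing e1 e4 U s u x
  + pairing e3 e1 U w s x * pairing e2 e4 U t u x = 0.
Proof.
move=> hs ht hw hu; pose E := pdeg e1 e2 + pdeg e3 e4.
have h1 : rg E U (fun x => pairing e1 e2 U s t x * pairing e3 e4 U w u x).
  exact: rgM erefl (pairing_rg hs ht) (pairing_rg hw hu).
have h2 : rg E U (fun x => pairing e2 e3 U t w x * pairing e1 e4 U s u x).
  by apply: rgM (pairing_rg ht hw) (pairing_rg hs hu); rewrite /E /pdeg; ring.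
have h3 : rg E U (fun x => pairing e3 e1 U w s x * pairing e2 e4 U t u x).
  by apply: rgM (pairing_rg hw hs) (pairing_rg ht hu); rewrite /E /pdeg; ring.
apply: (tfield_dense_eq (rgD (rgD h1 h2) h3) (rg0 _ _)) => {}x k l Ux.
set p1 := pairing e1 e2 _ _ _ _; set p2 := pairing e2 e3 _ _ _ _.
set p3 := pairing e3 e1 _ _ _ _; rewrite mulr0 !mulrDr.
rewrite ![_ * (p1 * _)]mulrCA ![_ * (p2 * _)]mulrCA ![_ * (p3 * _)]mulrCA.
have P e (r : vec K -> 'I_4 -> 'I_4 -> K) (hr : is_tfield F e U r) :
    x k * a x l * pairing e e4 U r u x = - pair_mx (u x) (r x) k l.
  rewrite (pairing_sym hu hr Ux) mulrN; congr (- _).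
  by rewrite (pairingP hu hr).
rewrite (P _ _ hw) (P _ _ hs) (P _ _ ht) /pair_mx !mulrN -!opprD; apply/eqP.
rewrite oppr_eq0 !mulr_sumr -!big_split big1 //= => r _.
have := pairing_relation k r hs ht hw Ux; rewrite -/p1 -/p2 -/p3 => E0.
by rewrite -[RHS](mul0r (star (u x) r l)) -E0; ring.
Qed.
End TangentFields.

(** * The first Chern class *)

(** The elimination showing that alternating forms in rank 2 are proportional. In the application
    [h] and [e] are the pairings of two pairs of sections, and [g] and [f] the values of an
    alternating form on them. The two long relations share the coefficients [a1], [a2]; the short
    ones express [f1], [f2] through [g]. *)
Lemma rank_one_algebra (R : comPzRingType) (h f a1 a2 b1 b2 f1 f2 g e : R) :
  h * f + a1 * f1 + a2 * f2 = 0 -> h * f1 = b1 * g -> h * f2 = b2 * g ->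
  h * e + a1 * b1 + a2 * b2 = 0 -> h * (h * f) = h * (e * g).
Proof.
move=> e1 e2 e3 e4; apply/eqP; rewrite -subr_eq0; apply/eqP.
transitivity (h * (h * f + a1 * f1 + a2 * f2) - a1 * (h * f1 - b1 * g)
  - a2 * (h * f2 - b2 * g) - (h * e + a1 * b1 + a2 * b2) * g); first by ring.
by rewrite e1 e2 e3 e4 !subrr; ring.
Qed.

Section Determinant.
Variables (K : closedFieldType) (d : nat) (F : distribution K d).
Implicit Types (U V W : zopen K) (x y : vec K).
Local Notation a := (coefv F).
Local Notation T := (tangent F).

Definition spair V (s t : T V) : vec K -> K := pairing F 2 2 V (tmat s) (tmat t).

Lemma spair_rg V (s t : T V) : rg (2 - d%:Z) V (spair s t).
Proof.
have -> : 2 - d%:Z = pdeg d 2 2 by rewrite /pdeg intS; ring.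
exact: pairing_rg (tmat_tfield s) (tmat_tfield t).
Qed.

Lemma spair_lin V (b : OO V) (s t u : T V) x : pts V x ->
  spair (b *: s + t) u x = b x * spair s u x + spair t u x.
Proof.
move=> Vx; have hs := tmat_tfield s; have ht := tmat_tfield t; have hu := tmat_tfield u.
rewrite /spair -(pairing_linl (rg_reg b) hs ht hu Vx).
have hbs := tfield_scale (rg_reg b) hs; rewrite add0r in hbs.
apply: (pairing_eq (tfield_add hbs ht) hu) => // y i j Vy; exact: tmat_lin.
Qed.

Lemma spair_diag V (s : T V) x : pts V x -> spair s s x = 0.
Proof. exact: pairing_diag (tmat_tfield s). Qed.

Lemma spair_sym V (s t : T V) x : pts V x -> spair t s x = - spair s t x.
Proof. exact: pairing_sym (tmat_tfield s) (tmat_tfield t). Qed.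

Lemma spair_res U V (VU : V `<=` U) (s t : T U) x : pts V x ->
  spair (res VU s) (res VU t) x = spair s t x.
Proof.
move=> Vx; have [hs ht] := (tmat_tfield s, tmat_tfield t).
rewrite -[RHS](pairing_sub hs ht VU Vx).
by apply: (pairing_eq (tfield_sub VU hs) (tfield_sub VU ht)) => // y i j Vy; exact: tmat_res.
Qed.

Definition aapp U (phi : Alt2 T U) V (VU : V `<=` U) (s t : T V) : OO V :=
  (Defs.sval (phi : subsec (is_alt2_closed T) U) :
     fam (fun V => (T V * T V)%type) (Osh K 0) U) V VU (s, t).

Section Alternating.
Variables (U : zopen K) (phi : Alt2 T U).
Lemma aapp_linl V (VU : V `<=` U) (b : OO V) (s t u : T V) :
  aapp phi VU (b *: s + t) u = b *: aapp phi VU s u + aapp phi VU t u.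
Proof.
by have [h _ _ _] := subsecP (phi : subsec (is_alt2_closed T) U); apply: h.
Qed.
Lemma aapp_linr V (VU : V `<=` U) (b : OO V) (s t u : T V) :
  aapp phi VU u (b *: s + t) = b *: aapp phi VU u s + aapp phi VU u t.
Proof.
by have [_ h _ _] := subsecP (phi : subsec (is_alt2_closed T) U); apply: h.
Qed.
Lemma aapp_diag V (VU : V `<=` U) (s : T V) : aapp phi VU s s = 0.
Proof.
by have [_ _ h _] := subsecP (phi : subsec (is_alt2_closed T) U); apply: h.
Qed.
Lemma aapp_res V W (VU : V `<=` U) (WU : W `<=` U) (WV : W `<=` V) (s t : T V) :
  aapp phi WU (res WV s) (res WV t) = OOres WV (aapp phi VU s t).
Proof.
by have [_ _ _ h] := subsecP (phi : subsec (is_alt2_closed T) U); apply: h.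
Qed.
Lemma aapp_sym V (VU : V `<=` U) (s t : T V) x :
  aapp phi VU t s x = - aapp phi VU s t x.
Proof.
have := aapp_diag VU (s + t); rewrite -[s in s + _]scale1r aapp_linl.
have E u : 1 *: s + u = u + s by rewrite scale1r addrC.
rewrite E -[t in t + s]scale1r !aapp_linr !aapp_diag !scale1r addr0 add0r.
move=> /(congr1 (fun f : OO V => f x)).
rewrite -[X in X = _ -> _]/(aapp phi VU s t x + aapp phi VU t s x).
by move=> /eqP; rewrite addr_eq0 => /eqP->; rewrite opprK.
Qed.
Lemma aapp0 V (VU : V `<=` U) (s : T V) x : aapp phi VU 0 s x = 0.
Proof.
have := aapp_linl VU 1 0 0 s; rewrite !scale1r addr0.
move=> /(congr1 (fun f => f - aapp phi VU 0 s)); rewrite subrr addrK => /(congr1 (fun f : OO V => f x)).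
by move=> <-.
Qed.

(** [phi] with second argument [u] is applied to the linear relation between three sections. *)
Lemma aapp_relation V (VU : V `<=` U) (s t w u : T V) x : pts V x ->
  spair s t x * aapp phi VU w u x + spair t w x * aapp phi VU s u x
  + spair w s x * aapp phi VU t u x = 0.
Proof.
move=> Vx; have [W [WV [k [Wx Wk]]]] := chart_cover Vx.
have WU := sub_trans WV VU.
(* The pairing of sections has degree [2 - d]; the power of the coordinate turns it into a function
   by which sections may be multiplied. *)
have hc (s' t' : T V) : rg 0 W (fun y => spair s' t' y * y k ^ (d%:Z - 2)).
  apply: (rgM (j := 2 - d%:Z) (k := d%:Z - 2)); first by ring.
    exact: rg_sub WV (spair_rg s' t').
  exact: rg_chart_pow.
pose c s' t' : OO W := mkreg (hc s' t').
have R : c s t *: res WV w + (c t w *: res WV s + (c w s *: res WV t + 0)) = 0.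
  apply: tmat_inj => y i j Wy; rewrite !tmat_lin // !tmat_res // !mkregE //.
  have z : tmat (0 : T W) y i j = 0 by rewrite /tmat mapp0 vmat0.
  rewrite z addr0.
  have := pairing_relation i j (tmat_tfield s) (tmat_tfield t) (tmat_tfield w) (WV y Wy).
  rewrite -/(spair _ _) -/(spair _ _) -/(spair _ _) => E.
  by rewrite -[RHS](mul0r (y k ^ (d%:Z - 2))) -E; ring.
have := aapp0 WU (res WV u) x; rewrite -R !aapp_linl.
have E (b : OO W) (f g : OO W) : (b *: f + g : OO W) x = b x * f x + g x by [].
rewrite !E aapp0 addr0 !(aapp_res VU WU WV) !regRE // !mkregE // => E0.
have xk : x k ^ (d%:Z - 2) != 0 by rewrite expfz_neq0 //; apply/chartE/Wk.
by apply: (mulIf xk); rewrite mul0r -[RHS]E0; ring.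
Qed.

Lemma aapp_proportional V (VU : V `<=` U) (s t s' t' : T V) x : pts V x ->
  spair s' t' x * aapp phi VU s t x = spair s t x * aapp phi VU s' t' x.
Proof.
move=> Vx; have R w1 w2 w3 w4 := aapp_relation VU w1 w2 w3 w4 Vx.
have H w1 w2 := spair_sym w1 w2 Vx; have B := aapp_sym VU.
have P w1 w2 w3 w4 := pairing_plucker (tmat_tfield (w1 : T V)) (tmat_tfield (w2 : T V))
  (tmat_tfield (w3 : T V)) (tmat_tfield (w4 : T V)) Vx.
have gen (p q p' q' : T V) : spair p' q' x * (spair p' q' x * aapp phi VU p q x)
    = spair p' q' x * (spair p q x * aapp phi VU p' q' x).
  have d1 : aapp phi VU p' p' x = 0 by rewrite aapp_diag.
  have d2 : aapp phi VU q' q' x = 0 by rewrite aapp_diag.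
  apply: (rank_one_algebra (R p' q' p q) _ _ (P p' q' p q)).
    have := R p' q' q p'; rewrite d1 mulr0 addr0 (B p' q) (H p' q) (B p' q') => /eqP.
    by rewrite addr_eq0 mulrN => /eqP/oppr_inj ->; rewrite mulrNN.
  have := R p' q' q q'; rewrite d2 mulr0 addr0 (B q' q) => /eqP.
  by rewrite addr_eq0 mulrN => /eqP/oppr_inj ->.
have [h0|h0] := eqVneq (spair s' t' x) 0; last exact: (mulfI h0) (gen _ _ _ _).
have [h1|h1] := eqVneq (spair s t x) 0; first by rewrite h0 h1 !mul0r.
exact/esym/(mulfI h1)/gen.
Qed.
End Alternating.
End Determinant.

Lemma eta_scale (K : fieldType) (c : K) x v w l :
  eta x (fun i => c * v i) (fun i => c * w i) l = c ^+ 2 * eta x v w l.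
Proof. rewrite /eta !sum4 /wedge; move: l; apply: ord4_ind; rewrite /star /=; ring. Qed.

(** * Alternating forms as multiples of the pairing *)

Section AlternatingForms.
Variables (K : closedFieldType) (d : nat) (F : distribution K d).
Implicit Types (U V W : zopen K) (x y : vec K).
Local Notation a := (coefv F).
Local Notation T := (tangent F).

(** Since [dot (a x) x = 0], a point with [a x l != 0] is not the [l]-th coordinate point. *)
Lemma chart_off_diag x l : nz x -> a x l != 0 -> exists2 k, x k != 0 & k != l.
Proof.
move=> nzx al; apply: contrapT => /forall2NP H.
have x0 k : k != l -> x k = 0.
  by move=> kl; have [/negP|] := H k; [rewrite negbK => /eqP|rewrite kl].
have := dot_coef F nzx; rewrite /dot (bigD1 l) //= big1 ?addr0.
  move/eqP; rewrite mulf_eq0 (negbTE al) /= => /eqP xl.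
  by case: nzx => i; have [->|/x0 ->] := eqVneq i l; rewrite ?xl eqxx.
by move=> i /x0 ->; rewrite mulr0.
Qed.

Section LocalFrame.
Variables (W : zopen K) (k : 'I_4).
Hypothesis Wk : W `<=` chart K k.

Lemma chart_neq0 x : pts W x -> x k != 0.
Proof. by move=> /Wk/chartE. Qed.

(** The power [- d] of the chart coordinate lowers the degree [d + 2] of a Koszul field to 2, the
    degree of sections of the tangent sheaf. *)
Fact chart_koszul_tfield i l : is_tfield F 2 W
  (fun x r s => x k ^ (- d%:Z) * wedge x (koszul (a x) i l) r s).
Proof.
have -> : 2 = - d%:Z + d.+2%:Z by rewrite !intS; ring.
exact: tfield_scale (rg_chart_pow (- d%:Z) Wk) (koszul_tfield F W i l).
Qed.
Definition chart_koszul i l : T W := tsec (chart_koszul_tfield i l).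

Lemma tmat_chart_koszul i l x r s : pts W x ->
  tmat (chart_koszul i l) x r s =
  wedge x (fun j => x k ^ (- d%:Z) * koszul (a x) i l j) r s.
Proof. by move=> Wx; rewrite tmat_tsec // /wedge; ring. Qed.

Lemma spair_chart_koszul l x : k != l -> pts W x ->
  star (fun p q => spair (chart_koszul p l) (chart_koszul q l) x) k l =
  x k * (x k ^ (- d%:Z)) ^+ 2 * a x l.
Proof.
move=> kl; have [p [q E]] := star_entry K kl; rewrite E {1}/spair.
apply: (pairing_unique (h := fun x => x k * (x k ^ (- d%:Z)) ^+ 2 * a x l)
  (tmat_tfield _) (tmat_tfield _)).
  have hx := rg_chart_pow (- d%:Z) Wk.
  apply: (rgM (j := 1 + (- d%:Z) *+ 2) (k := d.+1)).
  - by rewrite /pdeg intS mulr2n; ring.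
  - exact: rgM erefl (rg_coord W k) (rg_exp 2 hx).
  - exact/rg_poly/coef_homog.
move=> y i r Wy; have ax := dot_coef F (zopen_nz Wy).
rewrite (pair_mxE (x := y) (v := fun j => y k ^ (- d%:Z) * koszul (a y) p l j)
  (w := fun j => y k ^ (- d%:Z) * koszul (a y) q l j)); last first.
- by move=> *; exact: tmat_chart_koszul.
- by move=> *; exact: tmat_chart_koszul.
rewrite eta_scale; have := eta_koszul r kl ax; rewrite E => ->; ring.
Qed.

(** At each point [phi] is proportional to the pairing, whose values on Koszul sections are known
    multiples of [a x l]. So the values [f l] of [phi] are proportional to [a x l], and division by
    [a] gives the multiplier, also at the zeros of [a]. *)
Lemma alt2_local U (WU : W `<=` U) (phi : Alt2 T U) :
  exists g, rg (d%:Z - 2) W g /\ forall V (VU : V `<=` U) (VW : V `<=` W) (s t : T V) x,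
    pts V x -> aapp phi VU s t x = g x * spair s t x.
Proof.
pose f l x := star (fun p q => aapp phi WU (chart_koszul p l) (chart_koszul q l) x) k l.
have hf l : rg 0 W (f l) by apply: rg_star => i j; exact: rg_reg.
have prop V (VU : V `<=` U) (VW : V `<=` W) (s t : T V) l x : k != l -> pts V x ->
    x k * (x k ^ (- d%:Z)) ^+ 2 * a x l * aapp phi VU s t x = spair s t x * f l x.
  move=> kl Vx; rewrite -spair_chart_koszul //; last exact: VW.
  rewrite /f; have [p [q E]] := star_entry K kl; rewrite !E.
  have := aapp_proportional phi VU s t (res VW (chart_koszul p l)) (res VW (chart_koszul q l)) Vx.
  by rewrite spair_res // (aapp_res phi WU VU VW) regRE.
(* For [l = k] there is no information, as [star] vanishes on the diagonal. The missing entry is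
   defined so that [\sum_l M l x * x l = 0], the relation satisfied by [a]. *)
pose M l x := if l == k then - \sum_(r | r != k) f r x * (x r / x k) else f l x.
have rel x l m : pts W x -> l != k -> m != k -> f l x * a x m = f m x * a x l.
  move=> Wx lk mk; have kl : k != l by rewrite eq_sym.
  have km : k != m by rewrite eq_sym.
  have xk := chart_neq0 Wx.
  have [p [q E]] := star_entry K kl.
  have := prop W WU (@subset_refl _ _) (chart_koszul p l) (chart_koszul q l) m x km Wx.
  have -> : aapp phi WU (chart_koszul p l) (chart_koszul q l) x = f l x by rewrite /f E.
  have := spair_chart_koszul kl Wx; rewrite E => -> e {E}.
  have c0 : x k * (x k ^ (- d%:Z)) ^+ 2 != 0.
    by rewrite mulf_neq0 // expf_neq0 // expfz_neq0.
  apply: (mulfI c0); transitivity (x k * (x k ^ (- d%:Z)) ^+ 2 * a x m * f l x).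
    by ring.
  by rewrite e; ring.
have hM l : rg 0 W (M l).
  rewrite /M; case: eqP => _; last exact: hf.
  apply: rgN; apply: rg_sum => r _; apply: (rgM (j := 0) (k := 0)) => //.
  exact: ratio_subproof.
have relM x l m : pts W x -> M l x * (coef F m).@[x] = M m x * (coef F l).@[x].
  move=> Wx; rewrite -/(a x m) -/(a x l); have xk := chart_neq0 Wx.
  have ek : a x k = - \sum_(r | r != k) a x r * (x r / x k).
    have := dot_coef F (zopen_nz Wx); rewrite /dot (bigD1 k) //= => /eqP.
    rewrite addr_eq0 => /eqP e; apply: (mulIf xk); rewrite e mulNr mulr_suml.
    by congr (- _); apply: eq_bigr => r _; field.
  have aux m' : m' != k -> - (\sum_(r | r != k) f r x * (x r / x k)) * a x m' = f m' x * a x k.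
    move=> mk; rewrite ek mulNr mulrN mulr_suml mulr_sumr; congr (- _).
    by apply: eq_bigr => r rk; rewrite mulrAC (rel x r m') // -[LHS]mulrA.
  rewrite /M; case: (eqVneq l k) => [->|lk]; case: (eqVneq m k) => [->|mk] //.
  - exact: aux.
  - by rewrite aux.
  - exact: rel.
have [g [hg gE]] := rg_divide (@coef_homog K d F) (@coef_coprime K d F) hM relM.
exists (fun x => g x * x k ^ (d%:Z *+ 2 - 1)); split.
  by apply: rgM hg (rg_chart_pow _ Wk); rewrite intS mulr2n; ring.
move=> V VU VW s t x Vx.
have hgV : rg (d%:Z - 2) V (fun x => g x * x k ^ (d%:Z *+ 2 - 1)).
  by apply: rgM (rg_sub VW hg) (rg_chart_pow _ (sub_trans VW Wk)); rewrite intS mulr2n; ring.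
have hgs : rg 0 V (fun x => g x * x k ^ (d%:Z *+ 2 - 1) * spair s t x).
  by apply: rgM hgV (spair_rg s t); ring.
apply/eqP; rewrite -subr_eq0; apply/eqP.
apply: (tfield_dense (F := F) (rgB (rg_reg _) hgs)) Vx => {}x i r Vx xi ar.
have Wx := VW x Vx; have xk := chart_neq0 Wx.
have [l lk al] : exists2 l, k != l & a x l != 0.
  apply: contrapT => /forall2NP H.
  have al0 l : l != k -> a x l = 0.
    by move=> lk; have [|/negP] := H l; [rewrite eq_sym lk|rewrite negbK => /eqP].
  have [rk|rk] := eqVneq r k; last by move: ar; rewrite (al0 r rk) eqxx.
  have := dot_coef F (zopen_nz Wx); rewrite /dot (bigD1 k) //= big1 ?addr0.
    by move/eqP; rewrite mulf_eq0 (negbTE xk) orbF -rk (negbTE ar).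
  by move=> l /al0 ->; rewrite mul0r.
have c0 : x k * (x k ^ (- d%:Z)) ^+ 2 * a x l != 0.
  by rewrite !mulf_neq0 // expfz_neq0.
apply: (mulfI c0); rewrite mulr0 mulrBr (prop V VU VW) //.
have fl : f l x = a x l * g x.
  by have := gE x l Wx; rewrite /M eq_sym (negbTE lk).
have xd : x k ^ (d%:Z *+ 2 - 1) = (x k * (x k ^ (- d%:Z)) ^+ 2)^-1.
  rewrite mulr2n -addrA !expfzDr // -!invr_expz expr1z.
  by field; rewrite xk expfz_neq0.
by rewrite fl xd; field; rewrite expfz_neq0 // xk.
Qed.
End LocalFrame.

(** Koszul sections serve as tests: at a general point two of them have nonzero pairing. *)
Lemma alt2_factor_unique V (f g : vec K -> K) : rg (d%:Z - 2) V f -> rg (d%:Z - 2) V g ->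
  (forall W (WV : W `<=` V) (s t : T W) x, pts W x -> f x * spair s t x = g x * spair s t x) ->
  forall x, pts V x -> f x = g x.
Proof.
move=> hf hg h x Vx; apply/eqP; rewrite -subr_eq0; apply/eqP.
apply: (tfield_dense (F := F) (rgB hf hg)) Vx => {}x i r Vx xi ar.
have [k xk kr] := chart_off_diag (zopen_nz Vx) ar.
pose W := zcap V (chart K k); have WV : W `<=` V := @zcapl K _ _.
have Wk : W `<=` chart K k := @zcapr K _ _.
have Wx : pts W x by split=> //; apply/chartE.
have [p [q E]] := star_entry K kr.
have := h W WV (chart_koszul Wk p r) (chart_koszul Wk q r) x Wx.
have := spair_chart_koszul Wk kr Wx; rewrite E => ->.
have c0 : x k * (x k ^ (- d%:Z)) ^+ 2 * a x r != 0.
  by rewrite !mulf_neq0 // expfz_neq0.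
by move/(mulIf c0) => ->; rewrite subrr.
Qed.

Lemma alt2_section U (phi : Alt2 T U) :
  exists g, rg (d%:Z - 2) U g /\ forall V (VU : V `<=` U) (s t : T V) x,
    pts V x -> aapp phi VU s t x = g x * spair s t x.
Proof.
pose P V (g : vec K -> K) := [/\ V `<=` U, rg (d%:Z - 2) V g &
  forall W (WU : W `<=` U) (WV : W `<=` V) (s t : T W) x, pts W x ->
    aapp phi WU s t x = g x * spair s t x].
have [||g [hg gP]] := @rg_glue K (d%:Z - 2) U P.
- move=> x Ux; have [W [WU [k [Wx Wk]]]] := chart_cover Ux.
  have [g [hg gE]] := alt2_local Wk WU phi; exists W, g; split=> //; split=> //.
- move=> V W f g x [VU hf fE] [WU hg gE] Vx Wx.
  have hf' := rg_sub (@zcapl K V W) hf; have hg' := rg_sub (@zcapr K V W) hg.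
  apply: (alt2_factor_unique hf' hg' _ (conj Vx Wx)) => S SV s t y Sy.
  have SU := sub_trans SV (sub_trans (@zcapl K V W) VU).
  rewrite -(fE S SU (sub_trans SV (@zcapl K V W))) //.
  by rewrite -(gE S SU (sub_trans SV (@zcapr K V W))).
exists g; split=> // V VU s t x Vx.
have [W [g' [Wx WU [_ _ hg'] gg']]] := gP x (VU x Vx).
pose S := zcap V W; have SV : S `<=` V := @zcapl K _ _; have SW : S `<=` W := @zcapr K _ _.
have Sx : pts S x by []; have SU := sub_trans SV VU.
have := hg' S SU SW (res SV s) (res SV t) x Sx.
by rewrite (aapp_res phi VU SU SV) regRE // spair_res // gg'.
Qed.
End AlternatingForms.

(** A prime factor of [p] would have zeros, so [p] is constant. *)
Lemma nowhere_zero_degree (K : closedFieldType) (p : {mpoly K[4]}) (m : nat) :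
  p \is m.-homog -> (forall x, nz x -> p.@[x] != 0) -> m = 0%N.
Proof.
move=> hp pnz; have p0 : p != 0.
  have /pnz : nz (fun=> 1 : K) by exists ord0; rewrite oner_neq0.
  by apply: contraNneq => ->; rewrite meval0.
have pU : p \is a GRing.unit.
  apply: contrapT => /negP nU.
  have [g gP [b eb]] := prime_factor (@factorial_mpoly K 4) p0 nU.
  have [j gj] : exists j, g \is j.-homog.
    by apply: (@homog_factor _ _ g b m); rewrite mulrC -eb.
  have [_ [x [nzx gx]] _] := zirreducible_zero_locus gP gj.
  by have := pnz x nzx; rewrite eb mevalM gx mulr0 eqxx.
have ec : p = (p@_0)%:MP by case/andP: pU => /eqP.
apply: (dhomog_uniq p0 hp); rewrite ec -[_%:MP]mulr1 mul_mpolyC.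
by apply: rpredZ; apply: dhomog1.
Qed.

Lemma nowhere_zero_section (K : closedFieldType) e (f : vec K -> K) :
  rg e (PP K) f -> (forall x, nz x -> f x != 0) -> e = 0.
Proof.
move=> hf f0; have [p [fE]] := global_section hf.
have pnz x : nz x -> p.@[x] != 0 by move=> nzx; rewrite -fE // f0.
case=> [p0|[m em hp]]; last by rewrite em (nowhere_zero_degree hp pnz).
have /pnz : nz (fun=> 1 : K) by exists ord0; rewrite oner_neq0.
by rewrite p0 meval0 eqxx.
Qed.

(** * The determinant sheaf *)

Section DeterminantSheaf.
Variables (K : closedFieldType) (d : nat) (F : distribution K d).
Implicit Types (U V W : zopen K) (x y : vec K).
Local Notation T := (tangent F).
Local Notation D := (d%:Z - 2).

Lemma alt2_ext U (phi psi : Alt2 T U) :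
  (forall V (VU : V `<=` U) (s t : T V) x, pts V x ->
     aapp phi VU s t x = aapp psi VU s t x) -> phi = psi.
Proof.
move=> h; apply: subsec_inj; apply: famP => V VU [s t]; apply: reg_eqP => x Vx.
exact: h.
Qed.

Section AltOf.
Variables (U : zopen K) (g : vec K -> K) (hg : rg D U g).

Fact alt_of_rg V (VU : V `<=` U) (s t : T V) : rg 0 V (fun x => g x * spair s t x).
Proof. by apply: rgM (rg_sub VU hg) (spair_rg s t); ring. Qed.

Definition alt_fam : fam (fun V => (T V * T V)%type) (Osh K 0) U :=
  fun V VU st => mkreg (alt_of_rg VU st.1 st.2).

Fact alt_fam_alt2 : is_alt2 (alt_fam : Fam (fun V => (T V * T V)%type) (Osh K 0) U).
Proof.
have E V (VU : V `<=` U) (s t : T V) x : pts V x ->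
  (alt_fam VU (s, t) : OO V) x = g x * spair s t x by move=> Vx; rewrite mkregE.
have L V (b : OO V) (p q : OO V) x : (b *: p + q : OO V) x = b x * p x + q x by [].
split.
- move=> V VU b s t u; apply: reg_eqP => x Vx.
  by rewrite (L V b) !E // spair_lin //; ring.
- move=> V VU b s t u; apply: reg_eqP => x Vx.
  rewrite (L V b) !E // (spair_sym (b *: s + t) u Vx) (spair_sym s u Vx).
  by rewrite (spair_sym t u Vx) spair_lin //; ring.
- by move=> V VU s; apply: reg_eqP => x Vx; rewrite E // spair_diag // mulr0.
- move=> V W VU WU WV s t; apply: reg_eqP => x Wx.
  by rewrite [RHS]regRE // !E ?spair_res //; apply: WV.
Qed.

Definition alt_of : Alt2 T U := SubSec (is_alt2_closed T) alt_fam_alt2.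

Lemma aapp_alt_of V (VU : V `<=` U) (s t : T V) x : pts V x ->
  aapp alt_of VU s t x = g x * spair s t x.
Proof. by move=> Vx; rewrite /aapp /= indicE // mulr1. Qed.
End AltOf.

Definition alt_factor U (phi : Alt2 T U) : vec K -> K := projT1 (cid (alt2_section phi)).

Lemma alt_factor_rg U (phi : Alt2 T U) : rg D U (alt_factor phi).
Proof. by have [h _] := projT2 (cid (alt2_section phi)). Qed.

Lemma alt_factorE U (phi : Alt2 T U) V (VU : V `<=` U) (s t : T V) x : pts V x ->
  aapp phi VU s t x = alt_factor phi x * spair s t x.
Proof. by have [_ h] := projT2 (cid (alt2_section phi)); exact: h. Qed.

Lemma alt_factor_unique U (phi : Alt2 T U) g : rg D U g ->
  (forall V (VU : V `<=` U) (s t : T V) x, pts V x ->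
     aapp phi VU s t x = g x * spair s t x) ->
  forall x, pts U x -> alt_factor phi x = g x.
Proof.
move=> hg h; apply: (alt2_factor_unique (F := F) (alt_factor_rg phi) hg) => W WU s t x Wx.
by rewrite -(alt_factorE phi WU) // (h W WU).
Qed.

Lemma alt_factor_of U g (hg : rg D U g) x : pts U x -> alt_factor (alt_of hg) x = g x.
Proof. by apply: alt_factor_unique => // V VU s t y Vy; rewrite aapp_alt_of. Qed.

Lemma alt_factor_lin U (b : OO U) (phi psi : Alt2 T U) x : pts U x ->
  alt_factor (b *: phi + psi) x = b x * alt_factor phi x + alt_factor psi x.
Proof.
apply: (alt_factor_unique (g := fun x => b x * alt_factor phi x + alt_factor psi x)).
  apply: rgD (alt_factor_rg psi).
  by apply: rgM (rg_reg b) (alt_factor_rg phi); rewrite add0r.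
move=> V VU s t y Vy.
have -> : aapp (b *: phi + psi) VU s t y =
    (OOres VU b) y * aapp phi VU s t y + aapp psi VU s t y by [].
by rewrite regRE // !alt_factorE //; ring.
Qed.

Lemma alt_factor_res U V (VU : V `<=` U) (phi : Alt2 T U) x : pts V x ->
  alt_factor (res VU phi) x = alt_factor phi x.
Proof.
apply: (alt_factor_unique (rg_sub VU (alt_factor_rg phi))) => W WV s t y Wy.
rewrite -(alt_factorE phi (sub_trans WV VU)) //.
Qed.

Lemma alt_factor_inj U (phi psi : Alt2 T U) :
  (forall x, pts U x -> alt_factor phi x = alt_factor psi x) -> phi = psi.
Proof.
move=> h; apply: alt2_ext => V VU s t x Vx; rewrite !alt_factorE // h //; exact: VU.
Qed.

(** [alt_factor] and [alt_of] identify [Alt2 T] with [O(d - 2)], so [Psi] becomes a linear map from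
    [O(d - 2)] to [O]. *)
Lemma det_section U (Psi : det_sheaf T U) : exists f, rg (2 - d%:Z) U f /\
  forall V (VU : V `<=` U) (phi : Alt2 T V) x, pts V x ->
    (app Psi VU phi : OO V) x = f x * alt_factor phi x.
Proof.
have [||f [hf fE]] := @linear_section K D 0 U
  (fun V VU c => (app Psi VU (alt_of (rg_reg c)) : OO V)).
- move=> V VU c b.
  have -> : alt_of (rg_reg (c *: b)) = c *: alt_of (rg_reg b).
    apply: alt_factor_inj => x Vx; rewrite -[X in _ = alt_factor X x]addr0 alt_factor_lin //.
    rewrite !alt_factor_of //.
    have -> : alt_factor (0 : Alt2 T V) x = 0.
      apply: (alt_factor_unique (rg0 _ _)) => // W WV s t y Wy; by rewrite mul0r.
    by rewrite addr0.
  exact: (appZ Psi VU c (alt_of (rg_reg b))).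
- move=> V W VU WU WV b.
  have -> : alt_of (rg_reg (regR WV b)) = res WV (alt_of (rg_reg b)).
    apply: alt_factor_inj => x Wx; rewrite alt_factor_res // !alt_factor_of ?regRE //.
    exact: WV.
  exact: (app_res Psi VU WU WV (alt_of (rg_reg b))).
exists f; split=> [|V VU phi x Vx]; first by rewrite sub0r opprB in hf.
have := fE V VU (mkreg (alt_factor_rg phi)) x Vx; rewrite mkregE // => <-.
congr ((app Psi VU _ : OO V) x); apply: alt_factor_inj => y Vy.
by rewrite alt_factor_of // mkregE.
Qed.

Definition det_value U (Psi : det_sheaf T U) : vec K -> K := projT1 (cid (det_section Psi)).

Lemma det_value_rg U (Psi : det_sheaf T U) : rg (2 - d%:Z) U (det_value Psi).
Proof. by have [h _] := projT2 (cid (det_section Psi)). Qed.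

Lemma det_valueE U (Psi : det_sheaf T U) V (VU : V `<=` U) (phi : Alt2 T V) x : pts V x ->
  (app Psi VU phi : OO V) x = det_value Psi x * alt_factor phi x.
Proof. by have [_ h] := projT2 (cid (det_section Psi)); exact: h. Qed.

Lemma det_value_unique U (Psi : det_sheaf T U) f :
  (forall V (VU : V `<=` U) (phi : Alt2 T V) x, pts V x ->
     (app Psi VU phi : OO V) x = f x * alt_factor phi x) ->
  forall x, pts U x -> det_value Psi x = f x.
Proof.
move=> h x Ux; have [W [WU [k [Wx Wk]]]] := chart_cover Ux.
have xk : x k != 0 by apply/chartE/Wk.
pose phi := alt_of (rg_chart_pow D Wk).
have := det_valueE Psi WU phi Wx; rewrite h // alt_factor_of // => /esym.
by apply: mulIf; rewrite expfz_neq0.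
Qed.

Section DetOf.
Variables (U : zopen K) (f : vec K -> K) (hf : rg (2 - d%:Z) U f).

Fact det_of_rg V (VU : V `<=` U) (phi : Alt2 T V) : rg 0 V (fun x => f x * alt_factor phi x).
Proof. by apply: rgM (rg_sub VU hf) (alt_factor_rg phi); ring. Qed.

Fact det_of_hom : is_hom
  ((fun V VU phi => mkreg (det_of_rg VU phi)) : Fam (fun V => Alt2 T V) (Osh K 0) U).
Proof.
split.
  move=> V VU b phi psi; apply: reg_eqP => x Vx.
  rewrite -[RHS]/(b x * mkreg (det_of_rg VU phi) x + mkreg (det_of_rg VU psi) x).
  by rewrite !mkregE // alt_factor_lin //; ring.
move=> V W VU WU WV phi; apply: reg_eqP => x Wx.
by rewrite regRE // !mkregE ?alt_factor_res //; apply: WV.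
Qed.

Definition det_of : det_sheaf T U := mkhom det_of_hom.

Lemma det_value_of x : pts U x -> det_value det_of x = f x.
Proof. by apply: det_value_unique => V VU phi y Vy; rewrite mkregE. Qed.
End DetOf.

Lemma det_value_inj U (Phi Psi : det_sheaf T U) :
  (forall x, pts U x -> det_value Phi x = det_value Psi x) -> Phi = Psi.
Proof.
move=> h; apply: hom_ext => V VU phi; apply: reg_eqP => x Vx.
by rewrite !det_valueE // h //; apply: VU.
Qed.

Lemma det_value_lin U (b : OO U) (Phi Psi : det_sheaf T U) x : pts U x ->
  det_value (b *: Phi + Psi) x = b x * det_value Phi x + det_value Psi x.
Proof.
apply: (det_value_unique (f := fun x => b x * det_value Phi x + det_value Psi x)).
move=> V VU phi y Vy; rewrite app_linl.
rewrite -[LHS]/((OOres VU b) y * (app Phi VU phi : OO V) y + (app Psi VU phi : OO V) y).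
by rewrite regRE // !det_valueE //; ring.
Qed.

Lemma det_value_res U V (VU : V `<=` U) (Psi : det_sheaf T U) x : pts V x ->
  det_value (res VU Psi) x = det_value Psi x.
Proof.
apply: det_value_unique => W WV phi y Wy.
by rewrite (app_sub VU Psi WV (sub_trans WV VU)) det_valueE.
Qed.

Fact det_iso_hom : is_hom
  ((fun V (VU : V `<=` PP K) Psi => mkreg (det_value_rg Psi)) :
     Fam (fun V => det_sheaf T V) (Osh K (2 - d%:Z)) (PP K)).
Proof.
split.
  move=> V VU b phi psi; apply: reg_eqP => x Vx.
  rewrite -[RHS]/(b x * mkreg (det_value_rg phi) x + mkreg (det_value_rg psi) x).
  by rewrite !mkregE // det_value_lin.
move=> V W VU WU WV phi; apply: reg_eqP => x Wx.
by rewrite regRE // !mkregE ?det_value_res //; apply: WV.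
Qed.

Lemma det_iso : omod_iso (det_sheaf T) (Osh K (2 - d%:Z)).
Proof.
exists (mkhom det_iso_hom) => V VU.
exists (fun f : Osh K (2 - d%:Z) V => det_of (rg_reg (f : reg _ V))).
  move=> Psi; apply: det_value_inj => x Vx.
  by rewrite det_value_of // mkregE.
by move=> f; apply: reg_eqP => x Vx; rewrite mkregE // det_value_of.
Qed.

(** Preceded by [det_of], the isomorphism is multiplication by a section of [O(c - (2 - d))] without
    zeros, and such a section has degree 0. This matters because [c1] is a choice among all integers
    that fit. *)
Lemma det_iso_degree c : omod_iso (det_sheaf T) (Osh K c) -> c = 2 - d%:Z.
Proof.
move=> [theta bij]; pose psi V (f : reg (2 - d%:Z) V) : det_sheaf T V := det_of (rg_reg f).
have [||u [hu uE]] := @linear_section K (2 - d%:Z) c (PP K)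
  (fun V VU f => (app theta VU (psi V f) : reg c V)).
- move=> V VU b f; have -> : psi V (b *: f) = b *: psi V f.
    apply: det_value_inj => x Vx; rewrite -[b *: psi V f]addr0 det_value_lin //.
    rewrite !det_value_of //.
    have -> : det_value (0 : det_sheaf T V) x = 0.
      apply: (det_value_unique (f := fun=> 0)) => // W WV phi y Wy; by rewrite mul0r.
    by rewrite addr0.
  exact: (appZ theta VU b (psi V f)).
- move=> V W VU WU WV f; have -> : psi W (regR WV f) = res WV (psi V f).
    apply: det_value_inj => x Wx; rewrite det_value_res // !det_value_of ?regRE //.
    exact: WV.
  exact: (app_res theta VU WU WV (psi V f)).
suff : c - (2 - d%:Z) = 0 by move/eqP; rewrite subr_eq0 => /eqP.
apply: (nowhere_zero_section hu) => x nzx.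
have [W [WP [k [Wx Wk]]]] := chart_cover (nzx : pts (PP K) x).
have [inv _ invK] := bij W WP.
have e : psi W (mkreg (det_value_rg (inv (chart_gen c Wk)))) = inv (chart_gen c Wk).
  by apply: det_value_inj => y Wy; rewrite det_value_of // mkregE.
have := uE W WP (mkreg (det_value_rg (inv (chart_gen c Wk)))) x Wx.
rewrite e invK => h; have := chart_gen_neq0 c Wk Wx; rewrite h.
by rewrite mulf_eq0 negb_or => /andP[].
Qed.

Lemma c1_tangent : c1 T = 2 - d%:Z.
Proof. by apply: xget_unique; [exact: det_iso | exact: det_iso_degree]. Qed.
End DeterminantSheaf.

(** * Sections of twists and duals *)

Section TwistedSections.
Variables (K : closedFieldType) (d : nat) (F : distribution K d).
Implicit Types (U V W : zopen K) (x y : vec K).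
Implicit Types (m : vec K -> 'I_4 -> 'I_4 -> K).
Local Notation T := (tangent F).
Local Notation a := (coefv F).

Section Twist.
Variable n : int.

Section TwistOf.
Variables (U : zopen K) (m : vec K -> 'I_4 -> 'I_4 -> K).
Hypothesis hm : is_tfield F (n + 2) U m.

Fact twist_of_tfield V (VU : V `<=` U) (c : reg (- n) V) :
  is_tfield F 2 V (fun x i j => c x * m x i j).
Proof.
have -> : 2 = - n + (n + 2) by ring.
exact: tfield_scale (rg_reg c) (tfield_sub VU hm).
Qed.

Fact twist_of_hom :
  is_hom ((fun V VU (c : Osh K (- n) V) => tsec (twist_of_tfield VU c)) :
    Fam (fun V => Osh K (- n) V) T U).
Proof.
split.
  move=> V VU b c e; apply: tmat_inj => x i j Vx.
  rewrite tmat_lin // !tmat_tsec //.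
  by rewrite -[(b *: c + e : reg _ _) x]/(b x * c x + e x); ring.
move=> V W VU WU WV c; apply: tmat_inj => x i j Wx.
by rewrite tmat_res // !tmat_tsec ?regRE //; apply: WV.
Qed.

Definition twist_of : twist T n U := mkhom twist_of_hom.

Lemma tmat_twist_of V (VU : V `<=` U) c x i j : pts V x ->
  tmat (app twist_of VU c) x i j = c x * m x i j.
Proof. by move=> Vx; rewrite tmat_tsec. Qed.
End TwistOf.

(** Each matrix entry gives a linear map from [O(-n)] to [O(2)], hence multiplication by a function
    of degree [n + 2]. Tangency is seen on the generator of [O(-n)] over a chart. *)
Lemma twist_section U (psi : twist T n U) : exists m, is_tfield F (n + 2) U m /\
  forall V (VU : V `<=` U) (c : Osh K (- n) V) x i j, pts V x ->
    tmat (app psi VU c) x i j = (c : reg _ V) x * m x i j.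
Proof.
have hB V (s : T V) i j : rg 2 V (fun x => tmat s x i j).
  by have [h _] := tmat_tfield s; apply: h.
have /choice[f hf] : forall ij : 'I_4 * 'I_4, exists f : vec K -> K, rg (n + 2) U f /\
    forall V (VU : V `<=` U) (c : reg (- n) V) x, pts V x ->
    tmat (app psi VU (c : Osh K (- n) V)) x ij.1 ij.2 = f x * c x.
  move=> [i j]; have [||f [hf fE]] := @linear_section K (- n) 2 U
    (fun V VU c => mkreg (hB V (app psi VU (c : Osh K (- n) V)) i j)).
  - move=> V VU b c; apply: reg_eqP => x Vx; rewrite scale_regE !mkregE //.
    rewrite (appZ psi VU b (c : Osh K (- n) V)) -[b *: _]addr0 tmat_lin //.
    by rewrite [X in _ + X]/tmat mapp0 vmat0 // addr0.
  - move=> V W VU WU WV c; apply: reg_eqP => x Wx; rewrite regRE // !mkregE //.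
      by rewrite (app_res psi VU WU WV (c : Osh K (- n) V)) tmat_res.
    exact: WV.
  exists f; split=> [|V VU c x Vx]; first by rewrite opprK addrC in hf.
  by rewrite -fE // mkregE.
exists (fun x i j => f (i, j) x); split; last first.
  by move=> V VU c x i j Vx; rewrite (proj2 (hf (i, j)) V VU) // mulrC.
split=> [i j|x Ux]; first by case: (hf (i, j)).
have [W [WU [k [Wx Wk]]]] := chart_cover Ux.
have [v av mv] := proj2 (tmat_tfield (app psi WU (chart_gen (- n) Wk))) x Wx.
exists (fun i => x k ^ n * v i).
  transitivity (x k ^ n * dot (a x) v); last by rewrite av mulr0.
  by rewrite /dot mulr_sumr; apply: eq_bigr => i _; ring.
move=> i j; have := mv i j; rewrite (proj2 (hf (i, j)) W WU) // chart_genE // => e.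
have xk : x k != 0 by apply/chartE/Wk.
have -> : f (i, j) x = f (i, j) x * x k ^ (- n) * x k ^ n.
  by rewrite -mulrA -expfzDr // addNr expr0z mulr1.
by rewrite e /wedge; ring.
Qed.

Definition twmat U (psi : twist T n U) := projT1 (cid (twist_section psi)).

Lemma twmat_tfield U (psi : twist T n U) : is_tfield F (n + 2) U (twmat psi).
Proof. by have [h _] := projT2 (cid (twist_section psi)). Qed.

Lemma twmatE U (psi : twist T n U) V (VU : V `<=` U) (c : Osh K (- n) V) x i j :
  pts V x -> tmat (app psi VU c) x i j = (c : reg _ V) x * twmat psi x i j.
Proof. by have [_ h] := projT2 (cid (twist_section psi)); exact: h. Qed.

Lemma twmat_unique U (psi : twist T n U) m :
  (forall V (VU : V `<=` U) (c : Osh K (- n) V) x i j, pts V x ->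
    tmat (app psi VU c) x i j = (c : reg _ V) x * m x i j) ->
  forall x i j, pts U x -> twmat psi x i j = m x i j.
Proof.
move=> h x i j Ux; have [W [WU [k [Wx Wk]]]] := chart_cover Ux.
have := twmatE psi WU (chart_gen (- n) Wk) i j Wx; rewrite h // => e.
by apply: (mulfI (chart_gen_neq0 (- n) Wk Wx)); rewrite e.
Qed.

Lemma twmat_of U m (hm : is_tfield F (n + 2) U m) x i j : pts U x ->
  twmat (twist_of hm) x i j = m x i j.
Proof. by apply: twmat_unique => V VU c y r s Vy; rewrite tmat_twist_of. Qed.

Lemma twmat_lin U (b : OO U) (phi psi : twist T n U) x i j : pts U x ->
  twmat (b *: phi + psi) x i j = b x * twmat phi x i j + twmat psi x i j.
Proof.
apply: (twmat_unique (m := fun x i j => b x * twmat phi x i j + twmat psi x i j)).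
move=> V VU c y r s Vy.
by rewrite app_linl tmat_lin // !twmatE // regRE //; ring.
Qed.

Lemma twmat_res U V (VU : V `<=` U) (psi : twist T n U) x i j : pts V x ->
  twmat (res VU psi) x i j = twmat psi x i j.
Proof.
apply: twmat_unique => W WV c y r s Wy.
by rewrite (app_sub VU psi WV (sub_trans WV VU)) twmatE.
Qed.

Lemma twmat_inj U (phi psi : twist T n U) :
  (forall x i j, pts U x -> twmat phi x i j = twmat psi x i j) -> phi = psi.
Proof.
move=> h; apply: hom_ext => V VU c; apply: tmat_inj => x i j Vx.
by rewrite !twmatE // h //; apply: VU.
Qed.

Lemma twmat0 U x i j : pts U x -> twmat (0 : twist T n U) x i j = 0.
Proof.
apply: (twmat_unique (m := fun _ _ _ => 0)) => V VU c y r s Vy.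
by rewrite app_0l /tmat mapp0 vmat0 // mulr0.
Qed.
End Twist.

Definition has_tfield (e : int) := exists m, is_tfield F e (PP K) m /\
  exists x i j, nz x /\ m x i j != 0.

Lemma H0_twist (k : int) : H0_neq0 (twist T k) <-> has_tfield (k + 2).
Proof.
split=> [[psi psi0]|[m [hm [x [i [j [nzx mx]]]]]]].
  exists (twmat psi); split; first exact: twmat_tfield.
  apply: contrapT => H; apply: psi0; apply: twmat_inj => x i j nzx.
  rewrite twmat0 //; apply: contrapT => /eqP h; apply: H; by exists x, i, j.
exists (twist_of hm) => E; have := twmat_of hm i j (nzx : pts (PP K) x).
by rewrite E twmat0 // => e; rewrite -e eqxx in mx.
Qed.

Lemma pairing_koszul (k l p q : 'I_4) U x :
  (forall m : 'I_4 -> 'I_4 -> K, star m k l = m p q) -> k != l -> pts U x -> a x l != 0 ->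
  pairing F d.+2 d.+2 U (fun x => wedge x (koszul (a x) p l))
    (fun x => wedge x (koszul (a x) q l)) x = a x l * x k.
Proof.
move=> E kl Ux al; have ax := dot_coef F (zopen_nz Ux).
have := eta_koszul l kl ax; rewrite E.
rewrite (pairing_eta (koszul_tfield F U p l) (koszul_tfield F U q l) l Ux) // => e.
by apply: (mulfI al); rewrite e; ring.
Qed.

(** Nondegeneracy of the pairing. At a general point two Koszul fields have nonzero pairing, and the
    relation between them and [m] expresses [m] through its pairings with them. *)
Lemma pairing_koszul_eq0 e U m : is_tfield F e U m ->
  (forall x i l, pts U x ->
     pairing F e d.+2 U m (fun x => wedge x (koszul (a x) i l)) x = 0) ->
  forall x i j, pts U x -> m x i j = 0.
Proof.
move=> hm h x i j; apply: (tfield_dense (F := F) (proj1 hm i j)) => {}x r l Ux xr al.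
have [k xk kl] := chart_off_diag (zopen_nz Ux) al.
have [p [q E]] := star_entry K kl.
have := pairing_relation i j (koszul_tfield F U p l) (koszul_tfield F U q l) hm Ux.
rewrite (pairing_koszul E) // h // mul0r addr0.
rewrite (pairing_sym hm (koszul_tfield F U q l) Ux) h // oppr0 mul0r addr0 => /eqP.
by rewrite !mulf_eq0 (negbTE al) (negbTE xk) => /eqP.
Qed.

(** * Linear forms on a twist *)

Section Dual.
Variables n r : int.
Local Notation e := (d%:Z - n - r).

Section PairingForm.
Variable m : vec K -> 'I_4 -> 'I_4 -> K.
Hypothesis hm : is_tfield F e (PP K) m.

(** The degree [e] is chosen so that [r + e + (n + 2) - 1 - (d + 1) = 0]. The degree of [b] is
    written [- - r], as it arises from the twist by [- r]. *)
Fact pairing_form_rg V W (WV : W `<=` V) (b : reg (- - r) V) (psi : twist T n W) :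
  rg 0 W (fun x => b x * pairing F e (n + 2) W m (twmat psi) x).
Proof.
have hp := pairing_rg (tfield_sub (@subPP K W) hm) (twmat_tfield psi).
apply: rgM (rg_sub WV (rg_reg b)) hp; rewrite /pdeg intS; ring.
Qed.

Fact pairing_form_hom1 V (b : reg (- - r) V) :
  is_hom ((fun W WV psi => mkreg (pairing_form_rg WV b psi)) :
    Fam (fun W => twist T n W) (Osh K 0) V).
Proof.
split.
  move=> W WV c phi psi; apply: reg_eqP => x Wx.
  rewrite -[RHS]/(c x * mkreg (pairing_form_rg WV b phi) x
    + mkreg (pairing_form_rg WV b psi) x) !mkregE //.
  have hmW := tfield_sub (@subPP K W) hm.
  have P (psi' : twist T n W) := pairing_sym (twmat_tfield psi') hmW Wx.
  rewrite !P.
  rewrite (pairing_eq (s := fun x i j => c x * twmat phi x i j + twmat psi x i j)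
    (t := m) _ hmW) //.
  - by rewrite (pairing_linl (rg_reg c) (twmat_tfield _) (twmat_tfield _) hmW Wx); ring.
  - apply: tfield_add (twmat_tfield _).
    by have := tfield_scale (rg_reg c) (twmat_tfield phi); rewrite add0r.
  - by move=> y i j Wy; rewrite twmat_lin.
move=> W W' WV W'V W'W psi; apply: reg_eqP => x W'x.
rewrite regRE // !mkregE //; last exact: W'W.
congr (_ * _); have hmW := tfield_sub (@subPP K W) hm.
rewrite -(pairing_sub hmW (twmat_tfield psi) W'W W'x).
apply: (pairing_eq (tfield_sub (@subPP K W') hm) (tfield_sub W'W (twmat_tfield psi))) => //.
by move=> y i j W'y; rewrite twmat_res.
Qed.

Fact pairing_form_hom :
  is_hom ((fun V _ (b : Osh K (- - r) V) => mkhom (pairing_form_hom1 b)) :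
    Fam (fun V => Osh K (- - r) V) (dual (twist T n)) (PP K)).
Proof.
split.
  move=> V VU c b b'; apply: hom_ext => W WV psi; apply: reg_eqP => x Wx.
  rewrite app_linl.
  rewrite -[RHS]/((OOres WV c) x * mkreg (pairing_form_rg WV b psi) x
    + mkreg (pairing_form_rg WV b' psi) x) !mkregE // regRE //.
  by rewrite -[(c *: b + b' : reg _ _) x]/(c x * b x + b' x); ring.
move=> V V' VU V'U V'V b; apply: hom_ext => W WV' psi; apply: reg_eqP => x Wx.
rewrite (app_sub V'V _ WV' (sub_trans WV' V'V)) !app_mkhom !mkregE // regRE //.
exact: WV'.
Qed.

Definition pairing_form : twist (dual (twist T n)) (- r) (PP K) := mkhom pairing_form_hom.

(** By [pairing_koszul_eq0], a nonzero [m] has nonzero pairing with some Koszul field. A power of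
    the chart coordinate makes this field a section of the twist, where the form can be
    evaluated. *)
Lemma pairing_form_neq0 x i j : nz x -> m x i j != 0 -> pairing_form <> 0.
Proof.
move=> nzx mx E; case/negP: mx; apply/eqP.
apply: (pairing_koszul_eq0 hm) (nzx : pts (PP K) x) => y s l nzy.
have [W [WP [k [Wy Wk]]]] := chart_cover (nzy : pts (PP K) y).
have yk : y k != 0 by apply/chartE/Wk.
have hk : is_tfield F (n + 2) W (fun x i j => x k ^ (n - d%:Z) * wedge x (koszul (a x) s l) i j).
  have -> : n + 2 = (n - d%:Z) + d.+2%:Z by rewrite !intS; ring.
  exact: tfield_scale (rg_chart_pow _ Wk) (koszul_tfield F W s l).
pose psi := twist_of hk; pose b := chart_gen (- - r) Wk.
have := congr1 (fun phi : twist (dual (twist T n)) (- r) (PP K) =>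
  (app (app phi WP b) (@subset_refl _ W) psi : OO W) y) E.
rewrite [RHS]/= [LHS](mkregE (pairing_form_rg (@subset_refl _ W) b psi) Wy).
move=> /eqP; rewrite mulf_eq0 (negbTE (chart_gen_neq0 _ Wk Wy)) /= => /eqP.
have hmW := tfield_sub WP hm.
rewrite (pairing_eq (t := fun x i j => x k ^ (n - d%:Z) * wedge x (koszul (a x) s l) i j)
  hmW hk) //; last by move=> z u v Wz; rewrite twmat_of.
rewrite (pairing_sym hk hmW Wy).
have -> : n + 2 = (n - d%:Z) + d.+2%:Z by rewrite !intS; ring.
rewrite (pairing_scale (rg_chart_pow _ Wk) (koszul_tfield F W s l) hmW Wy).
move=> /eqP; rewrite oppr_eq0 mulf_eq0 expfz_eq0 (negbTE yk) andbF /= => /eqP h.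
rewrite (pairing_sym (koszul_tfield F (PP K) s l) hm) //.
by rewrite -(pairing_sub (koszul_tfield F (PP K) s l) hm WP Wy) h oppr0.
Qed.
End PairingForm.

Section FormToField.
Variable Phi : twist (dual (twist T n)) (- r) (PP K).

Definition fapp V (VP : V `<=` PP K) (b : reg (- - r) V) (psi : twist T n V) : OO V :=
  app (app Phi VP (b : Osh K (- - r) V)) (@subset_refl _ V) psi.

Lemma fapp_linr V (VP : V `<=` PP K) b (c : OO V) (phi psi : twist T n V) x :
  fapp VP b (c *: phi + psi) x = c x * fapp VP b phi x + fapp VP b psi x.
Proof.
exact: (congr1 (fun f : OO V => f x)
  (app_lin (app Phi VP (b : Osh K (- - r) V)) (@subset_refl _ V) c phi psi)).
Qed.

Lemma fapp_scalel V (VP : V `<=` PP K) (c : OO V) (b : reg (- - r) V) (psi : twist T n V) x :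
  pts V x -> fapp VP (c *: b) psi x = c x * fapp VP b psi x.
Proof.
move=> Vx; rewrite /fapp (appZ Phi VP c (b : Osh K (- - r) V)) -[c *: _]addr0 app_linl.
set s := app _ _ _; set z := app _ _ _.
have -> : z = 0 by [].
by rewrite -[LHS]/((OOres (@subset_refl _ V) c) x * (s : OO V) x + 0) regRE // addr0.
Qed.

Lemma fapp_res V W (VP : V `<=` PP K) (WP : W `<=` PP K) (WV : W `<=` V) b psi x : pts W x ->
  fapp WP (regR WV b) (res WV psi) x = fapp VP b psi x.
Proof.
move=> Wx; rewrite /fapp.
have -> : (regR WV b : Osh K (- - r) W) = res WV (b : Osh K (- - r) V) by [].
rewrite (app_res Phi VP WP WV (b : Osh K (- - r) V)).
rewrite (app_sub WV _ (@subset_refl _ W) WV).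
have := app_res (app Phi VP (b : Osh K (- - r) V)) (@subset_refl _ V) WV WV psi.
by move=> /(congr1 (fun f : OO W => f x)) ->; exact: regRE.
Qed.

Fact koszul_twist_tfield i l V (c : reg (n - d%:Z) V) : is_tfield F (n + 2) V
  (fun x s t => c x * wedge x (koszul (a x) i l) s t).
Proof.
have -> : n + 2 = (n - d%:Z) + d.+2%:Z by rewrite !intS; ring.
exact: tfield_scale (rg_reg c) (koszul_tfield F V i l).
Qed.
Definition koszul_twist i l V (c : reg (n - d%:Z) V) : twist T n V :=
  twist_of (koszul_twist_tfield i l c).

(** Evaluated on a Koszul field scaled by [c], [Phi] is bilinear in [b] and [c], so
    [bilinear_section] yields one function for all of them. *)
Lemma form_koszul_exists i l : exists f : vec K -> K, rg e (PP K) f /\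
  forall V (VP : V `<=` PP K) b c x, pts V x ->
    fapp VP b (koszul_twist i l c) x = f x * b x * c x.
Proof.
have [|||f [hf fE]] := @bilinear_section K (- - r) (n - d%:Z) 0 (PP K)
  (fun V VP b c => fapp VP b (koszul_twist i l c)).
- by move=> V VP c b b'; apply: reg_eqP => x Vx; rewrite scale_regE fapp_scalel.
- move=> V VP c b b'; apply: reg_eqP => x Vx; rewrite scale_regE.
  have -> : koszul_twist i l (c *: b') = c *: koszul_twist i l b' + 0.
    apply: twmat_inj => y s t Vy; rewrite twmat_lin // twmat0 // !twmat_of //.
    by rewrite scale_regE; ring.
  rewrite fapp_linr.
  have -> : fapp VP b 0 x = 0 by rewrite /fapp app0.
  by rewrite addr0.
- move=> V W VP WP WV b c; apply: reg_eqP => x Wx; rewrite regRE //.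
  rewrite -(fapp_res VP WP WV) //; congr (fapp _ _ _ _).
  apply: twmat_inj => y s t Wy; rewrite twmat_res // !twmat_of //; last exact: WV.
  by rewrite regRE.
exists f; split=> //; have -> : e = 0 - - - r - (n - d%:Z) by ring.
exact: hf.
Qed.

Definition form_koszul i l : vec K -> K := projT1 (cid (form_koszul_exists i l)).

Lemma form_koszul_rg i l : rg e (PP K) (form_koszul i l).
Proof. by have [h _] := projT2 (cid (form_koszul_exists i l)). Qed.

Lemma form_koszulE i l V (VP : V `<=` PP K) b c x : pts V x ->
  fapp VP b (koszul_twist i l c) x = form_koszul i l x * b x * c x.
Proof. by have [_ h] := projT2 (cid (form_koszul_exists i l)); exact: h. Qed.

Lemma fapp_koszul_sum V (VP : V `<=` PP K) b (s : seq (reg (n - d%:Z) V * 'I_4 * 'I_4)) psi x :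
  (forall y i j, pts V y -> twmat psi y i j =
     \sum_(z <- s) z.1.1 y * wedge y (koszul (a y) z.1.2 z.2) i j) -> pts V x ->
  fapp VP b psi x = b x * \sum_(z <- s) z.1.1 x * form_koszul z.1.2 z.2 x.
Proof.
move=> h Vx; elim: s psi h => [|[[c i] l] s IH] psi h.
  rewrite big_nil mulr0; have -> : psi = 0.
    by apply: twmat_inj => y i j Vy; rewrite h // big_nil twmat0.
  by rewrite /fapp app0.
pose psi' := psi - koszul_twist i l c.
have e1 : psi = (1 : OO V) *: koszul_twist i l c + psi' by rewrite scale1r addrC subrK.
have h' y u v : pts V y -> twmat psi' y u v =
    \sum_(z <- s) z.1.1 y * wedge y (koszul (a y) z.1.2 z.2) u v.
  move=> Vy; have := h y u v Vy; rewrite {1}e1 twmat_lin // big_cons /= twmat_of //.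
  by rewrite indicE // !mul1r => /addrI.
rewrite e1 fapp_linr (IH psi' h') form_koszulE // big_cons /= indicE // !mul1r; ring.
Qed.

(** By linearity of [Phi], its Koszul values inherit the relations between the Koszul fields:
    [fapp_koszul_sum] is applied to the zero section. *)
Lemma koszul_relation (s : seq ((vec K -> K) * 'I_4 * 'I_4)) V x :
  (forall z, List.In z s -> rg (n - d%:Z) V z.1.1) ->
  (forall y i j, pts V y ->
     \sum_(z <- s) z.1.1 y * wedge y (koszul (a y) z.1.2 z.2) i j = 0) -> pts V x ->
  \sum_(z <- s) z.1.1 x * form_koszul z.1.2 z.2 x = 0.
Proof.
move=> hs h Vx; have [W [WV [k [Wx Wk]]]] := chart_cover Vx.
have [s' es'] : exists s' : seq (reg (n - d%:Z) W * 'I_4 * 'I_4),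
    forall (G : vec K -> 'I_4 -> 'I_4 -> K) y, pts W y ->
    \sum_(z <- s') z.1.1 y * G y z.1.2 z.2 = \sum_(z <- s) z.1.1 y * G y z.1.2 z.2.
  elim: s hs {h} => [|[[c i] l] s IH] hs.
    by exists [::] => G y Wy; rewrite !big_nil.
  have [s' es'] := IH (fun z zs => hs z (or_intror zs)).
  have hc : rg (n - d%:Z) W c := rg_sub WV (hs _ (or_introl erefl)).
  exists ((mkreg hc, i, l) :: s') => G y Wy.
  by rewrite !big_cons es' //= indicE // mulr1.
have WP := sub_trans WV (@subPP K V).
have := @fapp_koszul_sum W WP (chart_gen _ Wk) s' 0 x _ Wx.
rewrite {1}/fapp app0 => E; have {}E := E _.
rewrite -(es' (fun y i l => form_koszul i l y)) //.
apply: (mulfI (chart_gen_neq0 (- - r) Wk Wx)); rewrite mulr0 -E //.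
move=> y i j Wy; rewrite twmat0 //.
rewrite (es' (fun y p q => wedge y (koszul (a y) p q) i j)) // h //; exact: WV.
Qed.

(** The relations to be used have coefficients of several degrees [c]; a power of a chart coordinate
    brings them to degree [n - d]. *)
Lemma koszul_relation_twist (c : int) (s : seq ((vec K -> K) * 'I_4 * 'I_4)) x :
  (forall z, List.In z s -> rg c (PP K) z.1.1) ->
  (forall y i j, nz y ->
     \sum_(z <- s) z.1.1 y * wedge y (koszul (a y) z.1.2 z.2) i j = 0) -> nz x ->
  \sum_(z <- s) z.1.1 x * form_koszul z.1.2 z.2 x = 0.
Proof.
move=> hs h nzx; have [W [WP [k [Wx Wk]]]] := chart_cover (nzx : pts (PP K) x).
have xk : x k != 0 by apply/chartE/Wk.
pose E := n - d%:Z - c.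
have e1 y (G : 'I_4 -> 'I_4 -> K) :
    \sum_(z <- [seq ((fun y => y k ^ E * z.1.1 y), z.1.2, z.2) | z <- s]) z.1.1 y * G z.1.2 z.2
    = y k ^ E * \sum_(z <- s) z.1.1 y * G z.1.2 z.2.
  by rewrite big_map mulr_sumr; apply: eq_bigr => z _; rewrite /= mulrA.
have := @koszul_relation [seq ((fun y => y k ^ E * z.1.1 y), z.1.2, z.2) | z <- s] W x _ _ Wx.
rewrite (e1 x (fun i l => form_koszul i l x)) => H; apply: (mulfI (x := x k ^ E)).
  by rewrite expfz_neq0.
rewrite mulr0; apply: H => [z /List.in_map_iff[z' [<- z's]]|y i j Wy].
  apply: (rgM (j := E) (k := c)); first by rewrite /E; ring.
    exact: rg_chart_pow.
  exact: rg_sub WP (hs _ z's).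
by rewrite (e1 y (fun p q => wedge y (koszul (a y) p q) i j)) h ?mulr0 //; exact: zopen_nz Wy.
Qed.

Lemma form_koszul_alternating x : nz x -> alternating (fun i l => form_koszul i l x).
Proof.
move=> nzx; split=> [i|i l].
  have := @koszul_relation_twist 0 [:: ((fun=> 1), i, i)] x _ _ nzx.
  rewrite big_seq1 mul1r; apply=> [z [<-|//]|y u v _]; first exact: rg_const.
  by rewrite big_seq1 /wedge /koszul /=; ring.
have := @koszul_relation_twist 0 [:: ((fun=> 1), i, l); ((fun=> 1), l, i)] x _ _ nzx.
rewrite big_cons big_seq1 !mul1r => H; apply/eqP; rewrite -addr_eq0; apply/eqP; apply: H.
  by move=> z [<-|[<-|//]]; exact: rg_const.
by move=> y u v _; rewrite big_cons big_seq1 /wedge /koszul /=; ring.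
Qed.

Lemma form_koszul_euler x l : nz x -> \sum_i x i * form_koszul i l x = 0.
Proof.
move=> nzx.
have := @koszul_relation_twist 1 [seq ((fun y : vec K => y i), i, l) | i <- index_enum 'I_4] x _ _ nzx.
rewrite big_map; apply=> [z /List.in_map_iff[i [<- _]]|y u v nzy]; first exact: rg_coord.
rewrite big_map /=.
transitivity (y u * (\sum_i y i * koszul (a y) i l v) - y v * (\sum_i y i * koszul (a y) i l u)).
  by rewrite /wedge !mulr_sumr -sumrB; apply: eq_bigr => i _; ring.
by rewrite !sum_koszul dot_coef // !mul0r !subr0; ring.
Qed.

Lemma form_koszul_cyclic x i l t : nz x ->
  a x t * form_koszul i l x + a x i * form_koszul l t x + a x l * form_koszul t i x = 0.
Proof.
move=> nzx.
have := @koszul_relation_twist d.+1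
  [:: (a^~ t, i, l); (a^~ i, l, t); (a^~ l, t, i)] x _ _ nzx.
rewrite !big_cons big_nil addr0 addrA; apply.
  by move=> z [<-|[<-|[<-|//]]]; apply/rg_poly/coef_homog.
move=> y u v _; rewrite !big_cons big_nil addr0 addrA /=.
transitivity (y u * (a y t * koszul (a y) i l v + a y i * koszul (a y) l t v + a y l * koszul (a y) t i v)
  - y v * (a y t * koszul (a y) i l u + a y i * koszul (a y) l t u + a y l * koszul (a y) t i u)).
  by rewrite /wedge; ring.
by rewrite !koszul_cyclic !mulr0 subrr.
Qed.

(** The Koszul values form an alternating matrix whose contraction with [x] and exterior product
    with [a] vanish. Its dual is thus some [x /\ v] with [dot (a x) v = 0], by [star_cyclic] and
    [star_annihilated]. *)
Definition form_field x : 'I_4 -> 'I_4 -> K := star (fun i l => form_koszul i l x).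

Lemma form_field_tfield : is_tfield F e (PP K) form_field.
Proof.
split=> [i j|x nzx]; first by apply: rg_star => u v; exact: form_koszul_rg.
have [k xk] := nzx; have alt := form_koszul_alternating nzx.
exists (fun i => form_field x k i / x k).
  transitivity ((\sum_j a x j * form_field x k j) / x k).
    by rewrite /dot mulr_suml; apply: eq_bigr => i _; ring.
  rewrite /form_field star_annihilated ?mul0r // => i j t.
  exact: form_koszul_cyclic.
move=> i j; apply: (mulfI xk).
have h l : \sum_i x i * form_koszul i l x = 0 by exact: form_koszul_euler.
by rewrite /form_field (star_cyclic i j k alt h) /wedge; field.
Qed.

(** If all Koszul values vanish, [Phi] vanishes on the multiple of [psi] by [x_i a_l], a combination
    of Koszul fields by [koszul_combination], and by density on [psi] itself. *)
Lemma form_field_neq0 : Phi <> 0 -> exists x i j, nz x /\ form_field x i j != 0.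
Proof.
move=> Phi0; apply: contrapT => H; apply: Phi0.
have l0 x i j : nz x -> form_koszul i j x = 0.
  move=> nzx; rewrite -(star_star i j (form_koszul_alternating nzx)).
  rewrite -[RHS](_ : star (fun _ _ => 0) i j = 0); last first.
    by move: i j; do 2!apply: ord4_ind.
  apply: eq_star => u v; apply: contrapT => /eqP h.
  by apply: H; exists x, u, v.
apply: hom_ext => V VP b; apply: hom_ext => W WV psi; apply: reg_eqP.
apply: (tfield_dense (F := F) (rg_reg _)) => x i l Wx xi al.
pose S := zcap W (chart K i); have SW : S `<=` W := @zcapl K _ _.
have Si : S `<=` chart K i := @zcapr K _ _; have Sx : pts S x by split=> //; apply/chartE.
have WP := sub_trans WV VP; have SP := sub_trans SW WP.
have -> : app (app Phi VP b) WV psi = fapp WP (regR WV (b : reg _ V)) psi.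
  rewrite /fapp.
  have -> : (regR WV (b : reg _ V) : Osh K (- - r) W) = res WV b by [].
  by rewrite (app_res Phi VP WP WV b) (app_sub WV _ (@subset_refl _ W) WV).
rewrite -(fapp_res WP SP SW _ _ Sx); set b' := regR SW _; set psi' := res SW psi.
have [hM1 hM2] := twmat_tfield psi'.
(* The factor [x_i a_l] is scaled to degree 0, so that sections may be multiplied by it. *)
have hc : rg 0 S (fun y => y i * a y l * y i ^ (- d.+2%:Z)).
  apply: (rgM (j := 1 + d.+1%:Z) (k := - d.+2%:Z)); first by rewrite !intS; ring.
    by apply: rgM erefl (rg_coord S i) (rg_poly S (coef_homog F l)).
  exact: rg_chart_pow.
have hs t : rg (n - d%:Z) S (fun y => y i ^ (- d.+2%:Z) * twmat psi' y i t).
  apply: (rgM (j := - d.+2%:Z) (k := n + 2)); first by rewrite !intS; ring.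
    exact: rg_chart_pow.
  exact: hM1.
have := @fapp_koszul_sum S SP b' [seq (mkreg (hs t), t, l) | t <- index_enum 'I_4]
  ((mkreg hc : OO S) *: psi' + 0) x _ Sx.
have z0 : fapp SP b' 0 x = 0 by rewrite /fapp app0.
rewrite fapp_linr mkregE // z0 !addr0 => E.
have {}E := E _; apply: (mulfI (x := x i * a x l * x i ^ (- d.+2%:Z))).
  by rewrite !mulf_neq0 // expfz_neq0.
rewrite mulr0 E.
  rewrite big1 ?mulr0 // => z _; rewrite l0 ?mulr0 //; exact: zopen_nz Sx.
move=> y u v Sy; rewrite -[_ *: _]addr0 twmat_lin // twmat0 // addr0 mkregE // big_map.
have [w aw mw] := hM2 y Sy; have ay := dot_coef F (zopen_nz Sy).
transitivity (y i ^ (- d.+2%:Z) * \sum_t wedge y w i t * wedge y (koszul (a y) t l) u v).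
  by rewrite koszul_combination // mw; ring.
by rewrite mulr_sumr; apply: eq_bigr => t _; rewrite mkregE // mw; ring.
Qed.
End FormToField.

(** The pairing identifies the dual of [T(n)] with [T(d - 2 - n)]; twisting by [- r] and adding 2
    for the matrix gives the degree [d - n - r]. *)
Lemma H0_twist_dual_twist :
  H0_neq0 (twist (dual (twist T n)) (- r)) <-> has_tfield e.
Proof.
split=> [[Phi Phi0]|[m [hm [x [i [j [nzx mx]]]]]]].
  by exists (form_field Phi); split; [exact: form_field_tfield|exact: form_field_neq0].
by exists (pairing_form hm); apply: pairing_form_neq0 nzx mx.
Qed.
End Dual.
End TwistedSections.

(** * Splitting *)

Section KoszulPolynomials.
Variable K : closedFieldType.
Implicit Types (f g h r : {mpoly K[4]}) (x y : vec K) (p q i j : 'I_4).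

(** Monomials are sorted by whether they contain [X_i] or [X_j]. That [r] is free of both is
    expressed through its values, the form in which it is used. With [i = j] this is division by one
    variable. *)
Lemma remainder_mod_vars i j f : exists g h r, f = 'X_i * g + 'X_j * h + r /\
  forall x y, (forall k, k != i -> k != j -> x k = y k) -> r.@[x] = r.@[y].
Proof.
elim/mpolyind: f => [|c m f _ _ [g [h [r [-> hr]]]]].
  by exists 0, 0, 0; split=> [|x y _]; rewrite ?meval0 //; ring.
have X k : m k != 0%N -> exists m', 'X_[m] = 'X_k * 'X_[m'] :> {mpoly K[4]}.
  move=> mk; exists (m - U_(k))%MM; rewrite -mpolyXD addmC submK //.
  by rewrite lep1mP.
have [mi|/X[m' ->]] := eqVneq (m i) 0%N; last first.
  by exists (c *: 'X_[m'] + g), h, r; split=> //; rewrite -mul_mpolyC -mul_mpolyC; ring.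
have [mj|/X[m' ->]] := eqVneq (m j) 0%N; last first.
  by exists g, (c *: 'X_[m'] + h), r; split=> //; rewrite -mul_mpolyC -mul_mpolyC; ring.
exists g, h, (c *: 'X_[m] + r); split; first by ring.
move=> x y xy; rewrite !mevalD !mevalZ !mevalX (hr x y xy); congr (_ * _ + _).
apply: eq_bigr => k _; have [->|ki] := eqVneq k i; first by rewrite mi !expr0.
have [->|kj] := eqVneq k j; first by rewrite mj !expr0.
by rewrite xy.
Qed.

(** Modulo [X_i] each factor has a representative free of that variable; if the product of the two
    representatives vanishes at [x_i = 0], it is zero. *)
Lemma prime_X i : prime_elt ('X_i : {mpoly K[4]}).
Proof.
have X0 := X_neq0 K i; split=> //.
  by apply/negP => /(meval_unit (fun=> 0)); rewrite mevalXU eqxx.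
move=> f g [h e].
have D (u : {mpoly K[4]}) : exists v w, u = 'X_i * v + w /\
    forall x y, (forall k, k != i -> x k = y k) -> w.@[x] = w.@[y].
  have [v [v' [w [-> hw]]]] := remainder_mod_vars i i u.
  by exists (v + v'), w; split=> [|x y xy]; [ring | apply: hw => k ki _; exact: xy].
have [f1 [f2 [ef hf]]] := D f; have [g1 [g2 [eg hg]]] := D g.
have : f2 * g2 = 0.
  apply: mpoly_eval_inj => x; rewrite mevalM meval0.
  pose y : vec K := fun k => if k == i then 0 else x k.
  have xy k : k != i -> x k = y k by rewrite /y => /negbTE ->.
  rewrite (hf x y xy) (hg x y xy).
  have yi : y i = 0 by rewrite /y eqxx.
  have := congr1 (meval y) e; rewrite ef eg !mevalM !mevalD !mevalM !mevalXU yi.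
  by rewrite !mul0r !add0r mulr0.
move=> /eqP; rewrite mulf_eq0 => /orP[/eqP h0|/eqP h0].
  by left; exists f1; rewrite ef h0; ring.
by right; exists g1; rewrite eg h0; ring.
Qed.

Lemma X_not_divides i j : i != j -> ~ divides ('X_i : {mpoly K[4]}) 'X_j.
Proof.
move=> ij [c /(congr1 (meval (fun k => (k == j)%:R)))].
by rewrite mevalM !mevalXU eqxx (negbTE ij) mulr0 => /eqP; rewrite oner_eq0.
Qed.

(** Modulo [X_i] and [X_j] the relation reads [X_k * r = 0], so [h] lies in the ideal of these two
    variables. Substituting, [X_i] divides the product of [X_j] and [g + X_k * a']; being prime, it
    divides the latter. *)
Lemma koszul_exact i j k f g h : i != j -> i != k -> j != k ->
  'X_i * f + 'X_j * g + 'X_k * h = 0 ->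
  exists a b c, [/\ f = 'X_j * c - 'X_k * b, g = 'X_k * a - 'X_i * c &
                    h = 'X_i * b - 'X_j * a].
Proof.
move=> ij ik jk e; have [b [a' [r [eh hr]]]] := remainder_mod_vars i j h.
have r0 : r = 0.
  suff : 'X_k * r = 0 by move/eqP; rewrite mulf_eq0 (negbTE (X_neq0 K k)) => /eqP.
  apply: mpoly_eval_inj => x; rewrite meval0 mevalM mevalXU.
  pose y : vec K := fun t => if (t == i) || (t == j) then 0 else x t.
  have -> : r.@[x] = r.@[y].
    by apply: hr => t ti tj; rewrite /y (negbTE ti) (negbTE tj).
  have yi : y i = 0 by rewrite /y eqxx.
  have yj : y j = 0 by rewrite /y eqxx orbT.
  have yk : y k = x k by rewrite /y eq_sym (negbTE ik) eq_sym (negbTE jk).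
  have := congr1 (meval y) e; rewrite eh !mevalD !mevalM !mevalD !mevalM !mevalXU.
  by rewrite yi yj yk meval0 !mul0r !add0r.
rewrite r0 addr0 in eh; have e2 : 'X_j * (g + 'X_k * a') = - (f + 'X_k * b) * 'X_i.
  by apply/eqP; rewrite -subr_eq0 -[X in _ == X]e eh; apply/eqP; ring.
have [_ _ P] := prime_X i.
have [|/(X_not_divides ij)//|[c ec]] := P 'X_j (g + 'X_k * a').
  by exists (- (f + 'X_k * b)).
exists (- a'), b, (- c); split.
- apply: (mulIf (X_neq0 K i)); apply/eqP; rewrite -subr_eq0; apply/eqP.
  transitivity (- (- (f + 'X_k * b) * 'X_i - 'X_j * (c * 'X_i))); first by ring.
  by rewrite -ec -e2 subrr oppr0.
- by apply/eqP; rewrite -subr_eq0; apply/eqP; rewrite -(subrr (g + 'X_k * a')) {2}ec; ring.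
- by rewrite eh; ring.
Qed.

Lemma grading_coef_homog f n : (grading f)`_n \is n.-homog.
Proof.
apply/dhomogP => m; rewrite mcoeff_msupp grading_coef.
by case: ifP => [/eqP//|_]; rewrite eqxx.
Qed.

Lemma gradingM f g : grading (f * g) = grading f * grading g.
Proof. exact: rmorphM. Qed.

Lemma gradingB f g : grading (f - g) = grading f - grading g.
Proof. exact: rmorphB. Qed.

Lemma grading_coefX i f n : (grading ('X_i * f))`_n.+1 = 'X_i * (grading f)`_n.
Proof.
rewrite gradingM (grading_homog (homogXU K i)) expr1 -mulrA coefCM.
by rewrite coefXM.
Qed.

(** Only the components of degree [n] of the multipliers contribute in degree [n.+1]. *)
Lemma koszul_exact_homog i j k f g h n : i != j -> i != k -> j != k ->
  f \is n.+1.-homog -> g \is n.+1.-homog -> h \is n.+1.-homog ->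
  'X_i * f + 'X_j * g + 'X_k * h = 0 ->
  exists a b c, [/\ a \is n.-homog, b \is n.-homog, c \is n.-homog &
    [/\ f = 'X_j * c - 'X_k * b, g = 'X_k * a - 'X_i * c & h = 'X_i * b - 'X_j * a]].
Proof.
move=> ij ik jk hf hg hh /(koszul_exact ij ik jk)[a [b [c [ef eg eh]]]].
have E u : u \is n.+1.-homog -> (grading u)`_n.+1 = u.
  by move/grading_homog ->; rewrite coefCM coefXn eqxx mulr1.
exists (grading a)`_n, (grading b)`_n, (grading c)`_n; split; try exact: grading_coef_homog.
by split; rewrite -!grading_coefX -coefB -gradingB -?ef -?eg -?eh E.
Qed.

Lemma eq_eta x x' v v' w w' l : (forall i, x i = x' i) -> (forall i, v i = v' i) ->
  (forall i, w i = w' i) -> @eta K x v w l = eta x' v' w' l.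
Proof.
move=> hx hv hw; apply: eq_bigr => i _; rewrite hw; congr (_ * _).
by apply: eq_star => s t; rewrite /wedge !hx !hv.
Qed.

(** The three Koszul multipliers, with signs depending on [p], become the entries of [C]. The [p]-th
    entry does not affect [eta] taken with the [p]-th basis vector and is set to 0. *)
Lemma koszul_exact_at p (f : 'I_4 -> {mpoly K[4]}) n :
  (forall i, f i \is n.+1.-homog) -> \sum_(i | i != p) 'X_i * f i = 0 ->
  exists C : 'I_4 -> {mpoly K[4]}, [/\ forall i, C i \is n.-homog, C p = 0 &
    forall x l, l != p ->
      (f l).@[x] = eta x (fun i => (i == p)%:R) (fun i => (C i).@[x]) l].
Proof.
move=> hf e.
pose vec4 (c0 c1 c2 c3 : {mpoly K[4]}) (i : 'I_4) : {mpoly K[4]} :=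
  match nat_of_ord i with 0 => c0 | 1 => c1 | 2 => c2 | _ => c3 end%N.
have e' : \sum_i (if i != p then 'X_i * f i else 0) = 0 by rewrite -big_mkcond.
have hV c0 c1 c2 c3 : c0 \is n.-homog -> c1 \is n.-homog -> c2 \is n.-homog ->
    c3 \is n.-homog -> forall i, vec4 c0 c1 c2 c3 i \is n.-homog.
  by move=> h0 h1 h2 h3; apply: (@ord4_ind (fun i => vec4 c0 c1 c2 c3 i \is n.-homog)).
have z : (0 : {mpoly K[4]}) \is n.-homog by rewrite rpred0.
have sum4' (G : 'I_4 -> {mpoly K[4]}) : \sum_i G i = G o0 + G o1 + G o2 + G o3.
  rewrite !big_ord_recl big_ord0 addr0 !addrA.
  by congr (G _ + G _ + G _ + G _); apply/val_inj.
rewrite sum4' in e'; move: p {e} e'; apply: ord4_ind => /=; rewrite ?addr0 ?add0r => e.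
- have [a [b [c [ha hb hc [ea eb ec]]]]] :=
    @koszul_exact_homog o1 o2 o3 _ _ _ n isT isT isT (hf o1) (hf o2) (hf o3) e.
  exists (vec4 0 (- a) (- b) (- c)); split=> //; first by apply: hV; rewrite ?rpredN.
  move=> x; apply: ord4_ind => //= _; rewrite ?ea ?eb ?ec mevalB !mevalM !mevalXU;
    rewrite /eta sum4 /wedge /star /vec4 /= ?mevalN meval0; ring.
- have [a [b [c [ha hb hc [ea eb ec]]]]] :=
    @koszul_exact_homog o0 o2 o3 _ _ _ n isT isT isT (hf o0) (hf o2) (hf o3) e.
  exists (vec4 (a) 0 (b) (c)); split=> //; first by apply: hV; rewrite ?rpredN.
  move=> x; apply: ord4_ind => //= _; rewrite ?ea ?eb ?ec mevalB !mevalM !mevalXU;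
    rewrite /eta sum4 /wedge /star /vec4 /= ?mevalN meval0; ring.
- have [a [b [c [ha hb hc [ea eb ec]]]]] :=
    @koszul_exact_homog o0 o1 o3 _ _ _ n isT isT isT (hf o0) (hf o1) (hf o3) e.
  exists (vec4 (- a) (- b) 0 (- c)); split=> //; first by apply: hV; rewrite ?rpredN.
  move=> x; apply: ord4_ind => //= _; rewrite ?ea ?eb ?ec mevalB !mevalM !mevalXU;
    rewrite /eta sum4 /wedge /star /vec4 /= ?mevalN meval0; ring.
- have [a [b [c [ha hb hc [ea eb ec]]]]] :=
    @koszul_exact_homog o0 o1 o2 _ _ _ n isT isT isT (hf o0) (hf o1) (hf o2) e.
  exists (vec4 (a) (b) (c) 0); split=> //; first by apply: hV; rewrite ?rpredN.
  move=> x; apply: ord4_ind => //= _; rewrite ?ea ?eb ?ec mevalB !mevalM !mevalXU;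
    rewrite /eta sum4 /wedge /star /vec4 /= ?mevalN meval0; ring.
Qed.
End KoszulPolynomials.

Section PointwiseSplitting.
Variable K : fieldType.
Implicit Types (x y v w a B : 'I_4 -> K).

Lemma dot_wedge a x v k : dot a (wedge x v k) = x k * dot a v - v k * dot a x.
Proof. by rewrite /dot /wedge !sum4; ring. Qed.

Lemma dot_eta_mid x v w : dot (eta x v w) v = 0.
Proof. by rewrite /eta /dot !sum4 /wedge /star /=; ring. Qed.

Lemma dot_eta_last x v w : dot (eta x v w) w = 0.
Proof. by rewrite /eta /dot !sum4 /wedge /star /=; ring. Qed.

Lemma eta_span x v w f g l : eta x v (fun i => f * v i + g * w i) l = g * eta x v w l.
Proof.
by rewrite /eta !sum4 /wedge; move: l; apply: ord4_ind; rewrite /star /=; ring.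
Qed.

(* Coordinates adapted to a vector [v] with [v p != 0]: [v] becomes the [p]-th
   basis vector, up to a factor. *)
Definition shear p v x i := (i != p)%:R * x i + x p / v p * v i.
Definition unshear p v y i := (i != p)%:R * (y i - y p / v p * v i) + (i == p)%:R * y p.

Lemma unshearK p v y : v p != 0 -> forall i, shear p v (unshear p v y) i = y i.
Proof.
move=> vp i; rewrite /shear /unshear eqxx mul0r add0r mul1r.
by have [->|ip] := eqVneq i p; rewrite /= ?mul0r ?mul1r ?addr0 ?add0r ?subrK // divfK.
Qed.

Lemma eta_unshear p v y B l : l != p -> v p != 0 -> B p = 0 ->
  eta y v (fun i => B i / v p) l = eta (unshear p v y) (fun i => (i == p)%:R) B l.
Proof.
move=> lp vp Bp; rewrite /eta !sum4 /wedge /unshear.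
move: p l lp vp Bp; do 2!apply: ord4_ind; rewrite //= => _ vp Bp;
  rewrite /star /= Bp; by field.
Qed.
End PointwiseSplitting.

Section PolynomialSubstitution.
Variable K : closedFieldType.
Implicit Types (U V W : zopen K) (x y : vec K) (p : {mpoly K[4]}).

Definition basis_vec (r : 'I_4) : vec K := fun k => (k == r)%:R.

Lemma nz_basis_vec r : nz (basis_vec r).
Proof. by exists r; rewrite /basis_vec eqxx oner_neq0. Qed.

Lemma meval_linear p x : p \is 1.-homog -> p.@[x] = \sum_r x r * p.@[basis_vec r].
Proof.
move=> /dhomogP hp; rewrite mevalE.
under [RHS]eq_bigr => r _ do rewrite mevalE mulr_sumr.
rewrite exchange_big /=; apply: eq_big_seq => m /hp /eqP.
rewrite mdeg_eq1 => /existsP[r /eqP ->].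
have E y : \prod_(i < 4) y i ^+ U_(r)%MM i = y r by rewrite -mevalX mevalXU.
rewrite E (bigD1 r) //= E big1 ?addr0; first by rewrite /basis_vec eqxx mulr1 mulrC.
by move=> j jr; rewrite E /basis_vec eq_sym (negbTE jr) !mulr0.
Qed.

Lemma rg_subst U p n (z : 'I_4 -> vec K -> K) : p \is n.-homog ->
  (forall i, rg 1 U (z i)) -> rg n U (fun x => p.@[z^~ x]).
Proof.
move=> /dhomogP hp hz.
have hprod (m : 'X_{1..4}) : rg (mdeg m) U (fun x => \prod_i z i x ^+ m i).
  rewrite mdegE; elim: index_enum => [|i r IH].
    by rewrite big_nil; apply: (rg_eq _ (rg_const U 1)) => x _; rewrite big_nil.
  rewrite big_cons PoszD; have := rg_exp (m i) (hz i); rewrite -[1 *+ m i]/((m i)%:R) natz => h.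
  by apply: (rg_eq _ (rgM erefl h IH)) => x _; rewrite big_cons.
have h m : rg (mdeg m) U (fun x => p@_m * \prod_i z i x ^+ m i).
  exact: rgM (esym (add0r _)) (rg_const U _) (hprod m).
apply: (rg_eq (f := fun x => \sum_(m <- msupp p) p@_m * \prod_i z i x ^+ m i)).
  by move=> x _; rewrite mevalE.
have {}h m : m \in msupp p -> rg n U (fun x => p@_m * \prod_i z i x ^+ m i).
  by move=> /hp e; rewrite -e; exact: h.
elim: (msupp p) h => [|m r IH] h.
  by apply: (rg_eq _ (rg0 _ _)) => x _; rewrite big_nil.
have IH' := IH (fun m' hm' => h m' (mem_behead (s := m :: r) hm')).
by apply: (rg_eq _ (rgD (h m (mem_head m r)) IH')) => x _; rewrite big_cons.
Qed.

Lemma global_section_homog n (f : vec K -> K) : rg n%:Z (PP K) f ->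
  exists2 p, p \is n.-homog & forall x, nz x -> f x = p.@[x].
Proof.
move=> /global_section[p [fE hp]]; exists p => //.
by case: hp => [->|[m [->]]//]; rewrite rpred0.
Qed.
End PolynomialSubstitution.

(** * Constant vectors annihilated by the 1-form *)

Section DegreeOneField.
Variables (K : closedFieldType) (d : nat) (F : distribution K d).
Implicit Types (U V W : zopen K) (x y v : vec K) (m : vec K -> 'I_4 -> 'I_4 -> K).
Local Notation T := (tangent F).
Local Notation a := (coefv F).

(** The entries are linear in [x], so [m] is known from its values [e_r /\ v_r] at the basis
    vectors. Decomposability at sums of two basis vectors forces the [v_r] to agree, up to multiples
    of [e_r]. *)
Lemma linear_field m : is_tfield F 1 (PP K) m ->
  exists v, (forall x i j, nz x -> m x i j = wedge x v i j) /\ forall x, nz x -> dot (a x) v = 0.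
Proof.
move=> [m1 m2].
have lin x i j : nz x -> m x i j = \sum_r x r * m (basis_vec K r) i j.
  have [p hp pE] := global_section_homog (n := 1) (m1 i j) => nzx.
  rewrite pE // (meval_linear x hp); apply: eq_bigr => r _.
  by rewrite pE //; exact: nz_basis_vec.
have W x : nz x -> exists v, forall i j, m x i j = wedge x v i j.
  by move=> /m2[v _ h]; exists v.
have alt x i j : nz x -> m x i j = - m x j i.
  by move=> /W[v h]; rewrite !h /wedge; ring.
have diag x i : nz x -> m x i i = 0 by move=> /W[v h]; rewrite h /wedge; ring.
have off r i j : r != i -> r != j -> m (basis_vec K r) i j = 0.
  move=> ri rj; have [v ->] := W _ (nz_basis_vec K r).
  by rewrite /wedge /basis_vec eq_sym (negbTE ri) eq_sym (negbTE rj) !mul0r subrr.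
(* [w j] is merely an index other than [j]: the entry [v j] cannot be read off at the basis vector
   [e_j]. *)
pose w i := if i == o0 then o1 else o0.
have wi i : w i != i by rewrite /w; case: (eqVneq i o0) => [->|]; rewrite // eq_sym.
pose v j := m (basis_vec K (w j)) (w j) j.
have vE i j : i != j -> m (basis_vec K i) i j = v j.
  move=> ij; have [->//|ik] := eqVneq i (w j); set k := w j in ik *; have kj : k != j := wi j.
  (* At [e_i + e_k] the cyclic identity compares the candidates for [v j] found at [e_i] and at
     [e_k]. *)
  pose x : vec K := fun r => ((r == i) || (r == k))%:R.
  have xi : x i = 1 by rewrite /x eqxx.
  have xk : x k = 1 by rewrite /x eqxx orbT.
  have xr r : r != i -> r != k -> x r = 0 by rewrite /x => /negbTE-> /negbTE->.
  have nzx : nz x by exists i; rewrite xi oner_neq0.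
  have xE s t : m x s t = m (basis_vec K i) s t + m (basis_vec K k) s t.
    rewrite lin // (bigD1 i) //= (bigD1 k) /=; last by rewrite eq_sym.
    rewrite xi xk !mul1r big1 ?addr0 // => r /andP[ri rk]; by rewrite xr ?mul0r.
  have [u h] := W x nzx; have := wedge_cyclic x u i j k.
  rewrite -!h !xE xi xk xr ?mul1r ?mul0r ?subr0; [|by rewrite eq_sym|by rewrite eq_sym].
  by rewrite (off k i j) ?(off i k j) // ?addr0 ?add0r // eq_sym.
have mE x i j : nz x -> m x i j = wedge x v i j.
  move=> nzx; have [->|ij] := eqVneq i j; first by rewrite diag // /wedge; ring.
  rewrite lin // (bigD1 i) //= (bigD1 j) /=; last by rewrite eq_sym.
  rewrite big1 ?addr0 => [|r /andP[ri rj]]; last by rewrite off ?mulr0.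
  rewrite vE // [m _ i j]alt ?vE /wedge; [by ring|by rewrite eq_sym|exact: nz_basis_vec].
exists v; split=> // x nzx; have [k xk] := nzx.
have [u au h] := m2 x nzx; apply: (mulfI xk); rewrite mulr0.
have := dot_wedge (a x) x v k; rewrite dot_coef // mulr0 subr0 => <-.
transitivity (dot (a x) (wedge x u k)).
  by apply: eq_bigr => i _; rewrite -h mE.
by rewrite dot_wedge dot_coef // au !mulr0 subrr.
Qed.

Lemma rg_shear_coord U p v i : rg 1 U (fun x => shear p v x i).
Proof.
apply: rgD; first exact: rgM (esym (add0r _)) (rg_const U _) (rg_coord U i).
apply: (rgM (j := 1) (k := 0)) (rg_const U _); first by rewrite addr0.
by apply: (rgM (j := 1) (k := 0)) (rg_coord U p) (rg_const U _); rewrite addr0.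
Qed.

Lemma rg_unshear_coord U p v i : rg 1 U (fun x => unshear p v x i).
Proof.
have h : rg 1 U (fun x => x p / v p * v i).
  apply: (rgM (j := 1) (k := 0)) (rg_const U _); first by rewrite addr0.
  by apply: (rgM (j := 1) (k := 0)) (rg_coord U p) (rg_const U _); rewrite addr0.
apply: rgD; first exact: rgM (esym (add0r _)) (rg_const U _) (rgB (rg_coord U i) h).
exact: rgM (esym (add0r _)) (rg_const U _) (rg_coord U p).
Qed.

Lemma coef_eta v : (exists p, v p != 0) -> (forall x, nz x -> dot (a x) v = 0) ->
  exists B : vec K -> vec K, (forall i, rg d (PP K) (fun x => B x i)) /\
    forall x l, nz x -> eta x v (B x) l = a x l.
Proof.
move=> [p vp] av.
have shear_nz x : nz x -> nz (shear p v x).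
  move=> [i xi]; have [xp|xp] := eqVneq (x p) 0.
    exists i; rewrite /shear xp !mul0r addr0.
    by have [ip|_] := eqVneq i p; [rewrite ip xp eqxx in xi|rewrite mul1r].
  by exists p; rewrite /shear eqxx mul0r add0r divfK.
have unshear_nz y : nz y -> nz (unshear p v y).
  move=> [i yi]; apply: contrapT => nzx.
  have x0 j : unshear p v y j = 0.
    by apply: contrapT => /eqP xj; apply: nzx; exists j.
  move: yi; rewrite -(unshearK y vp i) /shear !x0; by rewrite !mul0r mulr0 addr0 eqxx.
(* [f] is [a] in coordinates adapted to [v]. There the relation [dot a x = 0] involves only indices
   other than [p], since the remaining term is a multiple of [dot a v]. *)
have /choice[f hf] : forall i, exists f : {mpoly K[4]}, f \is d.+1.-homog /\
    forall x, nz x -> a (shear p v x) i = f.@[x].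
  move=> i; have h := rg_subst (coef_homog F i) (fun i => rg_shear_coord (PP K) p v i).
  by have [f hf fE] := global_section_homog h; exists f.
have [||C [hC Cp CE]] := @koszul_exact_at K p f d; first by move=> i; case: (hf i).
  apply: mpoly_eval_inj => x; rewrite meval0 raddf_sum /=.
  have [nzx|nzx] := pselect (nz x); last first.
    rewrite big1 // => i _; rewrite mevalM mevalXU.
    suff -> : x i = 0 by rewrite mul0r.
    by apply: contrapT => /eqP xi; apply: nzx; exists i.
  have := dot_coef F (shear_nz x nzx).
  have -> : dot (a (shear p v x)) (shear p v x) =
      \sum_(i | i != p) a (shear p v x) i * x i + x p / v p * dot (a (shear p v x)) v.
    rewrite big_mkcond /dot mulr_sumr -big_split; apply: eq_bigr => i _ /=.
    by rewrite {2}/shear; case: ifP => _ /=; ring.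
  rewrite av; last exact: shear_nz.
  rewrite mulr0 addr0 => E; rewrite -[RHS]E; apply: eq_bigr => i _.
  by rewrite mevalM mevalXU (proj2 (hf i)) // mulrC.
pose B x i := (C i).@[unshear p v x] / v p.
exists B; split=> [i|y l nzy].
  apply: (rgM (j := d%:Z) (k := 0)) (rg_const _ _); first by rewrite addr0.
  exact: rg_subst (hC i) (fun i => rg_unshear_coord _ p v i).
have off r : r != p -> eta y v (B y) r = a y r.
  move=> rp; rewrite /B (@eta_unshear _ p v y (fun i => (C i).@[unshear p v y])) //; last first.
    by rewrite Cp meval0.
  rewrite -CE // -(proj2 (hf r)); last exact: unshear_nz.
  by congr (a _ r); apply: functional_extensionality_dep => i; rewrite unshearK.
(* The entry [p] follows from the others, since [a] and [eta] both annihilate [v] and [v p != 0]. *)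
have [->|] := eqVneq l p; last exact: off.
have := dot_eta_mid y v (B y); rewrite -(av y nzy) /dot (bigD1 p) //= [in RHS](bigD1 p) //=.
rewrite (eq_bigr (fun i => a y i * v i)); last by move=> i ip; rewrite off.
by move=> /addIr /(mulIf vp).
Qed.
End DegreeOneField.

Section Splitting.
Variables (K : closedFieldType) (d : nat) (F : distribution K d).
Implicit Types (U V W : zopen K) (x y : vec K).
Local Notation T := (tangent F).
Local Notation a := (coefv F).

Section SplitBasis.
Variables (e e' : int) (v B : vec K -> vec K).
Hypotheses (hv : is_tfield F e (PP K) (fun x => wedge x (v x)))
  (hB : is_tfield F e' (PP K) (fun x => wedge x (B x)))
  (hvB : forall x l, nz x -> eta x (v x) (B x) l = a x l) (pdeg0 : pdeg d e e' = 0).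
Local Notation mv := (fun x : vec K => wedge x (v x)).
Local Notation mB := (fun x : vec K => wedge x (B x)).

Let hvU U : is_tfield F e U mv := tfield_sub (@subPP K U) hv.
Let hBU U : is_tfield F e' U mB := tfield_sub (@subPP K U) hB.

(** Cramer's rule: as [v] and [B] have pairing 1, the coordinates of [s] in this basis are its
    pairings with [B] and with [v]. *)
Let coord1 U (s : T U) : reg (pdeg d 2 e') U := mkreg (pairing_rg (tmat_tfield s) (hBU U)).
Let coord2 U (s : T U) : reg (pdeg d e 2) U := mkreg (pairing_rg (hvU U) (tmat_tfield s)).

Fact split_hom : is_hom ((fun U _ s => (coord1 s, coord2 s)) :
  Fam (fun U => T U) (dsum (Osh K (pdeg d 2 e')) (Osh K (pdeg d e 2))) (PP K)).
Proof.
have lin U (b : OO U) (s t : T U) e'' m x : is_tfield F e'' U m -> pts U x ->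
    pairing F 2 e'' U (tmat (b *: s + t)) m x =
    b x * pairing F 2 e'' U (tmat s) m x + pairing F 2 e'' U (tmat t) m x.
  move=> hm Ux; rewrite -(pairing_linl (rg_reg b) (tmat_tfield s) (tmat_tfield t) hm Ux).
  apply: (pairing_eq (t := m) _ hm) => // [|y i j Uy]; last by rewrite tmat_lin.
  apply: tfield_add (tmat_tfield t).
  by have := tfield_scale (rg_reg b) (tmat_tfield s); rewrite add0r.
split.
  move=> U UP b s t; congr pair; apply: reg_eqP => x Ux.
    rewrite -[RHS]/(b x * coord1 s x + coord1 t x) !mkregE //; exact: lin.
  rewrite -[RHS]/(b x * coord2 s x + coord2 t x) !mkregE //.
  rewrite !(pairing_sym (tmat_tfield _) (hvU U) Ux) lin //; ring.
move=> U V UP VP VU s; congr pair; apply: reg_eqP => x Vx.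
  rewrite [RHS](regRE VU (coord1 s) Vx) !mkregE //; last exact: VU.
  rewrite -(pairing_sub (tmat_tfield s) (hBU U) VU Vx).
  apply: (pairing_eq (t := mB) (tfield_sub VU (tmat_tfield s)) (hBU V)) => // y i j Vy.
  by rewrite tmat_res.
rewrite [RHS](regRE VU (coord2 s) Vx) !mkregE //; last exact: VU.
rewrite -(pairing_sub (hvU U) (tmat_tfield s) VU Vx).
apply: (pairing_eq (s := mv) (hvU V) (tfield_sub VU (tmat_tfield s))) => // y i j Vy.
by rewrite tmat_res.
Qed.

Fact combine_tfield U (f : reg (pdeg d 2 e') U) (g : reg (pdeg d e 2) U) :
  is_tfield F 2 U (fun x i j => f x * mv x i j + g x * mB x i j).
Proof.
have e1 : pdeg d 2 e' + e = 2 by rewrite -[RHS]add0r -[X in _ = X + _]pdeg0 /pdeg; ring.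
have e2 : pdeg d e 2 + e' = 2 by rewrite -[RHS]add0r -[X in _ = X + _]pdeg0 /pdeg; ring.
have h1 := tfield_scale (rg_reg f) (hvU U); rewrite e1 in h1.
have h2 := tfield_scale (rg_reg g) (hBU U); rewrite e2 in h2.
exact: tfield_add h1 h2.
Qed.

Lemma split_of_basis : is_split T.
Proof.
exists (pdeg d 2 e'), (pdeg d e 2); exists (mkhom split_hom) => U UP.
have hvB1 x : pts U x -> pairing F e e' U mv mB x = 1.
  apply: (pairing_unique (h := fun=> 1) (hvU U) (hBU U)).
    rewrite pdeg0; exact: rg_const.
  move=> y k l Uy; rewrite (@pair_mxE _ y (v y) (B y)) //.
  by rewrite hvB ?mulr1 //; exact: zopen_nz Uy.
exists (fun fg : reg (pdeg d 2 e') U * reg (pdeg d e 2) U => tsec (combine_tfield fg.1 fg.2)).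
  move=> s; apply: tmat_inj => x i j Ux; rewrite tmat_tsec //=.
  rewrite (indicE Ux) !mulr1.
  have := pairing_relation i j (hvU U) (hBU U) (tmat_tfield s) Ux.
  rewrite hvB1 // mul1r (pairing_sym (tmat_tfield s) (hBU U) Ux).
  rewrite (pairing_sym (hvU U) (tmat_tfield s) Ux) => E.
  by apply/eqP; rewrite -subr_eq0 -oppr_eq0 -[X in _ == X]E; apply/eqP; ring.
move=> [f g]; rewrite app_mkhom; congr pair; apply: reg_eqP => x Ux; rewrite mkregE //.
  apply: (pairing_unique (h := f) (tmat_tfield _) (hBU U) (rg_reg f)) => // y k l Uy.
  rewrite (@pair_mxE _ y (fun i => f y * v y i + g y * B y i) (B y)) //; last first.
    by move=> i j; rewrite tmat_tsec // /wedge /=; ring.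
  have -> : eta y (fun i => f y * v y i + g y * B y i) (B y) l = f y * eta y (v y) (B y) l.
    rewrite eta_sym (eq_eta (v' := B y) (x' := y) (w' := fun i => g y * B y i + f y * v y i)) //.
      by rewrite eta_span eta_sym; ring.
    by move=> i; rewrite addrC.
  by rewrite hvB; [ring|exact: zopen_nz Uy].
apply: (pairing_unique (h := g) (hvU U) (tmat_tfield _) (rg_reg g)) => // y k l Uy.
rewrite (@pair_mxE _ y (v y) (fun i => f y * v y i + g y * B y i)) //; last first.
  by move=> i j; rewrite tmat_tsec // /wedge /=; ring.
by rewrite eta_span hvB; [ring|exact: zopen_nz Uy].
Qed.
End SplitBasis.

Lemma degree_one_split : has_tfield F 1 -> is_split T.
Proof.
move=> [m [hm [x0 [i0 [j0 [nzx0 mx0]]]]]].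
have [v [mE av]] := linear_field hm.
have [p vp] : exists p, v p != 0.
  apply: contrapT => H; have v0 i : v i = 0.
    by apply: contrapT => /eqP vi; apply: H; exists i.
  by move: mx0; rewrite mE // /wedge !v0 !mulr0 subrr eqxx.
have [B [hB BE]] := coef_eta (ex_intro _ p vp) av.
apply: (@split_of_basis 1 d.+1%:Z (fun=> v) B) => //.
- exact: tfield_eq hm.
- split=> [i j|x nzx]; last first.
    exists (B x) => //; rewrite /dot -[RHS](dot_eta_last x v (B x)).
    by apply: eq_bigr => i _; rewrite BE.
  have e : d.+1%:Z = 1 + d%:Z by rewrite intS.
  by apply: rgB; apply: rgM e (rg_coord _ _) (hB _).
- by rewrite /pdeg; ring.
Qed.
End Splitting.

(** * Instability *)

Section Instability.
Variables (K : closedFieldType) (d : nat) (F : distribution K d).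
Local Notation T := (tangent F).

Lemma has_tfield_le e e' : e <= e' -> has_tfield F e -> has_tfield F e'.
Proof.
move=> ee' h; have [n ->] : exists n : nat, e' = n%:Z + e.
  by exists `|e' - e|%N; rewrite gez0_abs ?subr_ge0 // subrK.
elim: n {ee'} => [|n [m [hm [x [i [j [[k xk] mx]]]]]]]; first by rewrite add0r.
exists (fun x i j => x k * m x i j); split.
  by rewrite intS -addrA; exact: tfield_scale (rg_coord _ k) hm.
by exists x, i, j; split; [exists k | exact: mulf_neq0].
Qed.

(** Sections of [T(t - 1)] are matrices of degree [(t - 1) + 2]. *)
Definition least_tfield (t : int) : Prop :=
  has_tfield F (t + 1) /\ forall j, has_tfield F (j + 1) -> t <= j.

Lemma H0_twist_pred k : H0_neq0 (twist T (k - 1)) <-> has_tfield F (k + 1).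
Proof. by rewrite H0_twist -addrA. Qed.

Lemma min_twistE t : least_tfield t -> min_twist T = t.
Proof.
move=> [ht mt]; apply: xget_unique => [|s [/H0_twist_pred hs ms]].
  by split=> [|j]; rewrite H0_twist_pred //; exact: mt.
by apply/le_anti; rewrite mt // ms // H0_twist_pred.
Qed.

(* [min_twist] has the value 0 when the minimum does not exist. *)
Lemma min_twist_least : 1 <= min_twist T -> least_tfield (min_twist T).
Proof.
rewrite /min_twist; case: xgetP => [t _ [/H0_twist_pred ht mt] _|_ //].
by split=> // j /H0_twist_pred; exact: mt.
Qed.

(** For [t <= 0] there is a field of degree at most 1; multiplied by coordinates it reaches degree
    exactly 1, where [degree_one_split] applies. *)
Lemma least_tfield_gt0 t : ~ is_split T -> least_tfield t -> 1 <= t.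
Proof.
move=> nsplit [ht _]; rewrite leNgt; apply/negP => t1; apply: nsplit.
apply: degree_one_split; apply: has_tfield_le ht; lia.
Qed.

Variable eps : nat.
Hypotheses (eps1 : (eps <= 1)%N) (epsd : (eps = d %[mod 2])%N).

(** As [c1] is [2 - d], normalizing twists by [n = (d - 2 - eps) / 2] in both parities, and the
    degree [d - n - r] of the fields becomes [(d + eps) / 2 - r + 1]. *)
Lemma unstable_of_orderE r : unstable_of_order T r <->
  0 < r /\ least_tfield (((d%:Z + eps%:Z) %/ 2)%Z - r).
Proof.
have E s : H0_neq0 (twist (dual (normalization T)) (- s)) <->
    has_tfield F (((d%:Z + eps%:Z) %/ 2)%Z - s + 1).
  rewrite /normalization H0_twist_dual_twist c1_tangent.
  by set e := (X in has_tfield F X <-> _); set e' := (X in _ <-> has_tfield F X);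
    have -> : e = e' by rewrite /e /e'; case: ifP; lia.
split=> [[r0 /E hr mr]|[r0 [hr mr]]].
  split=> //; split=> // j hj.
  have := mr (((d%:Z + eps%:Z) %/ 2)%Z - j); rewrite E subKr => /(_ hj); lia.
by split=> // [|s /E/mr]; [apply/E | lia].
Qed.

Lemma unstable_tangent : ~ is_split T ->
  (unstable T <-> (3 <= d)%N /\ 1 <= min_twist T <= ((d%:Z - 2 + eps%:Z) %/ 2)%Z) /\
  (unstable T -> unstable_of_order T (((d%:Z + eps%:Z) %/ 2)%Z - min_twist T)).
Proof.
move=> nsplit; split; last first.
  move=> [r _ hr]; have /unstable_of_orderE[_ /min_twistE->] := hr.
  by rewrite subKr.
split=> [[r _ /unstable_of_orderE[r0 ht]]|[d3 /andP[t1 td]]].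
  (* From [1 <= (d + eps) / 2 - r] and [r >= 1] follows [d + eps >= 4], and thus [d >= 3] because
     [eps <= 1]. *)
  have := least_tfield_gt0 nsplit ht; rewrite (min_twistE ht); lia.
have ht := min_twist_least t1.
exists (((d%:Z + eps%:Z) %/ 2)%Z - min_twist T); first by lia.
by apply/unstable_of_orderE; split; [lia | rewrite subKr].
Qed.
End Instability.

Theorem lemma4p1 (R : realType) (d : nat) (F : distribution R[i]%C d)
    (eps : nat) :
  ~ is_split (tangent F) ->
  (eps <= 1)%N -> (eps = d %[mod 2])%N ->
  (unstable (tangent F) <->
     (3 <= d)%N /\
     1 <= min_twist (tangent F) <= ((d%:Z - 2 + eps%:Z) %/ 2)%Z) /\
  (unstable (tangent F) ->
     unstable_of_order (tangent F)
       (((d%:Z + eps%:Z) %/ 2)%Z - min_twist (tangent F))).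
Proof. by move=> nsplit eps1 epsd; exact: unstable_tangent. Qed.
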